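(* Let $N\ge 1$ and $k\ge 0$ be integers. The projective variety $(\mathbf{P}^N)^{(k)}:=\operatorname{Proj}\,(V^{\mathrm{diff}})^{(k)}$ compactifies in a natural fashion the $k$-th jet bundle $J_k\mathbf{P}^N$ of the projective space $\mathbf{P}^N$.
   Context: Fix $N\ge 1$. Consider formal variables $X_i^{(j)}$, $0\le i\le N$, $j\in\mathbb{N}$, and the algebra of differential polynomials $V=\mathbb{C}[X_i^{(j)}: 0\le i\le N,\ j\ge 0]$, graded by giving each variable degree $1$; $V_d$ is the degree-$d$ component. For $k\in\mathbb{N}$ put $V^{(k)}=\mathbb{C}[X_i^{(j)}: 0\le i\le N,\ 0\le j\le k]$. The group $\mathbb{C}[[T]]^{\times}$ of invertible formal power series acts on $V$ by algebra automorphisms: $\alpha\cdot P$ is obtained from $P$ by substituting $X_i^{(m)}\mapsto\sum_{j=0}^m\binom{m}{j}\alpha^{(m-j)}(0)X_i^{(j)}$, where $\alpha^{(s)}$ is the $s$-th formal derivative. $P\in V$ is differentially homogeneous of degree $d$ if $\alpha\cdot P=\alpha(0)^dP$ for all $\alpha\in\mathbb{C}[[T]]^\times$. Let $V_d^{\mathrm{diff}}\subset V_d$ be the space of such polynomials, $V^{\mathrm{diff}}=\bigoplus_{d}V_d^{\mathrm{diff}}$, and $(V^{\mathrm{diff}})^{(k)}=V^{\mathrm{diff}}\cap V^{(k)}$, a graded $\mathbb{C}$-algebra (the differentially homogeneous polynomials of order at most $k$). $J_k\mathbf{P}^N$ is the bundle of $k$-jets of germs of holomorphic curves traced on the complex projective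 space $\mathbf{P}^N$; as a scheme, it is obtained by glueing, for $0\le i\le N$, the affine schemes $\operatorname{Spec}\mathbb{C}[x_j^{(s)}: 0\le j\le N,\ j\ne i,\ 0\le s\le k]$ over the standard affine charts of $\mathbf{P}^N$. *)

(* Defs.v *)
From HB Require Import structures.
From mathcomp Require Import all_boot all_order all_algebra.
From mathcomp Require Import boolp classical_sets functions.
From mathcomp Require Import topology_structure sigT_topology quotient_topology.
From mathcomp Require Import mpoly ring.

Set Implicit Arguments.
Unset Strict Implicit.
Unset Printing Implicit Defensive.

Import GRing.Theory.
Local Open Scope ring_scope.
Local Open Scope classical_set_scope.

Notation "x %:F" := (@FracField.tofrac _ x) : ring_scope.

Definition unit_in (K : fieldType) (O : set K) (u : K) : Prop :=
  [/\ u != 0, O u & O u^-1].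

(* A locally ringed space over C whose structure sheaf is a subsheaf of the
   constant sheaf with value a field: [stalk x] is the local ring at x.  Every
   integral scheme over C is of this form, for its function field or any larger
   field. *)
Record lrspace (C : fieldType) := LRSpace {
  pts :> topologicalType;
  field_of : fieldType;
  cst : {rmorphism C -> field_of};
  stalk : pts -> set field_of;
  stalk_cst : forall x c, stalk x (cst c);
  stalkB : forall x u v, stalk x u -> stalk x v -> stalk x (u - v);
  stalkM : forall x u v, stalk x u -> stalk x v -> stalk x (u * v);
  stalk_local : forall x u v, stalk x u -> stalk x v ->
    unit_in (stalk x) (u + v) -> unit_in (stalk x) u \/ unit_in (stalk x) v;
  stalk_open : forall u, open [set x | stalk x u] }.

(* The sections over an open set U; the values of s outside U are irrelevant. *)
Definition sections (C : fieldType) (X : lrspace C) (U : set X) :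
    set (X -> field_of X) :=
  [set s | forall x, U x -> stalk x (s x) /\ \forall y \near x, s y = s x].

(* [mgerm x] stands for the map from the local ring at [mpt x] to the local ring
   at x; its values outside [stalk (mpt x)] are irrelevant. *)
Record lrmorphism (C : fieldType) (X Y : lrspace C) := LRMorphism {
  mpt :> X -> Y;
  mgerm : X -> field_of Y -> field_of X;
  m_continuous : continuous mpt;
  m_cst : forall x c, mgerm x (cst Y c) = cst X c;
  mB : forall x u v, stalk (mpt x) u -> stalk (mpt x) v ->
    mgerm x (u - v) = mgerm x u - mgerm x v;
  mM : forall x u v, stalk (mpt x) u -> stalk (mpt x) v ->
    mgerm x (u * v) = mgerm x u * mgerm x v;
  m_local : forall x u, stalk (mpt x) u ->
    unit_in (stalk x) (mgerm x u) -> unit_in (stalk (mpt x)) u;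
  m_sections : forall (U : set Y) s, open U -> sections U s ->
    sections (mpt @^-1` U) (fun x => mgerm x (s (mpt x))) }.

Definition open_immersion (C : fieldType) (X Y : lrspace C)
    (f : lrmorphism X Y) : Prop :=
  [/\ injective f, forall U : set X, open U -> open (f @` U) &
      forall x, set_bij (stalk (f x)) (stalk x) (mgerm f x)].

Definition closed_immersion (C : fieldType) (X Y : lrspace C)
    (f : lrmorphism X Y) : Prop :=
  [/\ injective f, forall Z : set X, closed Z -> closed (f @` Z) &
      forall x, set_surj (stalk (f x)) (stalk x) (mgerm f x)].

Definition irreducible_space (T : topologicalType) : Prop :=
  [set: T] !=set0 /\
  forall U V : set T, open U -> open V ->
    U !=set0 -> V !=set0 -> (U `&` V) !=set0.

Record prime_spec (A : idomainType) := PrimeSpec {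
  pset :> A -> Prop;
  pset0 : pset 0;
  psetB : forall a b, pset a -> pset b -> pset (a - b);
  psetMl : forall a b, pset b -> pset (a * b);
  pset1 : ~ pset 1;
  psetP : forall a b, pset (a * b) -> pset a \/ pset b }.

Section Spec.
Variable A : idomainType.

HB.instance Definition _ := gen_eqMixin (prime_spec A).
HB.instance Definition _ := gen_choiceMixin (prime_spec A).

Definition spec_open (U : set (prime_spec A)) : Prop :=
  exists E : set A, U = [set p : prime_spec A | exists2 f, E f & ~ p f].

Lemma spec_openT : spec_open setT.
Proof.
exists [set 1]; apply/seteqP; split=> p //= _.
by exists 1 => //; exact: pset1.
Qed.

Lemma spec_openI : setI_closed spec_open.
Proof.
move=> _ _ [E ->] [E' ->].
exists [set h | exists f g, [/\ E f, E' g & h = f * g]].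
apply/seteqP; split=> p /=.
  move=> [[f Ef pf] [g Eg pg]]; exists (f * g); first by exists f, g.
  by move=> /psetP[].
move=> [_ [f [g [Ef Eg ->]]] pfg]; split.
  by exists f => // pf; apply: pfg; rewrite mulrC; exact: psetMl.
by exists g => // pg; apply: pfg; exact: psetMl.
Qed.

Lemma spec_open_bigU (I : Type) (f : I -> set (prime_spec A)) :
  (forall i, spec_open (f i)) -> spec_open (\bigcup_i f i).
Proof.
move=> /choice[E fE]; exists (\bigcup_i E i).
apply/seteqP; split=> p /=.
  by move=> [i _]; rewrite fE => -[a Ea pa]; exists a => //; exists i.
by move=> [a [i _ Ea] pa]; exists i => //; rewrite fE; exists a.
Qed.

HB.instance Definition _ := isOpenTopological.Build (prime_spec A)
  spec_openT spec_openI spec_open_bigU.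

Definition loc_at (p : prime_spec A) : set {fraction A} :=
  [set u | exists a b, ~ p b /\ u = a%:F / b%:F].

Definition max_at (p : prime_spec A) : set {fraction A} :=
  [set u | exists a b, [/\ p a, ~ p b & u = a%:F / b%:F]].

Implicit Types (p : prime_spec A) (u v : {fraction A}).

Lemma notin_prime_neq0 p b : ~ p b -> b%:F != 0.
Proof. by move=> pb; rewrite tofrac_eq0; apply/eqP => b0; apply: pb; rewrite b0; exact: pset0. Qed.

Lemma pset_mulN p a b : ~ p a -> ~ p b -> ~ p (a * b).
Proof. by move=> pa pb /psetP[]. Qed.

Lemma loc_at_frac p a : loc_at p a%:F.
Proof. by exists a, 1; split; [exact: pset1 | rewrite tofrac1 divr1]. Qed.

Lemma loc_atB p u v : loc_at p u -> loc_at p v -> loc_at p (u - v).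
Proof.
move=> [a [b [pb ->]]] [c [d [pd ->]]].
exists (a * d - c * b), (b * d); split; first exact: pset_mulN.
rewrite -mulNr addf_div ?(notin_prime_neq0 pb) ?(notin_prime_neq0 pd)//.
by rewrite tofracB !tofracM mulNr.
Qed.

Lemma loc_atM p u v : loc_at p u -> loc_at p v -> loc_at p (u * v).
Proof.
move=> [a [b [pb ->]]] [c [d [pd ->]]].
exists (a * c), (b * d); split; first exact: pset_mulN.
by rewrite mulf_div !tofracM.
Qed.

Lemma max_at_frac p a : max_at p a%:F <-> p a.
Proof.
split=> [[c [b [pc pb /eqP]]]|pa]; last first.
  by exists a, 1; split=> //; [exact: pset1 | rewrite tofrac1 divr1].
rewrite -[X in X == _]divr1 -tofrac1 eqr_div ?(notin_prime_neq0 pb) ?tofrac1 ?oner_neq0//.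
rewrite mulr1 -tofracM tofrac_eq => /eqP cE.
by move: pc; rewrite -cE => /psetP[].
Qed.

Lemma loc_at_unit p u : loc_at p u -> ~ max_at p u -> unit_in (loc_at p) u.
Proof.
move=> [a [b [pb ->]]] nm.
have pa : ~ p a by move=> pa; apply: nm; exists a, b.
split; last by exists b, a; rewrite invf_div.
  by rewrite mulf_neq0 ?invr_eq0 ?(notin_prime_neq0 pa) ?(notin_prime_neq0 pb).
by exists a, b.
Qed.

Lemma max_at_loc p u : max_at p u -> loc_at p u.
Proof. by move=> [a [b [pa pb ->]]]; exists a, b. Qed.

Lemma max_atM p u v : loc_at p u -> max_at p v -> max_at p (u * v).
Proof.
move=> [a [b [pb ->]]] [c [d [pc pd ->]]].
exists (a * c), (b * d); split; [exact: psetMl|exact: pset_mulN|].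
by rewrite mulf_div !tofracM.
Qed.

Lemma max_atD p u v : max_at p u -> max_at p v -> max_at p (u + v).
Proof.
move=> [a [b [pa pb ->]]] [c [d [pc pd ->]]].
exists (a * d - (- c) * b), (b * d); split; last 2 first.
- exact: pset_mulN.
- by rewrite addf_div ?(notin_prime_neq0 pb) ?(notin_prime_neq0 pd)// mulNr opprK tofracD !tofracM.
apply: psetB; first by rewrite mulrC; exact: psetMl.
by rewrite mulrC -mulN1r mulrA; exact: psetMl.
Qed.

Lemma max_at_unit p u : max_at p u -> ~ unit_in (loc_at p) u.
Proof.
move=> mu [u0 _ lu]; have := max_atM lu mu; rewrite mulVf//.
by rewrite -tofrac1 => /max_at_frac; exact: pset1.
Qed.

Lemma max_atE p u : max_at p u <-> loc_at p u /\ ~ unit_in (loc_at p) u.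
Proof.
split=> [mu|[lu nu]]; first by split; [exact: max_at_loc|exact: max_at_unit].
by apply: contrapT => /(loc_at_unit lu).
Qed.

Lemma loc_at_local p u v : loc_at p u -> loc_at p v ->
  unit_in (loc_at p) (u + v) -> unit_in (loc_at p) u \/ unit_in (loc_at p) v.
Proof.
move=> lu lv uv; apply: contrapT => /not_orP[nu nv].
by apply: (@max_at_unit p (u + v)) => //; apply: max_atD; apply/max_atE.
Qed.

Lemma loc_at_open u : open [set p | loc_at p u].
Proof.
exists [set b | exists a, b != 0 /\ u = a%:F / b%:F].
apply/seteqP; split=> p /=.
  move=> [a [b [pb uE]]]; exists b => //; exists a; split=> //.
  by rewrite -tofrac_eq0 (notin_prime_neq0 pb).
by move=> [b [a [b0 uE]] pb]; exists a, b.
Qed.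

End Spec.

Section AffineScheme.
Variables (C : fieldType) (A : idomainType) (iota : {rmorphism C -> A}).

Definition spec : lrspace C :=
  @LRSpace C (prime_spec A) {fraction A} (@FracField.tofrac A \o iota)
    (@loc_at A) (fun p c => loc_at_frac p (iota c)) (@loc_atB A) (@loc_atM A)
    (@loc_at_local A) (@loc_at_open A).

End AffineScheme.

Record grading (C : fieldType) (A : idomainType) (iota : {rmorphism C -> A}) :=
  Grading {
    piece :> nat -> A -> Prop;
    piece0 : forall d, piece d 0;
    pieceB : forall d a b, piece d a -> piece d b -> piece d (a - b);
    pieceM : forall d e a b, piece d a -> piece e b -> piece (d + e)%N (a * b);
    piece_cst : forall c, piece 0%N (iota c);
    piece_direct : forall n (f : nat -> A), (forall d, piece d (f d)) ->
      \sum_(d < n) f d = 0 -> forall d, (d < n)%N -> f d = 0 }.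

(* The graded C-subalgebra of A which is the direct sum of the pieces. *)
Definition total (C : fieldType) (A : idomainType) (iota : {rmorphism C -> A})
    (S : grading iota) : set A :=
  [set a | exists n f, (forall d, S d (f d)) /\ a = \sum_(d < n) f d].

(* The homogeneous primes of the graded algebra that do not contain its
   irrelevant ideal. *)
Record proj_spec (C : fieldType) (A : idomainType) (iota : {rmorphism C -> A})
    (S : grading iota) := ProjSpec {
  hset :> A -> Prop;
  hset_total : hset `<=` total S;
  hset0 : hset 0;
  hsetB : forall a b, hset a -> hset b -> hset (a - b);
  hsetMl : forall a b, total S a -> hset b -> hset (a * b);
  hsetP : forall a b, total S a -> total S b ->
    hset (a * b) -> hset a \/ hset b;
  hset_homog : forall n (f : nat -> A), (forall d, S d (f d)) ->
    hset (\sum_(d < n) f d) -> forall d, (d < n)%N -> hset (f d);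
  hset_irrelevant : exists d a, [/\ (0 < d)%N, S d a & ~ hset a] }.

Section Proj.
Variables (C : fieldType) (A : idomainType) (iota : {rmorphism C -> A}).
Variable S : grading iota.

HB.instance Definition _ := gen_eqMixin (proj_spec S).
HB.instance Definition _ := gen_choiceMixin (proj_spec S).

Implicit Types (p : proj_spec S) (u v : {fraction A}).

Lemma total_piece d a : S d a -> total S a.
Proof.
move=> Sa; exists d.+1, (fun e => if e == d then a else 0); split.
  by move=> e; case: eqP => [->//|_]; exact: piece0.
rewrite big_ord_recr/= eqxx big1 ?add0r// => i _.
by rewrite ltn_eqF.
Qed.

Definition proj_open (U : set (proj_spec S)) : Prop :=
  exists E : set A, E `<=` [set a | exists d, S d a] /\
    U = [set p : proj_spec S | exists2 f, E f & ~ p f].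

Lemma proj_openT : proj_open setT.
Proof.
exists [set a | exists d, S d a]; split=> //.
apply/seteqP; split=> p //= _.
by have [d [a [_ Sa pa]]] := hset_irrelevant p; exists a => //; exists d.
Qed.

Lemma proj_openI : setI_closed proj_open.
Proof.
move=> _ _ [E [SE ->]] [E' [SE' ->]].
exists [set h | exists f g, [/\ E f, E' g & h = f * g]]; split.
  move=> _ [f [g [/SE[d Sf] /SE'[e Sg] ->]]].
  by exists (d + e)%N; exact: pieceM.
apply/seteqP; split=> p /=.
  move=> [[f Ef pf] [g Eg pg]]; exists (f * g); first by exists f, g.
  have [[d Sf] [e Sg]] := (SE _ Ef, SE' _ Eg).
  by move=> /hsetP[] //; [exact: total_piece Sf|exact: total_piece Sg].
move=> [_ [f [g [Ef Eg ->]]] pfg].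
have [[d Sf] [e Sg]] := (SE _ Ef, SE' _ Eg); split.
  by exists f => // pf; apply: pfg; rewrite mulrC; apply: hsetMl => //; exact: total_piece Sg.
by exists g => // pg; apply: pfg; apply: hsetMl => //; exact: total_piece Sf.
Qed.

Lemma proj_open_bigU (I : Type) (f : I -> set (proj_spec S)) :
  (forall i, proj_open (f i)) -> proj_open (\bigcup_i f i).
Proof.
move=> /choice[E fE]; exists (\bigcup_i E i); split.
  by move=> a [i _]; exact: (fE i).1.
apply/seteqP; split=> p /=.
  by move=> [i _]; rewrite (fE i).2 => -[a Ea pa]; exists a => //; exists i.
by move=> [a [i _ Ea] pa]; exists i => //; rewrite (fE i).2; exists a.
Qed.

HB.instance Definition _ := isOpenTopological.Build (proj_spec S)
  proj_openT proj_openI proj_open_bigU.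

Definition hloc_at (p : proj_spec S) : set {fraction A} :=
  [set u | exists d a b, [/\ S d a, S d b, ~ p b & u = a%:F / b%:F]].

Lemma notin_hprime_neq0 p b : ~ p b -> b%:F != 0.
Proof.
by move=> pb; rewrite tofrac_eq0; apply/eqP => b0; apply: pb; rewrite b0; exact: hset0.
Qed.

Lemma hset_mulN p d e a b : S d a -> S e b -> ~ p a -> ~ p b -> ~ p (a * b).
Proof. by move=> /total_piece Sa /total_piece Sb pa pb /hsetP[]. Qed.

Lemma hset1 p : ~ p 1.
Proof.
move=> p1; have [d [a [_ Sa]]] := hset_irrelevant p; apply.
by rewrite -(mulr1 a); apply: hsetMl => //; exact: total_piece Sa.
Qed.

Lemma hloc_at_cst p c : hloc_at p (iota c)%:F.
Proof.
exists 0%N, (iota c), 1; split; [exact: piece_cst| |exact: hset1|].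
  by rewrite -(rmorph1 iota); exact: piece_cst.
by rewrite tofrac1 divr1.
Qed.

Lemma hloc_atB p u v : hloc_at p u -> hloc_at p v -> hloc_at p (u - v).
Proof.
move=> [d [a [b [Sa Sb pb ->]]]] [e [a' [b' [Sa' Sb' pb' ->]]]].
exists (d + e)%N, (a * b' - a' * b), (b * b'); split.
- by apply: pieceB; [exact: pieceM|rewrite addnC; exact: pieceM].
- exact: pieceM.
- exact: (hset_mulN Sb Sb').
by rewrite -mulNr addf_div ?(notin_hprime_neq0 pb) ?(notin_hprime_neq0 pb')// tofracB !tofracM mulNr.
Qed.

Lemma hloc_atM p u v : hloc_at p u -> hloc_at p v -> hloc_at p (u * v).
Proof.
move=> [d [a [b [Sa Sb pb ->]]]] [e [a' [b' [Sa' Sb' pb' ->]]]].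
exists (d + e)%N, (a * a'), (b * b'); split; [exact: pieceM|exact: pieceM| |].
  exact: (hset_mulN Sb Sb').
by rewrite mulf_div !tofracM.
Qed.

Lemma hloc_at_unit p d a b : S d a -> S d b -> ~ p a -> ~ p b ->
  unit_in (hloc_at p) (a%:F / b%:F).
Proof.
move=> Sa Sb pa pb; split.
- by rewrite mulf_neq0 ?invr_eq0 ?(notin_hprime_neq0 pa) ?(notin_hprime_neq0 pb).
- by exists d, a, b.
- by exists d, b, a; rewrite invf_div.
Qed.

Lemma hloc_at_local p u v : hloc_at p u -> hloc_at p v ->
  unit_in (hloc_at p) (u + v) -> unit_in (hloc_at p) u \/ unit_in (hloc_at p) v.
Proof.
move=> [d [a [b [Sa Sb pb ->]]]] [e [a' [b' [Sa' Sb' pb' ->]]]].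
have [pa|pa] := pselect (p a); last by left; exact: hloc_at_unit Sa Sb pa pb.
have [pa'|pa'] := pselect (p a'); last by right; exact: hloc_at_unit Sa' Sb' pa' pb'.
rewrite addf_div ?(notin_hprime_neq0 pb) ?(notin_hprime_neq0 pb')//.
rewrite -!tofracM -tofracD => -[n0 _ [f [g [h [Sg Sh ph]]]]].
rewrite invf_div => /eqP; rewrite eqr_div ?(notin_hprime_neq0 ph)//; last first.
  by move: n0; rewrite mulf_eq0 negb_or => /andP[].
rewrite -!tofracM tofrac_eq => /eqP E; exfalso.
apply: (hset_mulN (pieceM Sb Sb') Sh (hset_mulN Sb Sb' pb pb') ph).
rewrite E; apply: hsetMl; first exact: total_piece Sg.
rewrite -[a' * b]opprK; apply: hsetB.
  by rewrite mulrC; apply: hsetMl => //; exact: total_piece Sb'.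
rewrite -mulN1r; apply: hsetMl.
  by apply: (@total_piece 0); rewrite -(rmorph1 iota) -rmorphN; exact: piece_cst.
by rewrite mulrC; apply: hsetMl => //; exact: total_piece Sb.
Qed.

Lemma hloc_at_open u : open [set p | hloc_at p u].
Proof.
exists [set b | exists d a, [/\ S d a, S d b, b != 0 & u = a%:F / b%:F]]; split.
  by move=> b [d [a [_ Sb _ _]]]; exists d.
apply/seteqP; split=> p /=.
  move=> [d [a [b [Sa Sb pb uE]]]]; exists b => //; exists d, a; split=> //.
  by rewrite -tofrac_eq0 (notin_hprime_neq0 pb).
by move=> [b [d [a [Sa Sb b0 uE]]] pb]; exists d, a, b.
Qed.

Definition Proj : lrspace C :=
  @LRSpace C (proj_spec S) {fraction A} (@FracField.tofrac A \o iota)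
    hloc_at hloc_at_cst hloc_atB hloc_atM hloc_at_local hloc_at_open.

(* The standard open set D_+(f). *)
Definition proj_basic (f : A) : set Proj := [set p : proj_spec S | ~ p f].

End Proj.

Section PolynomialGrading.
Variables (C : fieldType) (n : nat).

Lemma dhomog_direct m (f : nat -> {mpoly C[n]}) :
  (forall d, f d \is d.-homog) -> \sum_(d < m) f d = 0 ->
  forall d, (d < m)%N -> f d = 0.
Proof.
move=> fh f0 d dm; apply/mpolyP => mon; rewrite mcoeff0.
have [md|md] := eqVneq (mdeg mon) d; last exact: dhomog_nemf_coeff (fh d) md.
have := congr1 (mcoeff mon) f0; rewrite mcoeff0 raddf_sum/=.
rewrite (bigD1 (Ordinal dm))//= big1 ?addr0// => i ine.
apply: (dhomog_nemf_coeff (fh i)) => /=; rewrite md.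
by apply: contraNneq ine => E; apply/eqP/val_inj.
Qed.

Definition standard_grading : grading (@mpolyC n C).
Proof.
exists (fun d (P : {mpoly C[n]}) => P \is d.-homog).
- by move=> d; exact: dhomog0.
- by move=> d P Q Ph Qh; apply: dhomogD => //; rewrite dhomogN.
- by move=> d e P Q; exact: dhomogM.
- by move=> c; rewrite /= -[c%:MP]mulr1 mul_mpolyC; apply: dhomogZ; exact: dhomog1.
- exact: dhomog_direct.
Defined.

End PolynomialGrading.

Definition projective_space (C : fieldType) (n : nat) : lrspace C :=
  Proj (standard_grading C n.+1).

Definition projective_variety (C : fieldType) (X : lrspace C) : Prop :=
  irreducible_space X /\
  exists (n : nat) (f : lrmorphism X (projective_space C n)), closed_immersion f.

Section Jets.
Variable k : nat.

(* A row u stands for the jet (u, u', ..., u^(k)); by the Leibniz rule,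
   (u v)^(s) = \sum_r 'C(s, r) u^(r) v^(s-r). *)
Definition leibniz (R : comNzRingType) (v : 'rV[R]_k.+1) : 'M[R]_k.+1 :=
  \matrix_(r, s) (v 0 (inord (s - r)) *+ 'C(s, r)).

Definition jet_div (F : fieldType) (u v : 'rV[F]_k.+1) : 'rV[F]_k.+1 :=
  u *m invmx (leibniz v).

Definition jet1 (R : nzRingType) : 'rV[R]_k.+1 := \row_s (s == 0)%:R.

Lemma leibniz1 (R : comNzRingType) : leibniz (jet1 R) = 1%:M.
Proof.
apply/matrixP => r s; rewrite !mxE -val_eqE /= inordK; last first.
  by rewrite ltnS (leq_trans (leq_subr _ _))// -ltnS.
rewrite subn_eq0 -val_eqE /=.
by case: (ltngtP r s) => [rs|sr|->]; rewrite ?mul0rn ?binn // bin_small.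
Qed.

Lemma leibniz_mul (R : comNzRingType) (u v : 'rV[R]_k.+1) :
  leibniz (u *m leibniz v) = leibniz u *m leibniz v.
Proof.
apply/matrixP => r s; rewrite !mxE.
have lek (x : 'I_k.+1) : (x <= k)%N by rewrite -ltnS.
have [rs|sr] := leqP r s; last first.
  rewrite bin_small// mulr0n big1// => t _; rewrite !mxE.
  have [rt|tr] := leqP r t; last by rewrite bin_small// mulr0n mul0r.
  by rewrite (@bin_small s) ?mulr0n ?mulr0// (leq_trans sr).
pose G (t : nat) := u 0 (inord (t - r)) *+ 'C(t, r) *
  (v 0 (inord (s - t)) *+ 'C(s, t)).
transitivity (\sum_(0 <= t < k.+1) G t); last first.
  by rewrite big_mkord; apply: eq_bigr => t _; rewrite !mxE.
rewrite (@big_cat_nat _ _ _ r)//=; last by rewrite (leq_trans rs) // ltnW.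
rewrite [X in _ = X + _]big_nat [X in _ = X + _]big1 ?add0r; last first.
  by move=> t /andP[_ tr]; rewrite /G bin_small// mulr0n mul0r.
have -> : \sum_(r <= t < k.+1) G t = \sum_(0 <= j < k.+1 - r) G (j + r)%N.
  by rewrite -{1}[nat_of_ord r]add0n big_addn.
pose H (j : nat) := (u 0 (inord j) * (v 0 (inord (s - r - j)) *+ 'C(s - r, j))) *+ 'C(s, r).
have sr : (s - r <= k)%N by rewrite (leq_trans (leq_subr _ _)).
transitivity (\sum_(0 <= j < k.+1) H j).
  rewrite big_mkord -sumrMnl; apply: eq_bigr => j _.
  rewrite !mxE /H inord_val; congr (_ * (_ *+ 'C(_, _)) *+ _) => //.
    by rewrite inordK.
  by rewrite inordK.
rewrite (@big_cat_nat _ _ _ (k.+1 - r))//=; last exact: leq_subr.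
rewrite [X in _ + X]big_nat [X in _ + X]big1 ?addr0; last first.
  move=> j /andP[jr _]; rewrite /H bin_small ?mulr0n ?mulr0 ?mul0rn//.
  apply: leq_trans jr; rewrite ltn_sub2r// ltnS//.
apply: eq_big_nat => j _; rewrite /H /G addnK.
rewrite -subnDA [(r + j)%N]addnC.
rewrite mulrnAr mulrnAl mulrnAr -!mulrnA; congr (_ *+ _).
have [js|sj] := leqP (j + r) s; last first.
  by rewrite [in RHS]bin_small// [in LHS]bin_small// -(ltn_add2r r) subnK.
apply/eqP; rewrite -(eqn_pmul2r (fact_gt0 j)) -(eqn_pmul2r (fact_gt0 r)) -(eqn_pmul2r (fact_gt0 (s - (j + r)))).
have E1 := bin_fact rs.
have E2 : ('C(s - r, j) * (j`! * (s - (j + r))`!) = (s - r)`!)%N.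
  rewrite [(j + r)%N]addnC subnDA bin_fact//.
  by rewrite leq_subRL// addnC.
have E3 := bin_fact js.
have E4 : ('C(j + r, r) * (r`! * j`!) = (j + r)`!)%N.
  by have := @bin_fact (j + r) r (leq_addl _ _); rewrite addnK.
apply/eqP; transitivity (s`!).
  by rewrite -E1 -E2; ring.
by rewrite -E3 -E4; ring.
Qed.

Lemma det_leibniz (R : comNzRingType) (v : 'rV[R]_k.+1) :
  \det (leibniz v) = v 0 0 ^+ k.+1.
Proof.
rewrite -det_tr det_trig.
  rewrite (eq_bigr (fun=> v 0 0)) ?prodr_const ?card_ord// => i _.
  rewrite !mxE subnn binn; congr (v 0 _); apply/val_inj => /=; by rewrite inordK.
apply/is_trig_mxP => i j ij; rewrite !mxE bin_small//.
Qed.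

Lemma leibniz_unit (F : fieldType) (v : 'rV[F]_k.+1) :
  v 0 0 != 0 -> leibniz v \in unitmx.
Proof. by move=> v0; rewrite unitmxE det_leibniz unitrX// unitfE. Qed.

Lemma jet_divK (F : fieldType) (u v : 'rV[F]_k.+1) :
  v 0 0 != 0 -> jet_div u v *m leibniz v = u.
Proof. by move=> v0; rewrite mulmxKV// leibniz_unit. Qed.

Lemma jet_mul0 (R : comNzRingType) (u v : 'rV[R]_k.+1) :
  (u *m leibniz v) 0 0 = u 0 0 * v 0 0.
Proof.
rewrite mxE (bigD1 0)//= big1 ?addr0.
  rewrite mxE subnn bin0; congr (_ * v 0 _); apply/val_inj; by rewrite /= inordK.
move=> i i0; rewrite mxE bin_small ?mulr0n ?mulr0//.
by rewrite lt0n; apply: contraNneq i0 => E; apply/eqP/val_inj.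
Qed.

Lemma jet_div0 (F : fieldType) (u v : 'rV[F]_k.+1) :
  v 0 0 != 0 -> jet_div u v 0 0 = u 0 0 / v 0 0.
Proof. by move=> v0; rewrite -{2}(jet_divK u v0) jet_mul0 mulfK. Qed.

Lemma leibniz_div (F : fieldType) (u v : 'rV[F]_k.+1) :
  v 0 0 != 0 -> leibniz (jet_div u v) = leibniz u *m invmx (leibniz v).
Proof.
move=> v0; apply: (can_inj (mulmxK (leibniz_unit v0))).
by rewrite mulmxKV ?leibniz_unit// -leibniz_mul jet_divK.
Qed.

Lemma jet_div_div (F : fieldType) (u v w : 'rV[F]_k.+1) :
  v 0 0 != 0 -> w 0 0 != 0 ->
  jet_div (jet_div u w) (jet_div v w) = jet_div u v.
Proof.
move=> v0 w0.
have vw0 : jet_div v w 0 0 != 0 by rewrite jet_div0// mulf_neq0// invr_eq0.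
apply: (can_inj (mulmxK (leibniz_unit vw0))).
by rewrite jet_divK// leibniz_div// mulmxA jet_divK.
Qed.

Lemma jet_div1 (F : fieldType) (u : 'rV[F]_k.+1) : jet_div u (jet1 F) = u.
Proof. by rewrite /jet_div leibniz1 invmx1 mulmx1. Qed.

Lemma jet_divv (F : fieldType) (u : 'rV[F]_k.+1) :
  u 0 0 != 0 -> jet_div u u = jet1 F.
Proof.
move=> u0; apply: (can_inj (mulmxK (leibniz_unit u0))); rewrite jet_divK//.
apply/rowP => s; rewrite mxE (bigD1 0)//= big1 ?addr0; last first.
  by move=> i i0; rewrite mxE (negPf i0) mul0r.
by rewrite !mxE eqxx mul1r bin0 subn0 inord_val.
Qed.

Lemma map_leibniz (R S : comNzRingType) (f : {rmorphism R -> S})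
    (v : 'rV[R]_k.+1) : map_mx f (leibniz v) = leibniz (map_mx f v).
Proof. by apply/matrixP => r s; rewrite !mxE rmorphMn. Qed.

Lemma map_jet_div (F G : fieldType) (f : {rmorphism F -> G})
    (u v : 'rV[F]_k.+1) :
  map_mx f (jet_div u v) = jet_div (map_mx f u) (map_mx f v).
Proof. by rewrite map_mxM map_invmx map_leibniz. Qed.

Lemma map_jet1 (R S : nzRingType) (f : {rmorphism R -> S}) :
  map_mx f (jet1 R) = jet1 S.
Proof. by apply/rowP => s; rewrite !mxE rmorph_nat. Qed.

End Jets.

(* The extension to fractions of an injective ring morphism into a field. *)
Definition frac_lift (A : idomainType) (F : fieldType) (f : A -> F)
    (u : {fraction A}) : F :=
  f (\n_(repr u)) / f (\d_(repr u)).

Section FracLift.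
Variables (A : idomainType) (F : fieldType) (f : {rmorphism A -> F}).
Hypothesis f_inj : forall a, f a = 0 -> a = 0.

Lemma fracE (u : {fraction A}) : u = (\n_(repr u))%:F / (\d_(repr u))%:F.
Proof.
have d0 : \d_(repr u) != 0 := denom_ratioP _.
have d0' : (\d_(repr u))%:F != 0 by rewrite tofrac_eq0.
apply: (mulIf d0'); rewrite divfK//.
rewrite -{1}[u]reprK; move: (repr u) d0 {d0'} => x d0.
have : FracField.mul (\pi_{fraction A}%qT x) (\d_x)%:F = (\n_x)%:F; last by [].
rewrite !piE; apply/eqmodP; rewrite /= FracField.equivfE /FracField.mulf.
by rewrite !numden_Ratio ?oner_neq0 ?mulf_neq0 ?oner_neq0// !mulr1 mulrC.
Qed.

Lemma frac_liftE a b : b != 0 -> frac_lift f (a%:F / b%:F) = f a / f b.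
Proof.
move=> b0; have fb0 (c : A) : c != 0 -> f c != 0.
  by apply: contraNneq => /f_inj ->.
rewrite /frac_lift; set u := a%:F / b%:F; have uE := fracE u.
have d0 : \d_(repr u) != 0 := denom_ratioP _.
apply/eqP; rewrite eqr_div ?fb0// -!rmorphM; apply/eqP; congr (f _); apply/eqP.
move: uE; rewrite {1}/u => /eqP; rewrite eqr_div ?tofrac_eq0//.
by rewrite -!tofracM tofrac_eq eq_sym.
Qed.

Lemma frac_lift_frac a : frac_lift f a%:F = f a.
Proof.
rewrite -[a%:F]divr1 -tofrac1 frac_liftE ?oner_neq0//.
by rewrite rmorph1 divr1.
Qed.

Lemma fracP (u : {fraction A}) : exists a b, b != 0 /\ u = a%:F / b%:F.
Proof.
by exists \n_(repr u), \d_(repr u); split; [exact: denom_ratioP|exact: fracE].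
Qed.

Lemma frac_lift_zmod : zmod_morphism (frac_lift f).
Proof.
move=> u v; have [a [b [b0 ->]]] := fracP u; have [c [d [d0 ->]]] := fracP v.
have fb0 (e : A) : e != 0 -> f e != 0 by apply: contraNneq => /f_inj ->.
rewrite -mulNr addf_div ?tofrac_eq0// -tofracN -!tofracM -tofracD.
rewrite !frac_liftE ?mulf_neq0// -mulNr addf_div ?fb0//.
by rewrite rmorphD !rmorphM rmorphN.
Qed.

Lemma frac_lift_monoid : monoid_morphism (frac_lift f).
Proof.
split; first by rewrite -tofrac1 frac_lift_frac rmorph1.
move=> u v; have [a [b [b0 ->]]] := fracP u; have [c [d [d0 ->]]] := fracP v.
by rewrite mulf_div -!tofracM !frac_liftE ?mulf_neq0// mulf_div !rmorphM.
Qed.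

End FracLift.

Section JetBundle.
Variables (C : fieldType) (N k : nat).

Definition chart_ring : idomainType := {mpoly C[N * k.+1]}.
Local Notation A := chart_ring.
Local Notation F := {fraction A}.

(* In the i-th chart the homogeneous coordinates are normalized by x_i = 1: the
   jet of the i-th one is that of the constant 1, and the variable of index
   [mxvec_index j s] is the coordinate x_(lift i j)^(s). *)
Definition hcoord (i j : 'I_N.+1) : 'rV[A]_k.+1 :=
  if unlift i j is Some j' then \row_s 'X_(mxvec_index j' s) else jet1 k A.

Definition hcoordF (i j : 'I_N.+1) : 'rV[F]_k.+1 :=
  map_mx (@FracField.tofrac A) (hcoord i j).

(* The coordinate functions of the l-th chart, as functions on the i-th one:
   x_j is replaced by x_j / x_l, and x_j^(s) by the s-th derivative of this
   quotient. *)
Definition trans (i l : 'I_N.+1) : A -> F :=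
  mmap (@FracField.tofrac A \o @mpolyC (N * k.+1) C)
    (mxvec (\matrix_(j < N, s < k.+1)
              jet_div (hcoordF i (lift l j)) (hcoordF i l) 0 s) 0).

Definition transF (i l : 'I_N.+1) : F -> F := frac_lift (trans i l).

(* The open set x_l <> 0 of the i-th chart is glued to the open set x_i <> 0 of
   the l-th one along the isomorphism defined by [trans i l]. *)
Definition glued (x y : {i : 'I_N.+1 & prime_spec A}) : Prop :=
  let: existT i p := x in let: existT l q := y in
  ~ p (hcoord i l 0 0) /\ forall a, q a <-> max_at p (trans i l a).

HB.instance Definition _ (i l : 'I_N.+1) := GRing.RMorphism.on (trans i l).

Local Notation cF c := ((c%:MP : A)%:F : F).

Lemma chart_ind (P : A -> Prop) :
  (forall c, P c%:MP) -> (forall j s, P 'X_(mxvec_index j s)) ->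
  (forall a b, P a -> P b -> P (a + b)) ->
  (forall a b, P a -> P b -> P (a * b)) -> forall a, P a.
Proof.
move=> PC PX PD PM a; rewrite [a]mpolyE; apply: (big_ind P) => //.
  by have := PC 0; rewrite mpolyC0.
move=> m _; rewrite -mul_mpolyC; apply: (PM) => //; rewrite mpolyXE_id.
apply: (big_ind P) => //; first by have := PC 1; rewrite mpolyC1.
move=> v _; elim: (m v) => [|e IH].
  by rewrite expr0; have := PC 1; rewrite mpolyC1.
by rewrite exprS; apply: PM => //; case: (mxvec_indexP v) => *; exact: PX.
Qed.

Lemma chart_morph (S : pzRingType) (f g : {rmorphism A -> S}) :
  (forall c, f c%:MP = g c%:MP) ->
  (forall j s, f 'X_(mxvec_index j s) = g 'X_(mxvec_index j s)) -> f =1 g.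
Proof.
move=> fgC fgX; apply: chart_ind => // a b fa fb.
  by rewrite !rmorphD fa fb.
by rewrite !rmorphM fa fb.
Qed.

Lemma transC i l c : trans i l c%:MP = cF c.
Proof. by rewrite /trans mmapC. Qed.

Lemma transX i l j s : trans i l 'X_(mxvec_index j s) =
  jet_div (hcoordF i (lift l j)) (hcoordF i l) 0 s.
Proof. by rewrite /trans mmapX mmap1U mxvecE mxE. Qed.

Lemma hcoord_lift i j : hcoord i (lift i j) = \row_s 'X_(mxvec_index j s).
Proof. by rewrite /hcoord liftK. Qed.

Lemma hcoordii i : hcoord i i = jet1 k A.
Proof. by rewrite /hcoord unlift_none. Qed.

Lemma hcoordFii i : hcoordF i i = jet1 k F.
Proof. by rewrite /hcoordF hcoordii map_jet1. Qed.

Lemma mpolyX_neq0 n (v : 'I_n) : ('X_v : {mpoly C[n]}) != 0.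
Proof. by rewrite -msize_poly_eq0 msizeX. Qed.

Lemma hcoord_neq0 i j : hcoord i j 0 0 != 0.
Proof.
rewrite /hcoord; case: unlift => [j'|]; rewrite mxE ?eqxx ?oner_neq0//.
exact: mpolyX_neq0.
Qed.

Lemma hcoordF_neq0 i j : hcoordF i j 0 0 != 0.
Proof. by rewrite mxE tofrac_eq0 hcoord_neq0. Qed.

Lemma map_trans i l j :
  map_mx (trans i l) (hcoord l j) = jet_div (hcoordF i j) (hcoordF i l).
Proof.
have [->|nlj] := eqVneq l j.
  by rewrite hcoordii map_jet1 jet_divv// hcoordF_neq0.
have [j' -> _] := unlift_some nlj.
by apply/rowP => s; rewrite mxE hcoord_lift mxE transX.
Qed.

Lemma trans_coord i l j :
  trans i l (hcoord l j 0 0) = hcoordF i j 0 0 / hcoordF i l 0 0.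
Proof.
by have /rowP/(_ 0) := map_trans i l j; rewrite mxE jet_div0 ?hcoordF_neq0.
Qed.

Lemma trans_coord_neq0 i l j : trans i l (hcoord l j 0 0) != 0.
Proof. by rewrite trans_coord mulf_neq0 ?invr_eq0 ?hcoordF_neq0. Qed.

Lemma jet_divE (u v : 'rV[F]_k.+1) : v 0 0 != 0 ->
  jet_div u v = (v 0 0 ^- k.+1) *: (u *m \adj (leibniz v)).
Proof.
move=> v0; rewrite /jet_div /invmx leibniz_unit// det_leibniz.
by rewrite -scalemxAr.
Qed.

Lemma trans_denom i l a : exists n c,
  trans i l a * hcoordF i l 0 0 ^+ n = c%:F /\
  trans l i c = a%:F * trans l i (hcoord i l 0 0) ^+ n.
Proof.
have x0 := hcoordF_neq0 i l.
have xE : hcoordF i l 0 0 = (hcoord i l 0 0)%:F by rewrite mxE.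
elim/chart_ind: a => [c|j s|a b [n [c [cE cE']]] [m [d [dE dE']]]|
    a b [n [c [cE cE']]] [m [d [dE dE']]]].
- by exists 0%N, c%:MP; rewrite !expr0 !mulr1 !transC.
- pose u := hcoord i (lift l j); pose w := hcoord i l.
  exists k.+1, ((u *m \adj (leibniz w)) 0 s); split.
    rewrite transX jet_divE// mxE mulrAC mulVf ?mul1r ?expf_neq0//.
    have -> : ((u *m \adj (leibniz w)) 0 s)%:F =
      map_mx (@FracField.tofrac A) (u *m \adj (leibniz w)) 0 s by rewrite [RHS]mxE.
    by rewrite map_mxM map_mx_adj map_leibniz.
  have -> : trans l i ((u *m \adj (leibniz w)) 0 s) =
      map_mx (trans l i) (u *m \adj (leibniz w)) 0 s by rewrite [RHS]mxE.
  rewrite map_mxM map_mx_adj map_leibniz !map_trans.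
  have d0 : jet_div (hcoordF l l) (hcoordF l i) 0 0 = trans l i (hcoord i l 0 0).
    by rewrite -map_trans mxE.
  have := @jet_divE (jet_div (hcoordF l (lift l j)) (hcoordF l i))
     (jet_div (hcoordF l l) (hcoordF l i)).
  rewrite d0 => /(_ (trans_coord_neq0 _ _ _)).
  rewrite jet_div_div ?hcoordF_neq0//.
  rewrite hcoordFii jet_div1 => /(congr1 (fun v : 'rV[F]_k.+1 => v 0 s)).
  rewrite [RHS]mxE [X in X = _]mxE hcoord_lift mxE => ->.
  by rewrite mulrAC mulVf ?mul1r ?expf_neq0 ?trans_coord_neq0.
- exists (n + m)%N, (c * hcoord i l 0 0 ^+ m + d * hcoord i l 0 0 ^+ n); split.
    rewrite tofracD !tofracM !tofracXn -xE -cE -dE rmorphD exprD.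
    by rewrite mulrDl !mulrA (mulrAC _ (_ ^+ n) (_ ^+ m)) [in X in _ + X]mulrAC.
  rewrite !(rmorphD, rmorphM, rmorphXn)/= cE' dE' exprD mulrDl !mulrA.
  by rewrite [in X in _ + X]mulrAC.
exists (n + m)%N, (c * d); split.
  by rewrite tofracM -cE -dE rmorphM exprD mulrACA.
by rewrite rmorphM/= cE' dE' tofracM exprD mulrACA.
Qed.

Lemma trans_inj i l a : trans i l a = 0 -> a = 0.
Proof.
move=> a0; have [n [c [cE cE']]] := trans_denom i l a.
have c0 : c = 0.
  by apply/eqP; rewrite -tofrac_eq0 -cE a0 mul0r.
move: cE'; rewrite c0 rmorph0 => /esym/eqP.
by rewrite mulf_eq0 tofrac_eq0 expf_eq0 (negPf (trans_coord_neq0 _ _ _)) andbF orbF => /eqP.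
Qed.

HB.instance Definition _ (i l : 'I_N.+1) :=
  GRing.isZmodMorphism.Build F F (transF i l) (frac_lift_zmod (@trans_inj i l)).
HB.instance Definition _ (i l : 'I_N.+1) :=
  GRing.isMonoidMorphism.Build F F (transF i l)
    (frac_lift_monoid (@trans_inj i l)).

Lemma transF_frac i l a : transF i l a%:F = trans i l a.
Proof. exact: (frac_lift_frac (@trans_inj i l)). Qed.

Lemma transF_hcoordF i l j :
  map_mx (transF i l) (hcoordF l j) = jet_div (hcoordF i j) (hcoordF i l).
Proof.
rewrite -map_trans; apply/rowP => s; rewrite !mxE; exact: transF_frac.
Qed.

Lemma trans_comp i l m a : transF i l (trans l m a) = trans i m a.
Proof.
pose f := [the {rmorphism A -> F} of transF i l \o trans l m].
apply: (@chart_morph _ f (trans i m)) => [c|j s] /=.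
  by rewrite !transC transF_frac transC.
rewrite !transX; set u := jet_div _ _.
have -> : transF i l (u 0 s) = map_mx (transF i l) u 0 s by rewrite [RHS]mxE.
rewrite map_jet_div !transF_hcoordF jet_div_div ?hcoordF_neq0//.
Qed.

Lemma transF_div i l a b : transF i l (a%:F / b%:F) = trans i l a / trans i l b.
Proof. by rewrite fmorph_div/= !transF_frac. Qed.

Lemma transF_comp i l m u : transF i l (transF l m u) = transF i m u.
Proof.
have [a [b [b0 ->]]] := fracP u.
by rewrite !transF_div fmorph_div/= !trans_comp.
Qed.

Lemma trans_id i a : trans i i a = a%:F.
Proof.
apply: (@chart_morph _ (trans i i) (@FracField.tofrac A)) => [c|j s] /=.
  by rewrite transC.
by rewrite transX hcoordFii jet_div1 mxE hcoord_lift mxE.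
Qed.

Lemma transF_id i u : transF i i u = u.
Proof.
have [a [b [b0 ->]]] := fracP u.
by rewrite transF_div !trans_id.
Qed.

Lemma trans_loc i l (p : prime_spec A) a : ~ p (hcoord i l 0 0) ->
  loc_at p (trans i l a).
Proof.
move=> px; have [n [c [cE _]]] := trans_denom i l a.
exists c, (hcoord i l 0 0 ^+ n); split.
  by elim: n {cE} => [|n IH]; [exact: pset1|rewrite exprS; exact: pset_mulN].
have xE : hcoordF i l 0 0 = (hcoord i l 0 0)%:F by rewrite mxE.
rewrite -cE xE tofracXn mulfK//.
by rewrite expf_neq0// tofrac_eq0 hcoord_neq0.
Qed.

Lemma loc_at_unitV (p : prime_spec A) (u v : F) : loc_at p u ->
  loc_at p v -> ~ max_at p v -> loc_at p (u / v).
Proof. by move=> lu lv /(loc_at_unit lv)[_ _ lv']; exact: loc_atM. Qed.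

Section GluedPair.
Variables (i l : 'I_N.+1) (p q : prime_spec A).
Hypothesis pq : glued (existT _ i p) (existT _ l q).

Lemma glued_coord : ~ q (hcoord l i 0 0).
Proof.
case: pq => px qE /qE; rewrite trans_coord hcoordFii mxE eqxx.
move=> m1; have mx := max_atM (loc_at_frac p (hcoord i l 0 0)) m1.
apply: (@pset1 _ p); apply/max_at_frac; rewrite tofrac1.
by move: mx; rewrite [hcoordF i l]/hcoordF mxE mulrA mulr1 divff// tofrac_eq0 hcoord_neq0.
Qed.

Lemma glued_loc u : loc_at q u <-> loc_at p (transF i l u).
Proof.
have qx := glued_coord; case: pq => px qE.
have H a : loc_at p (trans i l a) := trans_loc a px.
have H' a : loc_at q (trans l i a) := trans_loc a qx.
split.
  move=> [a [b [qb ->]]]; rewrite transF_div.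
  by apply: loc_at_unitV => // /qE.
move=> [c [b [pb uE]]].
have -> : u = trans l i c / trans l i b.
  by rewrite -(transF_id l u) -(transF_comp l i l) uE transF_div.
apply: loc_at_unitV => // -[a' [b' [qa' qb' E]]].
apply: pb; apply/max_at_frac.
rewrite -(trans_id i) -(trans_comp i l i) E transF_div mulrC.
apply: max_atM; last exact/qE.
rewrite -[_^-1]mul1r; apply: loc_at_unitV => //; last by move=> /qE.
by rewrite -tofrac1; exact: loc_at_frac.
Qed.

Lemma glued_unit u :
  unit_in (loc_at q) u <-> unit_in (loc_at p) (transF i l u).
Proof.
split=> -[u0 lu lV].
  by split; rewrite -?fmorphV ?fmorph_eq0//; apply/glued_loc.
split; first by move: u0; rewrite fmorph_eq0.
  exact/glued_loc.
by apply/glued_loc; rewrite fmorphV.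
Qed.

Lemma glued_max u : max_at q u <-> max_at p (transF i l u).
Proof.
rewrite !max_atE; split=> -[lu nu]; split; first exact/glued_loc.
- by move=> /glued_unit.
- exact/glued_loc.
by move=> /glued_unit.
Qed.

End GluedPair.

Definition gluedb (x y : {i : 'I_N.+1 & prime_spec A}) : bool := `[< glued x y >].

Lemma glued_refl : reflexive gluedb.
Proof.
move=> [i p]; apply/asboolP; split=> [|a].
  by rewrite hcoordii mxE eqxx; exact: pset1.
by rewrite trans_id max_at_frac.
Qed.

Lemma glued_swap x y : glued x y -> glued y x.
Proof.
case: x y => [i p] [l q] pq; split=> [|a]; first exact: glued_coord pq.
by rewrite (glued_max pq) trans_comp trans_id max_at_frac.
Qed.

Lemma glued_sym : ssrbool.symmetric gluedb.
Proof. by move=> x y; apply/asboolP/asboolP => /glued_swap. Qed.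

Lemma glued_trans : transitive gluedb.
Proof.
move=> [l q] [i p] [m r] /asboolP pq /asboolP qr; apply/asboolP.
have [px _] := pq; have [qx rE] := qr.
split=> [|a]; last by rewrite rE (glued_max pq) trans_comp.
move=> /max_at_frac pm; apply: qx; apply/max_at_frac/(glued_max pq).
rewrite transF_frac trans_coord mulrC; apply: max_atM; last by rewrite mxE.
rewrite -[_^-1]mul1r; apply: loc_at_unitV.
- by rewrite -tofrac1; exact: loc_at_frac.
- by rewrite mxE; exact: loc_at_frac.
- by rewrite mxE => /max_at_frac.
Qed.

Canonical glued_equiv := EquivRel gluedb glued_refl glued_sym glued_trans.

Definition jet_pts : topologicalType :=
  quotient_topology {eq_quot glued_equiv}%qT.

Definition jet_pt (i : 'I_N.+1) (p : prime_spec A) : jet_pts :=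
  (\pi_({eq_quot glued_equiv}) (existT _ i p))%qT.

(* Rational functions on the glued space are written in the coordinates of the
   chart of index 0. *)
Definition jet_stalk (x : jet_pts) : set F :=
  [set u | exists i p, x = jet_pt i p /\ loc_at p (transF i ord0 u)].

Lemma jet_ptP (x : jet_pts) : exists i p, x = jet_pt i p.
Proof.
exists (projT1 (repr x)), (projT2 (repr x)).
by rewrite /jet_pt -sigT_eta reprK.
Qed.

Lemma jet_pt_eq i l p q :
  jet_pt i p = jet_pt l q -> glued (existT _ i p) (existT _ l q).
Proof. by move=> /eqmodP/asboolP. Qed.

Lemma jet_stalkE i p : jet_stalk (jet_pt i p) = transF i ord0 @^-1` loc_at p.
Proof.
apply/seteqP; split=> u /=; last by move=> ?; exists i, p.
move=> [l [q [/jet_pt_eq pq]]].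
by move=> /(glued_loc pq); rewrite transF_comp.
Qed.

Lemma jet_stalk_cst x c : jet_stalk x (cF c).
Proof.
have [i [p ->]] := jet_ptP x; rewrite jet_stalkE /= transF_frac transC.
exact: loc_at_frac.
Qed.

Lemma jet_stalkB x u v : jet_stalk x u -> jet_stalk x v -> jet_stalk x (u - v).
Proof.
have [i [p ->]] := jet_ptP x; rewrite !jet_stalkE /= rmorphB.
exact: loc_atB.
Qed.

Lemma jet_stalkM x u v : jet_stalk x u -> jet_stalk x v -> jet_stalk x (u * v).
Proof.
have [i [p ->]] := jet_ptP x; rewrite !jet_stalkE /= rmorphM.
exact: loc_atM.
Qed.

Lemma jet_unit_in i p u :
  unit_in (jet_stalk (jet_pt i p)) u <-> unit_in (loc_at p) (transF i ord0 u).
Proof. by rewrite /unit_in jet_stalkE /= fmorphV fmorph_eq0. Qed.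

Lemma jet_stalk_local x u v : jet_stalk x u -> jet_stalk x v ->
  unit_in (jet_stalk x) (u + v) ->
  unit_in (jet_stalk x) u \/ unit_in (jet_stalk x) v.
Proof.
have [i [p ->]] := jet_ptP x; rewrite {1 2}jet_stalkE !jet_unit_in rmorphD.
exact: loc_at_local.
Qed.

Lemma jet_stalk_open u : open [set x | jet_stalk x u].
Proof.
apply/sigT_openP => i; rewrite [X in open X](_ : _ = [set p | loc_at p (transF i ord0 u)]).
  exact: loc_at_open.
by apply/seteqP; split=> p /=; rewrite -[X in jet_stalk X]/(jet_pt i p) jet_stalkE.
Qed.

Definition jet_bundle : lrspace C :=
  @LRSpace C jet_pts F (@FracField.tofrac A \o @mpolyC (N * k.+1) C) jet_stalk
    jet_stalk_cst jet_stalkB jet_stalkM jet_stalk_local jet_stalk_open.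

End JetBundle.

Section Charts.
Variables (C : fieldType) (N k : nat).
Local Notation A := (chart_ring C N k).

Definition chart : lrspace C := spec (@mpolyC (N * k.+1) C).

Lemma jet_pt_continuous i : continuous (@jet_pt C N k i).
Proof.
have -> : @jet_pt C N k i = \pi_(quotient_topology {eq_quot glued_equiv C N k})%qT \o existT _ i by [].
by move=> p; apply: continuous_comp; [exact: existT_continuous|exact: pi_continuous].
Qed.

Lemma jet_chart_sections i (U : set (jet_bundle C N k)) s :
  open U -> sections U s ->
  @sections _ chart (@jet_pt C N k i @^-1` U)
    (fun p => transF i ord0 (s (jet_pt i p))).
Proof.
move=> oU sU p /= Up; have [sp nearp] := sU _ Up; split.
  by move: sp; rewrite /= jet_stalkE.
by have := jet_pt_continuous nearp; rewrite /= nbhs_filterE /=; apply: filterS => q /= ->.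
Qed.

Lemma jet_chart_local i (p : chart) u : jet_stalk (jet_pt i p) u ->
  unit_in (stalk p) (transF i ord0 u) -> unit_in (jet_stalk (jet_pt i p)) u.
Proof. by move=> _ /jet_unit_in. Qed.

Definition jet_chart_map (i : 'I_N.+1) : lrmorphism chart (jet_bundle C N k) :=
  @LRMorphism C chart (jet_bundle C N k) (@jet_pt C N k i)
    (fun=> transF i ord0) (@jet_pt_continuous i)
    (fun _ c => etrans (transF_frac i ord0 c%:MP) (transC k i ord0 c))
    (fun _ u v _ _ => rmorphB (transF i ord0) u v) (fun _ u v _ _ => rmorphM (transF i ord0) u v)
    (@jet_chart_local i) (@jet_chart_sections i).

Lemma prime_exp (q : prime_spec A) x n : ~ q x -> ~ q (x ^+ n).
Proof.
by move=> qx; elim: n => [|n IH]; [exact: pset1|rewrite exprS; exact: pset_mulN].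
Qed.

Lemma glued_exists i l (q : prime_spec A) : ~ q (hcoord C k l i 0 0) ->
  exists p, glued (existT _ l q) (existT _ i p).
Proof.
move=> qx; have H a := @trans_loc C N k l i q a qx.
have P0 : max_at q (trans l i 0).
  by rewrite rmorph0 -tofrac0 max_at_frac; exact: pset0.
have PB a b : max_at q (trans l i a) -> max_at q (trans l i b) ->
    max_at q (trans l i (a - b)).
  move=> qa qb; have := max_atD qa (max_atM (loc_at_frac q (-1)) qb).
  by rewrite rmorphB tofracN tofrac1 mulN1r.
have PM a b : max_at q (trans l i b) -> max_at q (trans l i (a * b)).
  by move=> qb; rewrite rmorphM /=; exact: max_atM.
have P1 : ~ max_at q (trans l i 1).
  by rewrite rmorph1 -tofrac1 max_at_frac; exact: pset1.
have PP a b : max_at q (trans l i (a * b)) ->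
    max_at q (trans l i a) \/ max_at q (trans l i b).
  move=> qab; apply: contrapT => /not_orP[na nb]; move: qab.
  rewrite rmorphM => qab; apply: nb.
  have [a0 _ aV] := loc_at_unit (H a) na.
  by rewrite -[trans l i b](mulKf a0); exact: max_atM.
by exists (@PrimeSpec A (fun a => max_at q (trans l i a)) P0 PB PM P1 PP).
Qed.

Lemma jet_chart_open i (U : set chart) : open U -> open (@jet_pt C N k i @` U).
Proof.
move=> [E UE]; apply/sigT_openP => l.
exists [set h | exists a c n, [/\ E a,
  trans l i a * hcoordF C k l i 0 0 ^+ n = c%:F & h = hcoord C k l i 0 0 * c]].
have xE : hcoordF C k l i 0 0 = (hcoord C k l i 0 0)%:F by rewrite mxE.
have key (q : prime_spec A) a c n : ~ q (hcoord C k l i 0 0) ->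
    trans l i a * hcoordF C k l i 0 0 ^+ n = c%:F ->
    (q c <-> max_at q (trans l i a)).
  move=> qx cE; rewrite -max_at_frac -cE xE -tofracXn.
  have qxn := prime_exp (n := n) qx.
  split; last by rewrite mulrC; apply: max_atM; exact: loc_at_frac.
  move=> qc; rewrite -[trans l i a](mulfK (notin_prime_neq0 qxn)) mulrC.
  apply: max_atM => //; exists 1, (hcoord C k l i 0 0 ^+ n); split=> //.
  by rewrite tofrac1 mul1r.
apply/seteqP; split=> q /=.
  move=> [p Up /jet_pt_eq /glued_swap [qx pE]].
  move: Up; rewrite UE => -[a Ea pa].
  have [n [c [cE _]]] := trans_denom l i a.
  exists (hcoord C k l i 0 0 * c); first by exists a, c, n.
  by apply: pset_mulN => // /(key _ _ _ _ qx cE)/pE.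
move=> [_ [a [c [n [Ea cE ->]]]] qxc].
have qx : ~ q (hcoord C k l i 0 0).
  by move=> qx; apply: qxc; rewrite mulrC; exact: psetMl.
have qc : ~ q c by move=> qc; apply: qxc; exact: psetMl.
have [p [_ pE] pP] : exists2 p, glued (existT _ l q) (existT _ i p) & True.
  by have [p pq] := glued_exists qx; exists p.
exists p; last by apply/eqmodP/asboolP/glued_swap; split.
by rewrite UE; exists a => // /pE /(key _ _ _ _ qx cE).
Qed.

Lemma jet_chart_open_immersion i : open_immersion (jet_chart_map i).
Proof.
split; first 1 last.
- exact: jet_chart_open.
- move=> p; split.
  + by move=> u /=; rewrite jet_stalkE.
  + by move=> u v _ _; exact: fmorph_inj.
  + move=> u lu; exists (transF ord0 i u).
      by rewrite /= jet_stalkE /= transF_comp transF_id.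
    by rewrite /= transF_comp transF_id.
move=> p q /jet_pt_eq[_ qE].
have pq : pset p = pset q.
  apply/funext => a; apply/propext; rewrite qE trans_id.
  by split => /max_at_frac.
case: p q pq {qE} => [p p1 p2 p3 p4 p5] [q q1 q2 q3 q4 q5] /= pq.
by case: _ / pq q1 q2 q3 q4 q5 => *; congr PrimeSpec; exact: Prop_irrelevance.
Qed.

End Charts.

Section DifferentiallyHomogeneous.
Variables (C : fieldType) (N k : nat).

(* V^(k); the variable of index [mxvec_index i j] is X_i^(j). *)
Definition Vk : idomainType := {mpoly C[N.+1 * k.+1]}.

Definition Xvar (i : 'I_N.+1) (j : 'I_k.+1) : Vk := 'X_(mxvec_index i j).

(* The formal derivative of the power series \sum_n a n T^n. *)
Definition series_deriv (a : nat -> C) : nat -> C := fun n => a n.+1 *+ n.+1.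

(* The action of a power series on V: it preserves V^(k), as X_i^(m) is sent to
   a combination of the X_i^(j) with j <= m. *)
Definition series_act (a : nat -> C) (P : Vk) : Vk :=
  mmap (@mpolyC (N.+1 * k.+1) C)
    (mxvec (\matrix_(i < N.+1, m < k.+1)
       \sum_(j < k.+1 | (j <= m)%N)
         ('C(m, j)%:R * iter (m - j) series_deriv a 0%N) *: Xvar i j) 0) P.

(* The intersection of V_d^diff with V^(k). *)
Definition diff_homog (d : nat) (P : Vk) : Prop :=
  (P : {mpoly C[N.+1 * k.+1]}) \is d.-homog /\
  forall a : nat -> C, a 0%N != 0 -> series_act a P = a 0%N ^+ d *: P.

Definition Vdiff : grading (@mpolyC (N.+1 * k.+1) C).
Proof.
exists diff_homog.
- by move=> d; split=> [|a _]; [exact: dhomog0 | rewrite /series_act mmap0 scaler0].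
- move=> d P Q [Ph Pd] [Qh Qd]; split=> [|a a0].
    by apply: dhomogD => //; rewrite dhomogN.
  by rewrite /series_act mmapB -!/(series_act _ _) Pd// Qd// scalerBr.
- move=> d e P Q [Ph Pd] [Qh Qd]; split=> [|a a0]; first exact: dhomogM.
  rewrite /series_act rmorphM/= -!/(series_act _ _) Pd// Qd//.
  by rewrite exprD -scalerAl -scalerAr scalerA.
- move=> c; split=> [|a a0].
    by rewrite /= -[c%:MP]mulr1 mul_mpolyC; apply: dhomogZ; exact: dhomog1.
  by rewrite /series_act mmapC expr0 scale1r.
move=> n f fh; apply: (@dhomog_direct C) => d; exact: (fh d).1.
Defined.

Definition PN_jet : lrspace C := Proj Vdiff.

(* The value of a polynomial in the X_i^(j) on the jets of the i-th chart, where
   X_i = 1 and X_j = x_j. *)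
Definition dehom (i : 'I_N.+1) (P : Vk) : chart_ring C N k :=
  mmap (@mpolyC (N * k.+1) C)
    (mxvec (\matrix_(j < N.+1, s < k.+1) hcoord C k i j 0 s) 0) P.

(* The i-th chart is identified with D_+(X_i) in such a way that, for P in
   V_d^diff, the function P / X_i^d is the value of P on the jets. *)
Definition natural_map (f : lrmorphism (jet_bundle C N k) PN_jet) : Prop :=
  forall i : 'I_N.+1, let chart_i := jet_chart_map C k i in
    f @` range chart_i = @proj_basic _ _ _ Vdiff (Xvar i 0) /\
    forall (p : chart C N k) (d : nat) (P : Vk), Vdiff d P ->
      mgerm chart_i p (mgerm f (chart_i p) (P%:F / (Xvar i 0)%:F ^+ d))
      = (dehom i P)%:F.

End DifferentiallyHomogeneous.

(* Main.v *)
(** Let x be the matrix of the X_i^(j) and n := k + 1.  A power series v acts on x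
   by right multiplication by the matrix [leibniz v], whose rows are, up to
   factorials, the shifts of the jet of v.  Hence the determinant of a matrix M
   made of n such shifts of the rows of x is differentially homogeneous of degree
   n.  Let Z be the matrix of the multiplication of jets by T; it commutes with
   every [leibniz v].  If P is differentially homogeneous of degree q n, the value
   P(x) / (det M)^q is a function of y := x M^-1 and of the regular nilpotent
   matrix A := M Z M^-1, whose entries are quotients of such determinants by det M.
   It is polynomial in A: two expressions of it, with denominators the powers of
   the Krylov determinants of the first and of the last row of A, agree, and these
   two determinants form with the coefficients of the characteristic polynomial a
   regular sequence, as is seen by degenerating them to monomials.  So P becomes a
   polynomial in the determinants after multiplication by a power of any of them.
   The determinant trick then shows that they have no common zero, and that they
   define a closed immersion of Proj into a projective space.

   Differential homogeneity applied to the inverse of the jet of X_i identifies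
   P / X_i^d, for P of degree d, with the value of P on the jets such that X_i = 1.
   The coordinates x_j^(s) are of this form, which makes D_+(X_i) the i-th chart of
   the jet bundle. *)

From HB Require Import structures.
From mathcomp Require Import all_boot all_order all_algebra perm.
From mathcomp Require Import boolp classical_sets functions.
From mathcomp Require Import topology_structure sigT_topology quotient_topology.
From mathcomp Require Import mpoly ring zify reals complex.
Require Import Defs.

Set Implicit Arguments.
Unset Strict Implicit.
Unset Printing Implicit Defensive.

Import GRing.Theory.
Local Open Scope ring_scope.

(** * Regular sequences and their symbols *)

(** The obstacle is that each formula for P(x) / (det M)^q in terms of y and A has a Krylov
    determinant as denominator, and this may vanish on a divisor of the nilpotent matrices. Those of
    the first and last rows together suffice: regularity says that their common zeros have
    codimension 2 there, and the extension across these is Kostant's theorem on functions on the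
    regular nilpotent orbit. The degeneration takes two weightings. The weight n^2 - (r - s)^2 is
    strictly concave in r - s with maximum on the diagonal; a diagonal conjugation adds a multiple
    of s - r, and completing the square moves the maximum to a neighbouring diagonal. The
    characteristic coefficients then become elementary symmetric functions of the diagonal, whose
    leading monomials would not be coprime; hence the Newton basis, whose coefficients become
    complete symmetric functions h_(n-J)(d_0, ..., d_J), with leading terms d_J^(n-J) for the second
    weighting. The determinants all have degree n, so other degrees are reached through n-th
    powers. *)

Lemma coef_stableD (O : nzRingType) (theta : {rmorphism O -> {poly O}}) F G j :
  theta (theta F)`_j = (theta F)`_j *: 'X^j ->
  theta (theta G)`_j = (theta G)`_j *: 'X^j ->
  theta (theta (F + G))`_j = (theta (F + G))`_j *: 'X^j.
Proof. by move=> tF tG; rewrite rmorphD coefD rmorphD /= tF tG scalerDl. Qed.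

Section RegularSequences.
Variable O : comNzRingType.
Implicit Types (F G h : O) (fs gs : seq O).

Fixpoint ideal_span gs F : Prop :=
  if gs is g :: gs' then exists u h, ideal_span gs' u /\ F = u + g * h
  else F = 0.

Lemma ideal_span0 gs : ideal_span gs 0.
Proof. by elim: gs => //= g gs IH; exists 0, 0; rewrite mulr0 addr0. Qed.

Lemma ideal_spanD gs F G : ideal_span gs F -> ideal_span gs G -> ideal_span gs (F + G).
Proof.
elim: gs F G => [|g gs IH] F G /=; first by move=> -> ->; rewrite addr0.
move=> [u [h [Iu ->]]] [v [l [Iv ->]]]; exists (u + v), (h + l).
by split; [exact: IH | ring].
Qed.

Lemma ideal_spanM gs c F : ideal_span gs F -> ideal_span gs (c * F).
Proof.
elim: gs F => [|g gs IH] F /=; first by move=> ->; rewrite mulr0.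
by move=> [u [h [Iu ->]]]; exists (c * u), (c * h); split; [exact: IH | ring].
Qed.

Lemma ideal_spanN gs F : ideal_span gs F -> ideal_span gs (- F).
Proof. by move=> /(ideal_spanM (-1)); rewrite mulN1r. Qed.

Lemma ideal_spanB gs F G : ideal_span gs F -> ideal_span gs G -> ideal_span gs (F - G).
Proof. by move=> IF IG; apply: ideal_spanD => //; exact: ideal_spanN. Qed.

Lemma ideal_span_sum gs (I : Type) (r : seq I) (P : pred I) (f : I -> O) :
  (forall i, P i -> ideal_span gs (f i)) -> ideal_span gs (\sum_(i <- r | P i) f i).
Proof. by move=> H; apply: (big_ind (ideal_span gs)) => //; [exact: ideal_span0 | exact: ideal_spanD]. Qed.

Lemma ideal_span_gen gs g : g \in gs -> ideal_span gs g.
Proof.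
elim: gs => //= x gs IH; rewrite inE => /predU1P[<-|/IH Ig].
  by exists 0, 1; split; [exact: ideal_span0 | rewrite add0r mulr1].
by exists g, 0; rewrite mulr0 addr0.
Qed.

Lemma ideal_span_sub gs (I : O -> Prop) :
  I 0 -> (forall F G, I F -> I G -> I (F + G)) -> (forall c F, I F -> I (c * F)) ->
  (forall g, g \in gs -> I g) -> forall F, ideal_span gs F -> I F.
Proof.
move=> I0 ID IM; elim: gs => [|g gs IH] Ig F /=; first by move=> ->.
move=> [u [h [Iu ->]]]; apply: ID; first by apply: IH Iu => x xs; apply: Ig; rewrite inE xs orbT.
by rewrite mulrC; apply: IM; apply: Ig; rewrite inE eqxx.
Qed.

Definition nzd_mod gs g := forall F, ideal_span gs (g * F) -> ideal_span gs F.

(* Each term is regular modulo the following ones. *)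
Fixpoint regular_seq gs : Prop :=
  if gs is g :: gs' then nzd_mod gs' g /\ regular_seq gs' else True.

(* [theta] separates the weights: the coefficient of 'X^w in theta F is the
   component of weight w of F. *)
Variable theta : {rmorphism O -> {poly O}}.
Hypothesis theta_inj : forall F, theta F = 0 -> F = 0.
Hypothesis theta_coef : forall F w, theta (theta F)`_w = (theta F)`_w *: 'X^w.

(** [c] may vanish: [W] is only a bound for the degree, which makes the relation additive and
    multiplicative. *)
Definition top_coef (W : nat) (p : {poly O}) (c : O) : Prop :=
  (size p <= W.+1)%N /\ p`_W = c.

Lemma top_coefD W p q c d : top_coef W p c -> top_coef W q d -> top_coef W (p + q) (c + d).
Proof.
move=> [sp <-] [sq <-]; split; last by rewrite coefD.
by rewrite (leq_trans (size_polyD _ _))// geq_max sp.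
Qed.

Lemma top_coefN W p c : top_coef W p c -> top_coef W (- p) (- c).
Proof. by move=> [sp <-]; split; rewrite ?size_polyN ?coefN. Qed.

Lemma top_coef0 W : top_coef W 0 0.
Proof. by split; rewrite ?size_poly0 ?coef0. Qed.

Lemma top_coefM V W p q c d :
  top_coef V p c -> top_coef W q d -> top_coef (V + W) (p * q) (c * d).
Proof.
move=> [sp <-] [sq <-]; split.
  rewrite (leq_trans (size_polyMleq _ _))// -ltnS.
  case: (size p + size q)%N (leq_add sp sq) => // m /=.
  by rewrite addSn addnS.
rewrite coefM (bigD1 (inord V)) //= inordK ?ltnS ?leq_addr// addKn.
rewrite big1 ?addr0// => i iV.
have {}iV : i != V :> nat.
  by apply: contraNneq iV => E; apply/eqP/val_inj; rewrite /= inordK ?ltnS ?leq_addr.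
have [iV'|iV'|E] := ltngtP i V; last by rewrite E eqxx in iV.
  by rewrite [q`__]nth_default ?mulr0// (leq_trans sq)// ltn_subRL ltn_add2r.
by rewrite [p`__]nth_default ?mul0r// (leq_trans sp).
Qed.

Lemma top_coefC c : top_coef 0 c%:P c.
Proof. by split; rewrite ?size_polyC ?coefC// leq_b1. Qed.

Lemma top_coef_lt W (p : {poly O}) : (size p <= W)%N -> top_coef W p 0.
Proof. by move=> sp; split; rewrite ?nth_default// (leq_trans sp). Qed.

Lemma top_coef_sum W (I : Type) (r : seq I) (P : pred I) (f : I -> {poly O}) (c : I -> O) :
  (forall i, P i -> top_coef W (f i) (c i)) ->
  top_coef W (\sum_(i <- r | P i) f i) (\sum_(i <- r | P i) c i).
Proof.
move=> H; apply: (big_ind2 (top_coef W)) => //; first exact: top_coef0.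
by move=> *; exact: top_coefD.
Qed.

Lemma top_coef_prod (I : Type) (r : seq I) (P : pred I) (W : I -> nat) (f : I -> {poly O}) (c : I -> O) :
  (forall i, P i -> top_coef (W i) (f i) (c i)) ->
  top_coef (\sum_(i <- r | P i) W i) (\prod_(i <- r | P i) f i) (\prod_(i <- r | P i) c i).
Proof.
move=> H; elim: r => [|i r IH]; first by rewrite !big_nil; exact: top_coefC.
by rewrite !big_cons; case: ifP => // Pi; apply: top_coefM => //; exact: H.
Qed.

Lemma top_coefX W p c n : top_coef W p c -> top_coef (W * n) (p ^+ n) (c ^+ n).
Proof.
move=> H; elim: n => [|n IH]; first by rewrite muln0 !expr0; exact: top_coefC.
by rewrite mulnS !exprS; exact: top_coefM.
Qed.

Definition has_symbol (W : nat) F G : Prop := top_coef W (theta F) G.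

Lemma symbol_coef W F : has_symbol W (theta F)`_W (theta F)`_W.
Proof.
rewrite /has_symbol theta_coef; split; last by rewrite coefZ coefXn eqxx mulr1.
by rewrite (leq_trans (size_scale_leq _ _))// size_polyXn.
Qed.

Lemma size_sub_symbol W F G : (size (theta F) <= W.+1)%N ->
  has_symbol W G (theta F)`_W -> (size (theta (F - G)%R) <= W)%N.
Proof.
move=> sF [sG cG]; rewrite rmorphB; apply/leq_sizeP => j Wj; rewrite coefB.
have [->|jW] := eqVneq j W; first by rewrite cG subrr.
have {jW Wj} jW : (W < j)%N by rewrite ltn_neqAle eq_sym jW.
by rewrite !nth_default ?subrr// (leq_trans _ jW).
Qed.

(* E is the ideal of the symbols of I. *)
Definition controlled (I E : O -> Prop) : Prop :=
  (forall (W : nat) F G, I F -> has_symbol W F G -> E G) /\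
  (forall (W : nat) G, E G -> exists2 F, I F & has_symbol W F (theta G)`_W).

Section Step.
Variables (fs gs : seq O) (f g : O) (V : nat).
Hypothesis fgs : controlled (ideal_span fs) (ideal_span gs).
Hypothesis fg : has_symbol V f g.
Hypothesis ng : nzd_mod gs g.

Lemma theta_symbol : theta g = g *: 'X^V.
Proof. by case: fg => _ <-; rewrite theta_coef. Qed.

(** Induction on the top weight J of F: the symbol g F_J of f F lies in the ideal of symbols, hence
    so does F_J, which is then the symbol of an element u of the ideal; F - u has lower weight. *)
Lemma controlled_nzd : nzd_mod fs f.
Proof.
have H J F : (size (theta F) <= J)%N -> ideal_span fs (f * F) -> ideal_span fs F.
  elim: J F => [|J IH] F sF IfF.
    have -> : F = 0 by apply: theta_inj; apply/eqP; rewrite -size_poly_leq0.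
    exact: ideal_span0.
  have sym : has_symbol (V + J) (f * F) (g * (theta F)`_J).
    by rewrite /has_symbol rmorphM; exact: top_coefM.
  have EF : ideal_span gs (theta F)`_J by apply: ng; exact: fgs.1 IfF sym.
  have [u Iu] := fgs.2 J _ EF.
  have [_ ->] := symbol_coef J F => su.
  have Fu : ideal_span fs (F - u).
    apply: IH; first exact: size_sub_symbol.
    by rewrite mulrBr; apply: ideal_spanB => //; exact: ideal_spanM.
  by rewrite -(subrK u F); exact: ideal_spanD.
by move=> F; apply: H (leqnn _).
Qed.

(** The point is that u + f h has no unexpected symbol. If the weight of f h exceeds W, its top part
    g h_j cancels against u, so h_j is itself a symbol by regularity of g, and h can be lowered
    without changing the sum. *)
Lemma controlled_cons : controlled (ideal_span (f :: fs)) (ideal_span (g :: gs)).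
Proof.
split.
  move=> W F G [u [h [Iu ->]]].
  have [J] := ubnP (size (theta h)).
  elim: J u h Iu => // J IH u h Iu sJ sFG.
  have [h0|h0] := eqVneq (theta h) 0.
    rewrite (theta_inj h0) mulr0 addr0 in sFG.
    exists G, 0; rewrite mulr0 addr0; split=> //; exact: fgs.1 Iu sFG.
  have [j sj] : exists j, size (theta h) = j.+1.
    by case: (size (theta h)) (size_poly_eq0 (theta h)) h0 => [<-//|j]; exists j.
  have sfh : has_symbol (V + j) (f * h) (g * (theta h)`_j).
    by rewrite /has_symbol rmorphM; apply: top_coefM => //; split; rewrite ?sj.
  have [le|lt] := leqP (V + j) W.
    have sfhW : has_symbol W (f * h) (g * (theta h)`_(W - V)).
      have /= := @top_coefM V (W - V) (theta f) (theta h) g (theta h)`_(W - V).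
      rewrite subnKC ?(leq_trans (leq_addr _ _) le)// -rmorphM; apply => //.
      by split=> //; rewrite sj ltnS leq_subRL ?(leq_trans (leq_addr _ _) le).
    have su : has_symbol W u (G - g * (theta h)`_(W - V)).
      by rewrite -(addrK (f * h) u) /has_symbol rmorphB; apply: top_coefD => //; exact: top_coefN.
    by exists (G - g * (theta h)`_(W - V)), (theta h)`_(W - V); rewrite subrK; split=> //; exact: fgs.1 Iu su.
  (* The sum has weight at most W < V + j, so the parts of weight V + j of u and f h are
     opposite. *)
  have su : has_symbol (V + j) u (- (g * (theta h)`_j)).
    rewrite -(addrK (f * h) u) -[X in has_symbol _ _ X]add0r /has_symbol rmorphB.
    apply: top_coefD; last exact: top_coefN.
    by apply: top_coef_lt; apply: leq_trans sFG.1 _.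
  have Eh : ideal_span gs (theta h)`_j.
    by apply: ng; rewrite -[_ * _]opprK; apply: ideal_spanN; exact: fgs.1 Iu su.
  have [v Iv] := fgs.2 j _ Eh.
  have [_ ->] := symbol_coef j h => sv.
  apply: (IH (u + f * v) (h - v)).
  - by apply: ideal_spanD => //; exact: ideal_spanM.
  - apply: leq_ltn_trans (_ : (size (theta (h - v)%R) <= j)%N) _; last by rewrite -ltnS -sj.
    by apply: size_sub_symbol => //; rewrite sj.
  - by have -> : u + f * v + f * (h - v) = u + f * h by ring.
move=> W G [e [c [Ee ->]]].
have [F IF sF] := fgs.2 W _ Ee.
have thE : (theta (e + g * c))`_W = (theta e)`_W + (if (W < V)%N then 0 else g * (theta c)`_(W - V)).
  by rewrite rmorphD rmorphM theta_symbol coefD -scalerAl coefZ coefXnM; case: ltnP; rewrite ?mulr0.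
rewrite {}thE; case: ltnP => [WV|VW].
  by rewrite addr0; exists F => //; exists F, 0; rewrite mulr0 addr0.
exists (F + f * (theta c)`_(W - V)); first by exists F, (theta c)`_(W - V).
rewrite /has_symbol rmorphD rmorphM; apply: top_coefD => //.
by rewrite -{1}(subnKC VW); apply: top_coefM => //; exact: symbol_coef.
Qed.

End Step.

Fixpoint symbols fs gs : Prop :=
  match fs, gs with
  | f :: fs', g :: gs' => (exists W, has_symbol W f g) /\ symbols fs' gs'
  | [::], [::] => True
  | _, _ => False
  end.

(** The induction carries along the ideal of symbols: regularity of the tail alone would not give
    the next step. *)
Lemma regular_symbols fs gs : symbols fs gs -> regular_seq gs -> regular_seq fs.
Proof.
suff H : symbols fs gs -> regular_seq gs ->
    controlled (ideal_span fs) (ideal_span gs) /\ regular_seq fs.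
  by move=> /H{}H /H[].
elim: fs gs => [|f fs IH] [|g gs]//=.
  move=> _ _; split=> //; split=> [W F G /= -> [_]|W G /= ->].
    by rewrite rmorph0 coef0.
  by exists 0 => //; rewrite /has_symbol rmorph0 coef0; exact: top_coef0.
move=> [[W fg] /IH{}IH] [ng /IH[cfg rfs]]; split.
  exact: controlled_cons fg ng.
by split=> //; exact: controlled_nzd fg ng.
Qed.

End RegularSequences.

Arguments ideal_span : simpl never.

(** * Weight gradings of polynomial rings *)

Section Weights.
Variables (K : comNzRingType) (m : nat) (w : 'I_m -> nat).
Local Notation O := {mpoly K[m]}.

Definition weight_exp : O -> {poly O} :=
  mmap (@polyC O \o @mpolyC m K) (fun v => 'X_v *: 'X^(w v)).

HB.instance Definition _ := GRing.RMorphism.on weight_exp.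

Lemma weight_expC c : weight_exp c%:MP = (c%:MP)%:P.
Proof. by rewrite /weight_exp mmapC. Qed.

Lemma weight_expX v : weight_exp 'X_v = 'X_v *: 'X^(w v).
Proof. by rewrite /weight_exp mmapX mmap1U. Qed.

Lemma weight_exp_monomial c (u : 'X_{1..m}) :
  weight_exp (c *: 'X_[u]) = (c *: 'X_[u]) *: 'X^(\sum_v w v * u v).
Proof.
rewrite -mul_mpolyC rmorphM /= weight_expC -scalerA -mul_polyC; congr (_ * _).
rewrite mpolyXE_id rmorph_prod /=.
elim/big_rec3: _ => [|v e p q _ ->]; first by rewrite expr0 scale1r.
by rewrite rmorphXn /= weight_expX exprZn -exprM -scalerAl -scalerAr scalerA exprD.
Qed.

Lemma weight_expD F G : weight_exp (F + G) = weight_exp F + weight_exp G.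
Proof. exact: rmorphD. Qed.

(** Setting the auxiliary variable to 1 recovers F. *)
Lemma weight_exp_inj F : weight_exp F = 0 -> F = 0.
Proof.
suff {2}<- : (weight_exp F).[1] = F by move=> ->; rewrite horner0.
elim/mpolyind: F => [|c u p _ _ IH]; first by rewrite rmorph0 horner0.
by rewrite weight_expD weight_exp_monomial hornerD hornerZ hornerXn expr1n mulr1 IH.
Qed.

Lemma weight_exp_coef F j :
  weight_exp (weight_exp F)`_j = (weight_exp F)`_j *: 'X^j.
Proof.
elim/mpolyind: F => [|c u p _ _ IH]; first by rewrite rmorph0 coef0 rmorph0 scale0r.
apply: coef_stableD; last exact: IH.
suff : weight_exp (weight_exp (c *: 'X_[u]))`_j = (weight_exp (c *: 'X_[u]))`_j *: 'X^j by exact.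
rewrite weight_exp_monomial coefZ coefXn; case: eqP => [->|_].
  by rewrite mulr1 weight_exp_monomial.
by rewrite mulr0 (raddf0 weight_exp) scale0r.
Qed.

Lemma symbol_var v : has_symbol weight_exp (w v) 'X_v 'X_v.
Proof.
rewrite /has_symbol -[X in top_coef _ X]/(weight_exp 'X_v) weight_expX; split; last by rewrite coefZ coefXn eqxx mulr1.
by rewrite (leq_trans (size_scale_leq _ _))// size_polyXn.
Qed.

End Weights.

(** * Monomial ideals *)

Section Monomials.
Variables (K : idomainType) (m : nat).
Local Notation O := {mpoly K[m]}.

(** The sign accommodates the signature of the permutation in the symbol of a Krylov determinant. *)
Definition signed_monomial (bu : bool * 'X_{1..m}) : O := (-1) ^+ bu.1 * 'X_[bu.2].

Lemma mcoeff_mulX_notle (p : O) (u e : 'X_{1..m}) :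
  ~~ (u <= e)%MM -> ('X_[u] * p)@_e = 0.
Proof.
move=> ue; elim/mpolyind: p => [|c v p _ _ IH]; first by rewrite mulr0 mcoeff0.
rewrite mulrDr mcoeffD IH addr0 -scalerAr mcoeffZ -mpolyXD mcoeffX.
case: eqP => [E|_]; last by rewrite mulr0.
by move: ue; rewrite -E lem_addr ?lepm_refl.
Qed.

Lemma signed_monomialK (u : bool * 'X_{1..m}) : (-1) ^+ u.1 * signed_monomial u = 'X_[u.2].
Proof. by rewrite /signed_monomial mulrA -expr2 sqrr_sign mul1r. Qed.

Lemma ideal_span_monomials (us : seq (bool * 'X_{1..m})) (F : O) :
  ideal_span [seq signed_monomial u | u <- us] F <->
  forall e, F@_e != 0 -> exists2 u, u \in us & (u.2 <= e)%MM.
Proof.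
split=> [|H].
  elim: us F => [|u us IH] F /=; first by move=> -> e; rewrite mcoeff0 eqxx.
  move=> [v [h [Iv ->]]] e; rewrite mcoeffD.
  have [v0|v0 _] := eqVneq v@_e 0; last first.
    by have [u' u'us ue] := IH _ Iv _ v0; exists u'; rewrite // inE u'us orbT.
  rewrite v0 add0r /signed_monomial -mulrA mulrCA => c0; exists u; first by rewrite inE eqxx.
  by apply: contra_neqT c0 => ue; exact: mcoeff_mulX_notle.
rewrite [F]mpolyE big_seq; apply: ideal_span_sum => e; rewrite mcoeff_msupp => /H[u u_us ue].
rewrite -(submK ue) mpolyXD -signed_monomialK scalerAl mulrA.
by apply: ideal_spanM; apply: ideal_span_gen; exact: map_f.
Qed.

Definition mnm_coprime (u v : bool * 'X_{1..m}) := [forall i, (u.2 i == 0)%N || (v.2 i == 0)%N].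

(** A generator that divides e + u and shares no variable with u already divides e. *)
Lemma signed_monomial_nzd us u : all (mnm_coprime u) us ->
  nzd_mod [seq signed_monomial v | v <- us] (signed_monomial u).
Proof.
move=> /allP cop F; rewrite !ideal_span_monomials => H e Fe.
have : (signed_monomial u * F)@_(e + u.2) != 0.
  rewrite /signed_monomial -mulrA mulrC -signr_odd.
  rewrite (_ : 'X_[_] * F * _ = (-1) ^+ (odd u.1) *: (F * 'X_[u.2])); last first.
    by rewrite mulrC [_ * F]mulrC; case: (odd _); rewrite ?expr0 ?expr1 ?scale1r ?scaleN1r ?mul1r ?mulN1r.
  by rewrite mcoeffZ addmC mcoeffMX mulf_neq0 ?signr_eq0.
move=> /H[v vus /mnm_lepP ve]; exists v => //; apply/mnm_lepP => i.
have /forallP/(_ i)/orP[/eqP ui|/eqP->//] := cop _ vus.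
by have := ve i; rewrite mnmDE ui addn0.
Qed.

Lemma regular_monomials us : pairwise mnm_coprime us ->
  regular_seq [seq signed_monomial v | v <- us].
Proof.
by elim: us => //= u us IH /andP[/signed_monomial_nzd nu /IH].
Qed.

End Monomials.

(** * Complete symmetric functions and divided differences *)

Section CompleteSymmetric.
Variables (R : comNzRingType) (d : nat -> R).

(* The complete symmetric function of degree m in d 0, ..., d (J - 1). *)
Fixpoint complete_sym (J m : nat) : R :=
  if J is J'.+1 then \sum_(a < m.+1) d J' ^+ a * complete_sym J' (m - a)
  else (m == 0)%:R.

Lemma complete_sym0 J : complete_sym J 0 = 1.
Proof. by elim: J => //= J IH; rewrite big_ord1 mul1r. Qed.

Lemma complete_symS J m :
  complete_sym J.+1 m.+1 = complete_sym J m.+1 + d J * complete_sym J.+1 m.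
Proof.
rewrite /= big_ord_recl /= subn0 mul1r; congr (_ + _).
rewrite mulr_sumr; apply: eq_bigr => a _.
by rewrite /= /bump /= add1n exprS mulrA subSS.
Qed.

Lemma complete_sym_recr J m :
  complete_sym J.+1 m = \sum_(a < m) d J ^+ a * complete_sym J (m - a) + d J ^+ m.
Proof. by rewrite /= big_ord_recr /= subnn complete_sym0 mulr1. Qed.

(* The divided difference of 'X^i at d 0, ..., d (J - 1). *)
Definition divdiff_exp J i : R := if (J <= i.+1)%N then complete_sym J (i.+1 - J) else 0.

Lemma divdiff_expS J i :
  divdiff_exp J.+1 i.+1 - d J * divdiff_exp J.+1 i = divdiff_exp J i.
Proof.
rewrite /divdiff_exp ltnS; have [Ji|Ji|->] := ltngtP J i.+1.
- by rewrite !subSS subSn// complete_symS addrK.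
- by rewrite mulr0 subr0.
by rewrite !subSS !subnn mulr0 subr0 !complete_sym0.
Qed.

Definition divdiff n J (p : {poly R}) := \sum_(i < n) p`_i * divdiff_exp J i.

Lemma divdiff_mulXsub n J (p : {poly R}) : (size p <= n)%N ->
  divdiff n.+1 J.+1 (('X - (d J)%:P) * p) = divdiff n J p.
Proof.
move=> sp; rewrite /divdiff.
under eq_bigr => i _ do rewrite mulrBl coefB coefXM coefCM mulrBl.
rewrite sumrB big_ord_recl /= mul0r add0r big_ord_recr /= (nth_default 0 sp) mulr0 mul0r addr0.
by rewrite -sumrB; apply: eq_bigr => i _; rewrite /bump /= add1n -(divdiff_expS J i); ring.
Qed.

(** Each factor is removed together with its node by [divdiff_mulXsub]; without nodes left,
    [divdiff_exp d 0 i] is a complete symmetric function of positive degree in no variable, that is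
    0. *)
Lemma divdiff_prod0 n J p : (size (\prod_(i < J) ('X - (d i)%:P) * p)%R <= n)%N ->
  divdiff n J (\prod_(i < J) ('X - (d i)%:P) * p) = 0.
Proof.
elim: J n p => [|J IH] n p.
  by rewrite /divdiff big_ord0 big1// => i _; rewrite /divdiff_exp /= mulr0.
rewrite big_ord_recr /= mulrAC mulrC; set q := \prod_(i < J) _ * p.
have [->|q0] := eqVneq q 0.
  by move=> _; rewrite mulr0 /divdiff big1// => i _; rewrite coef0 mul0r.
rewrite size_monicM ?monicXsubC// size_XsubC add2n /=.
by case: n => // n; rewrite ltnS => sq; rewrite divdiff_mulXsub ?IH.
Qed.

End CompleteSymmetric.

(** * Krylov determinants of the generic matrix *)

Section Krylov.
Variables (k : nat) (R : comNzRingType).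
Implicit Types (A B D : 'M[R]_k.+1).

Definition krylov (v : 'I_k.+1) A : 'M[R]_k.+1 :=
  \matrix_(j < k.+1, s < k.+1) (A ^+ j) v s.

Lemma row_krylov v A (j : 'I_k.+1) : row j (krylov v A) = row v (A ^+ j).
Proof. by apply/rowP => s; rewrite !mxE. Qed.

(** As A^j D = D B^j, row v is only multiplied by the entry d_v, normalized to 1. *)
Lemma krylov_conj v A B (d : 'rV[R]_k.+1) :
  A *m diag_mx d = diag_mx d *m B -> d 0 v = 1 ->
  krylov v A *m diag_mx d = krylov v B.
Proof.
move=> AB dv.
have H j : A ^+ j *m diag_mx d = diag_mx d *m B ^+ j.
  elim: j => [|j IH]; first by rewrite !expr0 mul1mx mulmx1.
  by rewrite exprSr -[_ * A]/(_ *m A) -mulmxA AB mulmxA IH -mulmxA exprSr.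
apply/row_matrixP => j; rewrite row_mul !row_krylov -row_mul H.
by rewrite mul_diag_mx; apply/rowP => s; rewrite !mxE dv mul1r.
Qed.

Variables (p : 'S_k.+1) (b : 'I_k.+1 -> R) (B : 'M[R]_k.+1).
Hypothesis Bp : forall j j' : 'I_k.+1, j' = j.+1 :> nat ->
  forall s, B (p j) s = if s == p j' then b j else 0.

(** Each multiplication by B moves the basis vector one step along the path p 0, p 1, ..., with
    factor b. The row p k, where the path ends, is unconstrained by [Bp]. *)
Lemma path_matrix_pow (j : 'I_k.+1) s :
  (B ^+ j) (p 0) s = if s == p j then \prod_(i < k.+1 | (i < j)%N) b i else 0.
Proof.
case: j => j ltj; elim: j ltj s => [|j IH] ltj s /=.
  have -> : Ordinal ltj = 0 by exact/val_inj.
  by rewrite expr0 mxE [p 0 == s]eq_sym big_pred0//; case: (s == p 0).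
have ltj' := ltnW ltj; rewrite exprSr mxE (bigD1 (p (Ordinal ltj'))) //=.
rewrite big1 ?addr0 => [|i ij]; last by rewrite IH (negPf ij) mul0r.
rewrite IH eqxx (Bp (j' := Ordinal ltj)) //; case: eqP => [_|_]; last by rewrite mulr0.
rewrite mulrC [RHS](bigD1 (Ordinal ltj')) //=; congr (_ * _).
by apply: eq_bigl => i; rewrite ltnS ltn_neqAle andbC.
Qed.

Lemma det_krylov_path :
  \det (krylov (p 0) B) = (-1) ^+ p * \prod_(j < k.+1) \prod_(i < k.+1 | (i < j)%N) b i.
Proof.
have -> : krylov (p 0) B =
    diag_mx (\row_j \prod_(i < k.+1 | (i < j)%N) b i) *m perm_mx p.
  apply/matrixP => j s; rewrite mul_diag_mx !mxE path_matrix_pow eq_sym.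
  by case: eqP; rewrite ?mulr1 ?mulr0.
rewrite det_mulmx det_diag det_perm mulrC; congr (_ * _).
by apply: eq_bigr => j _; rewrite mxE.
Qed.

End Krylov.

Lemma map_krylov k (R S : comNzRingType) (f : {rmorphism R -> S}) (v : 'I_k.+1)
  (A : 'M[R]_k.+1) : map_mx f (krylov v A) = krylov v (map_mx f A).
Proof. by apply/matrixP => j s; rewrite !mxE -(rmorphXn (map_mx f)) mxE. Qed.

Section TopCoefMatrix.
Variable O : comNzRingType.

Lemma top_coef_scaleXn a e (c : O) : (e <= a)%N ->
  top_coef a (c *: 'X^e) (if e == a then c else 0).
Proof.
move=> ea; split.
  by rewrite (leq_trans (size_scale_leq _ _))// size_polyXn.
by rewrite coefZ coefXn eq_sym; case: eqP; rewrite ?mulr1 ?mulr0.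
Qed.

Lemma top_coef_mulXn W e (p : {poly O}) c :
  (e <= W)%N -> top_coef W (p * 'X^e) c -> top_coef (W - e) p c.
Proof.
move=> eW [sp <-]; split; last by rewrite coefMXn ltnNge eW.
have [->|p0] := eqVneq p 0; first by rewrite size_poly0.
by move: sp; rewrite size_Mmonic ?monicXn// size_polyXn; lia.
Qed.

Lemma top_coef_signM W (b : bool) (p : {poly O}) c :
  top_coef W p c -> top_coef W ((-1) ^+ b * p) ((-1) ^+ b * c).
Proof.
by case: b => H; rewrite ?expr1 ?mulN1r ?expr0 ?mul1r//; exact: top_coefN.
Qed.

Lemma top_coef_det n (W : 'I_n -> nat) (A : 'M[{poly O}]_n) (C : 'M[O]_n) :
  (forall i j, top_coef (W i) (A i j) (C i j)) ->
  top_coef (\sum_i W i) (\det A) (\det C).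
Proof.
move=> H; rewrite /determinant; apply: top_coef_sum => s _.
by apply: top_coef_signM; apply: top_coef_prod => i _; exact: H.
Qed.

Variables (k a : nat) (B : 'M[{poly O}]_k.+1) (C : 'M[O]_k.+1).
Hypothesis BC : forall r s, top_coef a (B r s) (C r s).

Lemma top_coef_mxX j r s : top_coef (a * j) ((B ^+ j) r s) ((C ^+ j) r s).
Proof.
elim: j s => [|j IH] s.
  by rewrite muln0 !expr0 !mxE -polyC_natr; exact: top_coefC.
rewrite !exprSr !mxE; apply: top_coef_sum => i _.
by rewrite mulnSr; exact: top_coefM.
Qed.

Lemma top_coef_krylov v :
  top_coef (\sum_(j < k.+1) a * j) (\det (krylov v B)) (\det (krylov v C)).
Proof. by apply: top_coef_det => j s; rewrite !mxE; exact: top_coef_mxX. Qed.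

(** Total weight at most a e when the variable of the characteristic polynomial is itself given
    weight a; [c] collects the part of weight exactly a e. *)
Definition graded_top e (p : {poly {poly O}}) (c : {poly O}) : Prop :=
  forall i, if (i <= e)%N then top_coef (a * (e - i)) p`_i c`_i else p`_i = 0 /\ c`_i = 0.

Lemma graded_topD e p q c d :
  graded_top e p c -> graded_top e q d -> graded_top e (p + q) (c + d).
Proof.
move=> Hp Hq i; move: (Hp i) (Hq i); rewrite !coefD; case: leqP => _.
  exact: top_coefD.
by move=> [-> ->] [-> ->]; rewrite !addr0.
Qed.

Lemma graded_topM e f p q c d :
  graded_top e p c -> graded_top f q d -> graded_top (e + f) (p * q) (c * d).
Proof.
move=> Hp Hq i; rewrite !coefM.
have H (j : 'I_i.+1) : if (i <= e + f)%N
    then top_coef (a * (e + f - i)) (p`_j * q`_(i - j)) (c`_j * d`_(i - j))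
    else p`_j * q`_(i - j) = 0 /\ c`_j * d`_(i - j) = 0.
  move: (Hp j) (Hq (i - j)%N); have ji : (j <= i)%N by rewrite -ltnS.
  case: (leqP j e) => [je|_ [-> ->] _]; last first.
    by rewrite !mul0r; case: ifP => // _; exact: top_coef0.
  case: (leqP (i - j) f) => [jf|_ _ [-> ->]]; last first.
    by rewrite !mulr0; case: ifP => // _; exact: top_coef0.
  have -> : (i <= e + f)%N by lia.
  have -> : (a * (e + f - i) = a * (e - j) + a * (f - (i - j)))%N by rewrite -mulnDr; congr muln; lia.
  exact: top_coefM.
case: ifP => ief; first by apply: top_coef_sum => j _; move: (H j); rewrite ief.
by split; apply: big1 => j _; move: (H j); rewrite ief => -[].
Qed.

Lemma graded_top0 e : graded_top e 0 0.
Proof. by move=> i; rewrite !coef0; case: ifP => // _; exact: top_coef0. Qed.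

Lemma graded_top1 : graded_top 0 1 1.
Proof.
move=> i; rewrite !coef1; case: i => [|i] //=.
by rewrite muln0; exact: top_coefC.
Qed.

Lemma graded_topN e p c : graded_top e p c -> graded_top e (- p) (- c).
Proof.
move=> H i; move: (H i); rewrite !coefN; case: ifP => _; first exact: top_coefN.
by move=> [-> ->]; rewrite !oppr0.
Qed.

Lemma graded_top_char_poly : graded_top k.+1 (char_poly B) (char_poly C).
Proof.
rewrite /char_poly /determinant.
apply: (big_ind2 (graded_top k.+1)); [exact: graded_top0|by move=> *; exact: graded_topD|].
move=> s _.
suff H : graded_top k.+1 (\prod_i char_poly_mx B i (s i)) (\prod_i char_poly_mx C i (s i)).
  by case: (s : bool); rewrite ?expr1 ?mulN1r ?expr0 ?mul1r//; exact: graded_topN.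
have H i j : graded_top 1 (char_poly_mx B i j) (char_poly_mx C i j).
  move=> l; rewrite !mxE !coefB !coefMn !coefX !coefC.
  case: l => [|[|l]] /=; rewrite ?mul0rn ?sub0r ?muln1 ?muln0 ?subr0.
  - exact: top_coefN.
  - case: (i == j); rewrite ?mulr1n ?mulr0n; last exact: top_coef0.
    by rewrite -polyC1; exact: top_coefC.
  - by rewrite !oppr0.
suff : graded_top (\sum_(i < k.+1) 1) (\prod_i char_poly_mx B i (s i))
    (\prod_i char_poly_mx C i (s i)) by rewrite sum1_card card_ord.
apply: (big_rec3 (fun e p c => graded_top e p c)); first exact: graded_top1.
by move=> i e p c _ Hp; rewrite addnC mulrC [_ * c]mulrC; apply: graded_topM.
Qed.

End TopCoefMatrix.

(** The sum of the two truncated differences is the distance of a and b. The added 1 makes the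
    minuend positive, so that truncated subtraction of a nonzero number does lower it. *)
Lemma dist_sqr_eq (a b c : nat) : (c ^ 2 + 1 - ((a - b) + (b - a)) ^ 2 == c ^ 2 + 1)%N = (b == a).
Proof.
apply/eqP/eqP => [E|->]; last by rewrite subnn exp0n// subn0.
have /eqP : ((a - b + (b - a)) ^ 2 = 0)%N.
  by move: E; move: (_ ^ 2)%N (c ^ 2)%N => x y; lia.
by rewrite expn_eq0 andbT; lia.
Qed.

(** * Symbols of the Krylov determinants of the generic matrix *)

Section GenericMatrix.
Variables (K : idomainType) (k : nat).
Local Notation n := k.+1.
Local Notation O := {mpoly K[n * n]}.

Definition generic_mx : 'M[O]_n := \matrix_(r < n, s < n) 'X_(mxvec_index r s).

Definition entry_weight (w : 'M[nat]_n) : 'I_(n * n) -> nat := mxvec w 0.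

Definition diag_var (i : nat) : O := 'X_(mxvec_index (inord i : 'I_n) (inord i : 'I_n)).

Definition char_coef (i : nat) : O := (char_poly generic_mx)`_i.

(* The coefficients, in the Newton basis of the diagonal entries, of 'X^n minus
   the generic characteristic polynomial. *)
Definition newton_coef (J : nat) : O :=
  - \sum_(i < n) char_coef i * divdiff_exp diag_var J i.

Lemma weight_exp_generic w : map_mx (weight_exp (entry_weight w)) generic_mx =
  \matrix_(r, s) ('X_(mxvec_index r s) *: 'X^(w r s)).
Proof. by apply/matrixP => r s; rewrite !mxE weight_expX /entry_weight mxvecE. Qed.

Lemma symbol_diag w i :
  has_symbol (weight_exp (entry_weight w)) (w (inord i) (inord i)) (diag_var i) (diag_var i).
Proof.
have := symbol_var K (entry_weight w) (mxvec_index (inord i : 'I_n) (inord i : 'I_n)).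
by rewrite /entry_weight mxvecE.
Qed.

Section KrylovSymbol.
Variables (w w' : 'M[nat]_n) (d : 'I_n -> nat) (a : nat) (p : 'S_n).
Hypothesis ww' : forall r s, (w r s + d s = d r + w' r s)%N.
Hypothesis w'a : forall r s, (w' r s <= a)%N.
Hypothesis dp : d (p 0) = 0%N.
Hypothesis dle : (\sum_r d r <= \sum_(j < n) a * j)%N.
Hypothesis w'p : forall j j' : 'I_n, j' = j.+1 :> nat ->
  forall s, (w' (p j) s == a) = (s == p j').

Definition path_monomial : 'X_{1..n * n} :=
  (\sum_(j < n) \sum_(i < n | (i < j)%N) U_(mxvec_index (p i) (p (inord i.+1))))%MM.

(** The diagonal matrix with entries 'X^(d r) conjugates the weights [w] into [w']. By [w'p] the
    part of maximal weight a of row p j is its single entry in column p (j + 1), so the top part of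
    the Krylov matrix is that of a path, with a monomial as determinant. *)
Lemma krylov_symbol : exists W,
  has_symbol (weight_exp (entry_weight w)) W (\det (krylov (p 0) generic_mx))
    (signed_monomial K (p : bool, path_monomial)).
Proof.
pose th : {rmorphism O -> {poly O}} := weight_exp (entry_weight w).
pose B : 'M[{poly O}]_n := \matrix_(r, s) ('X_(mxvec_index r s) *: 'X^(w' r s)).
pose C : 'M[O]_n := \matrix_(r, s) (if w' r s == a then 'X_(mxvec_index r s) else 0).
pose D : 'rV[{poly O}]_n := \row_r 'X^(d r).
have thB : map_mx th generic_mx *m diag_mx D = diag_mx D *m B.
  apply/matrixP => r s; rewrite weight_exp_generic mul_mx_diag mul_diag_mx !mxE.
  by rewrite -scalerAl -scalerAr -!exprD ww'.
have Dv : D 0 (p 0) = 1 by rewrite mxE dp expr0.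
have := congr1 determinant (krylov_conj thB Dv).
rewrite det_mulmx det_diag => E.
have BC r s : top_coef a (B r s) (C r s).
  by rewrite !mxE; apply: top_coef_scaleXn.
(* Row j of the conjugated Krylov matrix has weight a j, and the conjugation multiplies the
   determinant by 'X^(\sum_r d r), which is divided out. *)
exists (\sum_(j < n) a * j - \sum_r d r)%N.
rewrite /has_symbol -det_map_mx (map_krylov th).
apply: top_coef_mulXn => //.
have -> : 'X^(\sum_r d r) = \prod_r D 0 r.
  rewrite (eq_bigr (fun r => 'X^(d r))) => [|r _]; last by rewrite mxE.
  by rewrite prodrXr.
rewrite E; suff <- : \det (krylov (p 0) C) = signed_monomial K (p : bool, path_monomial).
  exact: top_coef_krylov.
rewrite (@det_krylov_path _ _ p (fun i => 'X_(mxvec_index (p i) (p (inord i.+1))))).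
  rewrite /signed_monomial /path_monomial; congr (_ * _).
  rewrite (big_morph _ (@mpolyXD _ _) (@mpolyX0 _ _)); apply: eq_bigr => j _.
  by rewrite (big_morph _ (@mpolyXD _ _) (@mpolyX0 _ _)).
move=> j j' jj' s; rewrite mxE (w'p jj'); case: eqP => // ->.
by rewrite -jj' inord_val.
Qed.

Lemma path_monomial_support i : path_monomial i != 0%N ->
  exists2 j : 'I_n, (j < k)%N & i = mxvec_index (p j) (p (inord j.+1)).
Proof.
rewrite /path_monomial mnm_sumE sum_nat_eq0 negb_forall => /existsP[j].
rewrite /= mnm_sumE sum_nat_eq0 negb_forall => /existsP[i']; rewrite negb_imply mnm1E.
rewrite eqb0 negbK => /andP[ij /eqP <-]; exists i' => //.
by rewrite -ltnS (leq_trans _ (ltn_ord j)).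
Qed.

End KrylovSymbol.

(* With these weights the top part of the generic matrix is its diagonal, while
   that of a suitable diagonal conjugate is its first upper or lower diagonal; so
   the symbols of the char_coef only involve the diagonal variables, and those of
   the two Krylov determinants below only the off-diagonal ones. *)
Definition square_weight : 'M[nat]_n := \matrix_(r, s) (n ^ 2 - ((r - s) + (s - r)) ^ 2)%N.

Lemma sum_double_le (f : 'I_n -> nat) : (forall r, f r <= 2 * r)%N ->
  (\sum_r f r <= \sum_(j < n) (n ^ 2 + 1) * j)%N.
Proof.
move=> H; apply: leq_sum => j _; apply: leq_trans (H j) _.
by rewrite leq_mul2r; apply/orP; right; rewrite addn1 ltnS expn_gt0.
Qed.

(** The twist d r = 2 r completes the square: n^2 - (r - s)^2 + 2 (s - r) = n^2 + 1 - (r + 1 - s)^2,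
    maximal for s = r + 1. As r + 1 - s has absolute value at most n, no subtraction is
    truncated. *)
Lemma super_symbol : exists W,
  has_symbol (weight_exp (entry_weight square_weight)) W (\det (krylov 0 generic_mx))
    (signed_monomial K (false, path_monomial 1%g)).
Proof.
have := @krylov_symbol square_weight
  (\matrix_(r, s) (n ^ 2 + 1 - ((r.+1 - s) + (s - r.+1)) ^ 2)%N)
  (fun r => 2 * r)%N (n ^ 2 + 1) 1%g.
rewrite perm1 odd_perm1; apply => //.
- move=> r s; rewrite !mxE; have := ltn_ord r; have := ltn_ord s.
  have [rs|sr] := leqP s r.
    rewrite -(subnK rs); set t := (r - s)%N => s_n t_n.
    rewrite addnK -addSn addnK.
    have -> : (s - (t + s) = 0)%N by lia.
    have -> : (s - (t.+1 + s) = 0)%N by lia.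
    rewrite !addn0; have : (t.+1 ^ 2 <= n ^ 2)%N by rewrite leq_sqr; lia.
    by rewrite -!mulnn; lia.
  rewrite -(subnK sr); set t := (s - r.+1)%N => s_n r_n.
  have -> : (r - (t + r.+1) + (t + r.+1 - r) = t.+1)%N by lia.
  have -> : (r.+1 - (t + r.+1) + (t + r.+1 - r.+1) = t)%N by lia.
  have : (t.+1 ^ 2 <= n ^ 2)%N by rewrite leq_sqr; lia.
  by rewrite -!mulnn; lia.
- by move=> r s; rewrite mxE leq_subr.
- exact: sum_double_le.
move=> j j' jj' s; rewrite !perm1 mxE -[s == j'](inj_eq val_inj) /= jj'.
exact: dist_sqr_eq.
Qed.

(** The opposite twist d r = 2 (k - r) gives n^2 + 1 - (s + 1 - r)^2, maximal for s = r - 1; the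
    path descends from the last index, whence the reversal permutation. *)
Lemma sub_symbol : exists W,
  has_symbol (weight_exp (entry_weight square_weight)) W (\det (krylov ord_max generic_mx))
    (signed_monomial K (perm (@rev_ord_inj n) : bool, path_monomial (perm (@rev_ord_inj n)))).
Proof.
have rev0 : perm (@rev_ord_inj n) 0 = ord_max by rewrite permE; apply/val_inj; rewrite /= subn1.
have := @krylov_symbol square_weight
  (\matrix_(r, s) (n ^ 2 + 1 - ((s.+1 - r) + (r - s.+1)) ^ 2)%N)
  (fun r => 2 * (k - r))%N (n ^ 2 + 1) (perm (@rev_ord_inj n)).
rewrite rev0; apply => //.
- move=> r s; rewrite !mxE; have := ltn_ord r; have := ltn_ord s.
  have [rs|sr] := leqP r s.
    rewrite -(subnK rs); set t := (s - r)%N => s_n t_n.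
    have -> : (r - (t + r) + (t + r - r) = t)%N by lia.
    have -> : ((t + r).+1 - r + (r - (t + r).+1) = t.+1)%N by lia.
    have : (t.+1 ^ 2 <= n ^ 2)%N by rewrite leq_sqr; lia.
    by rewrite -!mulnn; lia.
  rewrite -(subnK sr); set t := (r - s.+1)%N => s_n r_n.
  have -> : ((t + s.+1) - s + (s - (t + s.+1)) = t.+1)%N by lia.
  have -> : (s.+1 - (t + s.+1) + (t + s.+1 - s.+1) = t)%N by lia.
  have : (t.+1 ^ 2 <= n ^ 2)%N by rewrite leq_sqr; lia.
  by rewrite -!mulnn; lia.
- by move=> r s; rewrite mxE leq_subr.
- by rewrite /= subnn muln0.
- rewrite (reindex_inj rev_ord_inj) /=; apply: sum_double_le => r /=.
  by have := ltn_ord r; lia.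
move=> j j' jj' s; rewrite !permE mxE -[s == _](inj_eq val_inj) /= jj'.
have := ltn_ord s; have := ltn_ord j'; rewrite jj' => j'n sn.
by rewrite -[in RHS]eqSS -subSn// subSS dist_sqr_eq eq_sym.
Qed.

End GenericMatrix.

Section SymbolCompleteSym.
Variables (O : comNzRingType) (theta : {rmorphism O -> {poly O}}) (d : nat -> O).

Lemma symbolM V W F G f g : has_symbol theta V F f -> has_symbol theta W G g ->
  has_symbol theta (V + W) (F * G) (f * g).
Proof. by move=> sF sG; rewrite /has_symbol rmorphM; exact: top_coefM. Qed.

Lemma symbolX W F f m : has_symbol theta W F f ->
  has_symbol theta (W * m) (F ^+ m) (f ^+ m).
Proof. by move=> sF; rewrite /has_symbol rmorphXn; exact: top_coefX. Qed.

Lemma symbol_sum W (I : Type) (r : seq I) (P : pred I) (F f : I -> O) :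
  (forall i, P i -> has_symbol theta W (F i) (f i)) ->
  has_symbol theta W (\sum_(i <- r | P i) F i) (\sum_(i <- r | P i) f i).
Proof. by move=> H; rewrite /has_symbol rmorph_sum; exact: top_coef_sum. Qed.

Lemma symbol0 W : has_symbol theta W 0 0.
Proof. by rewrite /has_symbol rmorph0; exact: top_coef0. Qed.

Lemma symbolN W F f : has_symbol theta W F f -> has_symbol theta W (- F) (- f).
Proof. by rewrite /has_symbol rmorphN; exact: top_coefN. Qed.

Lemma symbol_nat m : has_symbol theta 0 m%:R m%:R.
Proof. by rewrite /has_symbol rmorph_nat -polyC_natr; exact: top_coefC. Qed.

Lemma symbol_complete_sym a : (forall i, has_symbol theta a (d i) (d i)) ->
  forall J m, has_symbol theta (a * m) (complete_sym d J m) (complete_sym d J m).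
Proof.
move=> sd; elim=> [|J IH] m /=.
  by case: m => [|m] /=; [rewrite muln0; exact: symbol_nat|exact: symbol0].
apply: symbol_sum => i _.
have -> : (a * m = a * i + a * (m - i))%N by rewrite -mulnDr subnKC// -ltnS.
by apply: symbolM => //; exact: symbolX.
Qed.

(** The last variable [d J] is the heaviest, so its pure power outweighs every other monomial. *)
Lemma symbol_complete_sym_lex n : (forall i, (i < n)%N -> has_symbol theta i.+1 (d i) (d i)) ->
  forall J m, (J < n)%N -> has_symbol theta (J.+1 * m) (complete_sym d J.+1 m) (d J ^+ m).
Proof.
move=> sd; elim=> [|J IH] m Jn.
  rewrite complete_sym_recr big1 ?add0r; first by apply: symbolX; exact: sd.
  by move=> i _ /=; rewrite -subnSK//= mulr0.
rewrite complete_sym_recr -[X in has_symbol _ _ _ X]add0r /has_symbol rmorphD.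
apply: top_coefD; last by apply: symbolX; exact: sd.
apply: top_coef_lt; rewrite rmorph_sum; apply: leq_trans (size_sum _ _ _) _.
apply/bigmax_leqP => i _.
have [H _] := symbolM (symbolX i (sd _ Jn)) (IH (m - i)%N (ltnW Jn)).
apply: leq_trans H _.
have := ltn_ord i; nia.
Qed.

End SymbolCompleteSym.

Lemma char_poly_symbol (O : comNzRingType) (theta : {rmorphism O -> {poly O}}) k a
    (A : 'M[O]_k.+1) (d : nat -> O) i :
  (forall r s, top_coef a (theta (A r s)) (if r == s then d r else 0)) ->
  (i <= k.+1)%N ->
  has_symbol theta (a * (k.+1 - i)) (char_poly A)`_i (\prod_(j < k.+1) ('X - (d j)%:P))`_i.
Proof.
move=> AC ik; pose C : 'M[O]_k.+1 := diag_mx (\row_j d j).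
have BC r s : top_coef a (map_mx theta A r s) (C r s).
  have := AC r s; rewrite !mxE; case: eqP => [->|]; by rewrite ?mulr1n ?mulr0n.
have := graded_top_char_poly BC i; rewrite ik -map_char_poly coef_map.
rewrite (char_poly_trig (diag_mx_is_trig _)).
rewrite (eq_bigr (fun j : 'I_k.+1 => 'X - (d j)%:P)) // => j _.
by rewrite !mxE eqxx mulr1n.
Qed.

Lemma mxvec_index_inj m n (i i' : 'I_m) (j j' : 'I_n) :
  mxvec_index i j = mxvec_index i' j' -> i = i' /\ j = j'.
Proof. by rewrite /mxvec_index => /cast_ord_inj /enum_rank_inj[]. Qed.

(** * The regular sequence of Krylov determinants and Newton coefficients *)

Section Regular.
Variables (K : idomainType) (k : nat).
Local Notation n := k.+1.
Local Notation O := {mpoly K[n * n]}.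
Local Notation d := (diag_var K k).
Local Notation theta := (weight_exp (entry_weight (square_weight k)) : {rmorphism O -> {poly O}}).

Lemma symbol_square_diag i : has_symbol theta (n ^ 2) (d i) (d i).
Proof. by have := symbol_diag K (square_weight k) i; rewrite mxE subnn exp0n// subn0. Qed.

Lemma char_coef_symbol i : (i <= n)%N ->
  has_symbol theta (n ^ 2 * (n - i)) (char_coef K k i) (\prod_(j < n) ('X - (d j)%:P))`_i.
Proof.
move=> i_n; apply: char_poly_symbol => // r s.
have -> : theta (generic_mx K k r s) = 'X_(mxvec_index r s) *: 'X^(square_weight k r s).
  rewrite [generic_mx K k r s]mxE.
  apply: etrans (@weight_expX K _ (entry_weight (square_weight k)) (mxvec_index r s)) _.
  by rewrite /entry_weight mxvecE.
rewrite mxE.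
have -> : (if r == s then d r else 0) =
    if (n ^ 2 - (r - s + (s - r)) ^ 2 == n ^ 2)%N then 'X_(mxvec_index r s) else 0 :> O.
  have -> : (n ^ 2 - (r - s + (s - r)) ^ 2 == n ^ 2)%N = (r == s).
    apply/eqP/eqP => [E|->]; last by rewrite subnn exp0n// subn0.
    have /eqP : ((r - s + (s - r)) ^ 2 = 0)%N.
      have : (0 < n ^ 2)%N by rewrite expn_gt0.
      by move: E; move: (_ ^ 2)%N (n ^ 2)%N => x y; lia.
    by rewrite expn_eq0 andbT => /eqP E'; apply/val_inj => /=; lia.
  by case: eqP => // ->; rewrite /diag_var inord_val.
by apply: top_coef_scaleXn; rewrite leq_subr.
Qed.

(** The symbols of the characteristic coefficients are the coefficients of the product of the 'X -
    d_j. Its divided difference at d_0, ..., d_J is 0, and the leading term 'X^n contributes h_(n-J)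
    to it; the remaining terms therefore sum to - h_(n-J). *)
Lemma newton_coef_symbol J : (J < n)%N ->
  has_symbol theta (n ^ 2 * (n - J)) (newton_coef K k J.+1) (complete_sym d J.+1 (n - J)).
Proof.
move=> Jn.
have -> : complete_sym d J.+1 (n - J) =
    - \sum_(i < n) (\prod_(j < n) ('X - (d j)%:P))`_i * divdiff_exp d J.+1 i.
  have H : divdiff d n.+1 J.+1 (\prod_(j < n) ('X - (d j)%:P)) = 0.
    have -> : \prod_(j < n) ('X - (d j)%:P) =
        \prod_(j < J.+1) ('X - (d j)%:P) * \prod_(J.+1 <= j < n) ('X - (d j)%:P).
      by rewrite -!(big_mkord xpredT (fun j => 'X - (d j)%:P)) -big_cat_nat.
    apply: divdiff_prod0; rewrite -(big_mkord xpredT (fun j => 'X - (d j)%:P)).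
    by rewrite -big_cat_nat//= size_prod_XsubC size_iota subn0.
  move: H; rewrite /divdiff big_ord_recr /=.
  have -> : (\prod_(j < n) ('X - (d j)%:P))`_n = 1.
    have /monicP := monic_prod_XsubC (index_iota 0 n) xpredT d.
    by rewrite lead_coefE size_prod_XsubC size_iota subn0 /= big_mkord.
  rewrite mul1r {2}/divdiff_exp ltnS ltnW// subSS => /eqP.
  by rewrite addrC addr_eq0 => /eqP.
apply: symbolN; apply: symbol_sum => i _; rewrite /divdiff_exp ltnS subSS.
case: leqP => Ji; last by rewrite !mulr0; exact: symbol0.
have i_n := ltn_ord i.
have -> : (n ^ 2 * (n - J) = n ^ 2 * (n - i) + n ^ 2 * (i - J))%N.
  by rewrite -mulnDr; congr muln; lia.
apply: symbolM; first exact: char_coef_symbol (ltnW i_n).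
exact: symbol_complete_sym symbol_square_diag _ _.
Qed.

Definition newton_coefs : seq O := [seq newton_coef K k J.+1 | J <- iota 0 n].

Definition krylov_det v : O := \det (krylov v (generic_mx K k)).

(** The second degeneration: the path monomials, being off-diagonal, keep weight 0, while the
    diagonal variables are ordered so that complete symmetric functions become powers. *)
Let w2 : 'M[nat]_n := \matrix_(r, s) (if r == s then r.+1 else 0)%N.
Local Notation theta2 := (weight_exp (entry_weight w2) : {rmorphism O -> {poly O}}).

Lemma symbol_lex_diag i : (i < n)%N -> has_symbol theta2 i.+1 (d i) (d i).
Proof. by move=> i_n; have := symbol_diag K w2 i; rewrite mxE eqxx inordK. Qed.

Lemma symbol_lex_path (p : 'S_n) (b : bool) c : (forall j : 'I_n, (j < k)%N -> p j != p (inord j.+1)) ->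
  has_symbol theta2 0 (signed_monomial K (b, path_monomial p) ^+ c)
    (signed_monomial K (b, path_monomial p) ^+ c).
Proof.
move=> pj; rewrite -(mul0n c); apply: symbolX.
rewrite /signed_monomial -[0%N]/(0 + 0)%N; apply: symbolM.
  by case: b => /=; [rewrite expr1; apply: symbolN|]; exact: (symbol_nat _ 1).
rewrite -[X in has_symbol _ _ X]scale1r /has_symbol.
rewrite -[X in top_coef _ X]/(weight_exp (entry_weight w2) (1 *: 'X_[path_monomial p])).
rewrite weight_exp_monomial big1 ?expr0 ?scale1r => [|v _].
  by rewrite alg_polyC; exact: top_coefC.
have [/eqP->|/path_monomial_support[j jk ->]] := boolP (path_monomial p v == 0)%N.
  by rewrite muln0.
by rewrite /entry_weight mxvecE mxE (negPf (pj _ jk)).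
Qed.

Lemma signed_monomialX (b : bool) (u : 'X_{1..n * n}) c :
  signed_monomial K (b, u) ^+ c = signed_monomial K (b && odd c, (u *+ c)%MM).
Proof.
rewrite /signed_monomial exprMn mpolyXn -exprM; congr (_ * _).
by case: b; rewrite ?mul0n // mul1n /= signr_odd.
Qed.

Lemma symbols_map (O' : comNzRingType) (th : {rmorphism O' -> {poly O'}}) (I : eqType) (r : seq I) (f g : I -> O') :
  (forall i, i \in r -> exists W, has_symbol th W (f i) (g i)) ->
  symbols th (map f r) (map g r).
Proof.
elim: r => //= i r IH H; split; first by apply: H; rewrite inE eqxx.
by apply: IH => j jr; apply: H; rewrite inE jr orbT.
Qed.

Lemma mnm_coprimeP (u v : bool * 'X_{1..n * n}) :
  (forall i, u.2 i != 0%N -> v.2 i != 0%N -> False) -> mnm_coprime u v.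
Proof.
move=> H; apply/forallP => i; case: (eqVneq (u.2 i) 0%N) => //= ui.
by case: (eqVneq (v.2 i) 0%N) => // vi; case: (H i).
Qed.

Lemma mulmn_neq0 (u : 'X_{1..n * n}) c i : (u *+ c)%MM i != 0%N -> u i != 0%N.
Proof. by rewrite mulmnE muln_eq0 negb_or => /andP[]. Qed.

(** Two degenerations, by [theta] and then [theta2], end in monomials supported on the subdiagonal,
    the superdiagonal and distinct diagonal variables: they are pairwise coprime. The powers [b] and
    [c] are those by which division takes place in [kostant]. *)
Theorem regular_krylov_newton b c :
  regular_seq [:: krylov_det ord_max ^+ b, krylov_det 0 ^+ c & newton_coefs].
Proof.
rewrite /newton_coefs.
have : pairwise ltn (iota 0 n) by rewrite -sorted_pairwise ?iota_ltn_sorted//; exact: ltn_trans.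
have : forall J, J \in iota 0 n -> (J < n)%N by move=> J; rewrite mem_iota.
move: (iota 0 n) => l ln lsorted.
pose pr : 'S_n := perm (@rev_ord_inj n).
pose mt : 'X_{1..n * n} := path_monomial pr.
pose ms : 'X_{1..n * n} := path_monomial (1%g : 'S_n).
pose idx (J : nat) := mxvec_index (inord J : 'I_n) (inord J : 'I_n).
pose mdiag J : bool * 'X_{1..n * n} := (false, (U_(idx J) *+ (n - J))%MM).
pose us := [:: ((pr : bool) && odd b, (mt *+ b)%MM), (false, (ms *+ c)%MM) &
  [seq mdiag J | J <- l]].
pose gs := [:: signed_monomial K (pr : bool, mt) ^+ b, signed_monomial K (false, ms) ^+ c &
  [seq complete_sym d J.+1 (n - J) | J <- l]].
have mdiag0 J i : (mdiag J).2 i != 0%N -> i = idx J.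
  by move=> /mulmn_neq0; rewrite mnm1E eqb0 negbK => /eqP.
have path_diag (p : 'S_n) J i : (forall j : 'I_n, (j < k)%N -> p j != p (inord j.+1)) ->
    (path_monomial p) i != 0%N -> i = idx J -> False.
  move=> pj /path_monomial_support[j jk ->] /mxvec_index_inj[E1 E2].
  by have := pj j jk; rewrite E1 E2 eqxx.
have jne (j : 'I_n) : (j < k)%N -> j != inord j.+1.
  by move=> jk; rewrite -(inj_eq val_inj) /= inordK// neq_ltn ltnSn.
have pr_ne (j : 'I_n) : (j < k)%N -> pr j != pr (inord j.+1).
  by move=> /jne; rewrite (inj_eq perm_inj).
have p1_ne (j : 'I_n) : (j < k)%N -> (1%g : 'S_n) j != (1%g : 'S_n) (inord j.+1).
  by move=> /jne; rewrite (inj_eq perm_inj).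
have reg_us : regular_seq [seq signed_monomial K u | u <- us].
  apply: regular_monomials; rewrite /= -andbA; apply/and4P; split.
  - apply: mnm_coprimeP => i /mulmn_neq0 /path_monomial_support[j jk ->].
    move=> /mulmn_neq0 /path_monomial_support[j' j'k] /mxvec_index_inj[].
    rewrite !perm1 !permE => /(congr1 val) /= E1 /(congr1 val) /=.
    by rewrite !inordK ?ltnS//=; lia.
  - apply/allP => _ /mapP[J _ ->]; apply: mnm_coprimeP => i /mulmn_neq0 mi /mdiag0.
    exact: path_diag mi.
  - apply/allP => _ /mapP[J _ ->]; apply: mnm_coprimeP => i /mulmn_neq0 mi /mdiag0.
    exact: path_diag mi.
  rewrite pairwise_map; apply: (@sub_in_pairwise _ [pred J | J < n]%N ltn) => /=.
  - move=> J J' /= Jn J'n JJ'; apply: mnm_coprimeP => i /mdiag0 -> /mdiag0 /mxvec_index_inj[/(congr1 val)].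
    by rewrite /= !inordK// => E; rewrite E ltnn in JJ'.
  - by apply/allP => J /ln.
  exact: lsorted.
have reg_gs : regular_seq gs.
  apply: (regular_symbols (theta := theta2) (@weight_exp_inj _ _ _) (@weight_exp_coef _ _ _)) reg_us.
  split; first by rewrite -signed_monomialX; exists 0%N; exact: symbol_lex_path.
  split; first by rewrite -[signed_monomial K (false, (ms *+ c)%MM)](signed_monomialX false); exists 0%N; exact: symbol_lex_path.
  rewrite -map_comp; apply: symbols_map => J=> /ln Jn.
  exists (J.+1 * (n - J))%N.
  rewrite -[X in has_symbol _ _ _ X](signed_monomialX false (U_(idx J))) /signed_monomial expr0 mul1r.
  exact: (symbol_complete_sym_lex symbol_lex_diag).
apply: (regular_symbols (theta := theta) (@weight_exp_inj _ _ _) (@weight_exp_coef _ _ _)) reg_gs.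
split; first by have [W sW] := sub_symbol K k; exists (W * b)%N; exact: symbolX.
split; first by have [W sW] := super_symbol K k; exists (W * c)%N; exact: symbolX.
apply: symbols_map => J=> /ln Jn.
by exists (n ^ 2 * (n - J))%N; exact: newton_coef_symbol.
Qed.

End Regular.

(** * Evaluation of differentially homogeneous polynomials *)

Lemma rmorph_mmap n (R S T : comNzRingType) (f : {rmorphism R -> S}) (g : {rmorphism S -> T})
    (h : 'I_n -> S) (h' : 'I_n -> T) (f' : {rmorphism R -> T}) (P : {mpoly R[n]}) :
  (forall c, g (f c) = f' c) -> (forall i, g (h i) = h' i) ->
  g (mmap f h P) = mmap f' h' P.
Proof.
move=> gf gh; elim/mpolyind: P => [|c m p _ _ IH]; first by rewrite !mmap0 rmorph0.
rewrite !mmapD rmorphD IH; congr (_ + _).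
rewrite !mmapZ rmorphM gf !mmapX; congr (_ * _).
rewrite /mmap1 rmorph_prod; apply: eq_bigr => i _.
by rewrite rmorphXn gh.
Qed.

(** * Multiplication of jets by T *)

Section Shift.
Variables (k : nat) (R : comNzRingType).
Local Notation n := k.+1.

Definition shift_mx : 'M[R]_n := \matrix_(r, s) (if s == r.+1 :> nat then s%:R else 0).

Lemma shift_mulmx m (B : 'M[R]_(n, m)) (j j' : 'I_n) : j' = j.+1 :> nat ->
  row j (shift_mx *m B) = j'%:R *: row j' B.
Proof.
move=> jj'; apply/rowP => s; rewrite !mxE (bigD1 j') //= big1 ?addr0 => [|i ij].
  by rewrite mxE jj' eqxx.
rewrite mxE; case: eqP => [E|]; last by rewrite mul0r.
by case/eqP: ij; apply/val_inj; rewrite /= E jj'.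
Qed.

Lemma shift_mulmx_max m (B : 'M[R]_(n, m)) : row ord_max (shift_mx *m B) = 0.
Proof.
apply/rowP => s; rewrite !mxE big1 // => i _; rewrite mxE /=.
by rewrite ltn_eqF ?mul0r.
Qed.

Lemma leibniz_shift (v : 'rV[R]_n) : leibniz v *m shift_mx = shift_mx *m leibniz v.
Proof.
apply/row_matrixP => r.
have -> : row r (leibniz v *m shift_mx) =
    \row_s ((v 0 (inord (s.-1 - r)) *+ 'C(s.-1, r)) *+ s).
  apply/rowP => s; rewrite !mxE; case: s => [[|s] ltsn] /=.
    by rewrite mulr0n big1// => i _; rewrite !mxE /= mulr0.
  rewrite (bigD1 (Ordinal (ltnW ltsn))) //= big1 ?addr0 => [|i ij].
    by rewrite !mxE /= eqxx mulr_natr.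
  rewrite [X in _ * X]mxE /= eqSS; case: eqP => [E|]; last by rewrite mulr0.
  by case/eqP: ij; apply/val_inj.
have [rk|] := ltnP r k; last first.
  move=> kr; have -> : r = ord_max by apply/val_inj/eqP; rewrite /= eqn_leq kr -ltnS ltn_ord.
  rewrite shift_mulmx_max; apply/rowP => s; rewrite !mxE.
  case: s => [[|s] ltsn] /=; first by rewrite mulr0n.
  by rewrite bin_small ?mulr0n ?mul0rn.
rewrite (@shift_mulmx _ _ r (Ordinal (rk : r.+1 < n)%N)) //.
apply/rowP => s; rewrite !mxE /=.
case: s => [[|s] ltsn] /=; first by rewrite bin0n mulr0n mulr0n mulr0.
rewrite subSS mulr_natl -!mulrnA; congr (_ *+ _).
by have := mul_bin_diag s.+1 r; rewrite /=; lia.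
Qed.

(** In other words, row j of [leibniz w] is the jet of w T^j / j!. *)
Lemma row_shift_exp (w : 'rV[R]_n) (j : 'I_n) :
  w *m shift_mx ^+ j = (j`!)%:R *: row j (leibniz w).
Proof.
case: j => j ltj; elim: j ltj => [|j IH] ltj /=.
  rewrite expr0 mulmx1 scale1r; apply/rowP => s.
  by rewrite !mxE /= bin0 subn0 inord_val.
have ltj' := ltnW ltj.
rewrite exprSr -[_ ^+ j * _]/(_ *m _) mulmxA (IH ltj') -scalemxAl -row_mul leibniz_shift.
rewrite (@shift_mulmx _ _ (Ordinal ltj') (Ordinal ltj)) // scalerA -natrM mulnC.
by rewrite factS.
Qed.

End Shift.

Section Evaluation.
Variables (C : fieldType) (N k : nat).
Local Notation n := k.+1.
Local Notation V := {mpoly C[N.+1 * k.+1]}.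

Definition jet_eval (R : comNzRingType) (f : {rmorphism C -> R}) (x : 'M[R]_(N.+1, n)) (P : V) : R :=
  mmap f (mxvec x 0) P.

HB.instance Definition _ (R : comNzRingType) (f : {rmorphism C -> R}) x :=
  GRing.RMorphism.copy (jet_eval f x : V -> R) (mmap f (mxvec x 0)).

Definition Xmx : 'M[V]_(N.+1, n) := \matrix_(i, j) @Xvar C N k i j.

Lemma jet_evalX (R : comNzRingType) (f : {rmorphism C -> R}) x i j :
  jet_eval f x (Xvar C i j) = x i j.
Proof. by rewrite /jet_eval /Xvar mmapX mmap1U mxvecE. Qed.

Lemma jet_eval_Xmx (R : comNzRingType) (f : {rmorphism C -> R}) x :
  map_mx (jet_eval f x) Xmx = x.
Proof. by apply/matrixP => i j; rewrite !mxE jet_evalX. Qed.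

Lemma jet_evalC (R : comNzRingType) (f : {rmorphism C -> R}) x c :
  jet_eval f x c%:MP = f c.
Proof. by rewrite /jet_eval mmapC. Qed.

Lemma jet_eval_comp (R S : comNzRingType) (f : {rmorphism C -> R}) (g : {rmorphism R -> S})
    (h : {rmorphism C -> S}) x P :
  (forall c, g (f c) = h c) ->
  g (jet_eval f x P) = jet_eval h (map_mx g x) P.
Proof.
move=> gf; apply: rmorph_mmap => // i.
by case/mxvec_indexP: i => i j; rewrite !mxvecE mxE.
Qed.

Lemma iter_series_deriv (a : nat -> C) j i :
  iter j (@series_deriv C) a i = a (i + j)%N *+ ((i + j) ^_ j).
Proof.
elim: j i => [|j IH] i /=; first by rewrite addn0 ffactn0.
rewrite /series_deriv IH -mulrnA addSnnS ffactnSr; congr (_ *+ (_ * _)).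
by rewrite addnS -addSn addnK.
Qed.

Lemma series_act_eval (a : nat -> C) (P : V) : series_act a P =
  jet_eval (@mpolyC (N.+1 * n) C)
    (Xmx *m leibniz (map_mx (@mpolyC (N.+1 * n) C) (\row_j (a j *+ j`!)))) P.
Proof.
congr (mmap _ (mxvec _ 0) P); apply/matrixP => i m; rewrite !mxE big_mkcond.
apply: eq_bigr => j _; rewrite !mxE; case: leqP => [jm|mj]; last first.
  by rewrite bin_small ?mulr0n ?mulr0.
rewrite iter_series_deriv add0n ffactnn inordK; last first.
  by rewrite ltnS (leq_trans (leq_subr _ _))// -ltnS.
by rewrite -mul_mpolyC mulr_natl mulrC; congr (_ * _); exact: raddfMn.
Qed.

Hypothesis charC : forall m, m.+1%:R != 0 :> C.

Lemma natrS_neq0 (L : idomainType) (f : {rmorphism C -> L}) m : m.+1%:R != 0 :> L.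
Proof. by rewrite -(rmorph_nat f) fmorph_eq0. Qed.

Lemma poly_eq0_natroots (L : idomainType) (f : {rmorphism C -> L}) (q : {poly L}) :
  (forall m, q.[m.+1%:R] = 0) -> q = 0.
Proof.
move=> H; apply/eqP; apply: contraT => q0.
have inj : {in iota 0 (size q) &, injective (fun m => m.+1%:R : L)}.
  have lt_neq m m' : (m < m')%N -> m.+1%:R != m'.+1%:R :> L.
    move=> lt; have -> : m'.+1 = (m.+1 + (m' - m.+1).+1)%N by lia.
    by rewrite natrD -subr_eq0 opprD addrA subrr sub0r oppr_eq0 (natrS_neq0 f).
  move=> m m' _ _ /= E; have [/lt_neq|/lt_neq|//] := ltngtP m m'.
    by rewrite E eqxx.
  by rewrite E eqxx.
have := max_poly_roots q0 (rs := [seq m.+1%:R | m <- iota 0 (size q)]).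
rewrite size_map size_iota ltnn; apply.
  by apply/allP => _ /mapP[m _ ->]; rewrite rootE H.
by rewrite map_inj_in_uniq ?iota_uniq.
Qed.

(* Differential homogeneity, required for power series with constant
   coefficients, holds for coefficients in any domain: each coefficient is made
   arbitrary in turn, a polynomial with infinitely many roots being zero. *)
Lemma jet_eval_leibniz d (P : V) (L : idomainType) (f : {rmorphism C -> L})
    (x : 'M[L]_(N.+1, n)) (v : 'rV[L]_n) :
  @diff_homog C N k d P -> jet_eval f (x *m leibniz v) P = v 0 0 ^+ d * jet_eval f x P.
Proof.
move=> [_ Pd]; pose good (i : nat) (v : 'rV[L]_n) := forall j : 'I_n, (i <= j)%N ->
  exists2 c, v 0 j = f c & j = 0 -> c != 0.
suff H i : forall v, good i v ->
    jet_eval f (x *m leibniz v) P = v 0 0 ^+ d * jet_eval f x P.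
  by apply: (H n) => j; rewrite leqNgt ltn_ord.
elim: i => [|i IH] {}v gv.
  have [c vc c0] : exists2 c : 'rV[C]_n, v = map_mx f c & c 0 0 != 0.
    have H (j : 'I_n) : exists c, v 0 j = f c /\ (j = 0 -> c != 0).
      by have [c vc c0] := gv j (leq0n _); exists c.
    have [c Hc] := boolp.choice H.
    by exists (\row_j c j); [apply/rowP => j; rewrite !mxE (Hc j).1|rewrite mxE; apply: (Hc 0).2].
  (* A series whose derivatives at 0 are the entries of c; its coefficients beyond order k are
     arbitrary. *)
  pose a m := c 0 (inord m) / (m`!)%:R.
  have facC m : (m`!)%:R != 0 :> C by rewrite -(prednK (fact_gt0 m)) charC.
  have ac : \row_j (a j *+ j`!) = c.
    by apply/rowP => j; rewrite mxE /a inord_val -mulr_natr divfK.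
  have a0 : a 0%N = c 0 0 by rewrite -ac mxE mulr1n.
  have := Pd a; rewrite a0 => /(_ c0); rewrite series_act_eval ac.
  move=> /(congr1 (jet_eval f x)).
  rewrite (jet_eval_comp (h := f)) => [|c']; last exact: jet_evalC.
  rewrite map_mxM jet_eval_Xmx map_leibniz -map_mx_comp.
  have -> : map_mx (jet_eval f x \o @mpolyC (N.+1 * n) C) c = v.
    by rewrite vc; apply/rowP => j; rewrite !mxE /= jet_evalC.
  by rewrite -mul_mpolyC rmorphM /= jet_evalC rmorphXn /= vc mxE.
have [ni|i_n] := leqP n i; first by apply: IH => j ij; have := ltn_ord j; lia.
pose io := Ordinal i_n.
pose w (z : L) : 'rV[L]_n := \row_j (if j == io then z else v 0 j).
pose W : 'rV[{poly L}]_n := \row_j (if j == io then 'X else (v 0 j)%:P).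
pose fp : {rmorphism C -> {poly L}} := @polyC L \o f.
pose q : {poly L} := jet_eval fp (map_mx (@polyC L) x *m leibniz W) P
  - W 0 0 ^+ d * (jet_eval f x P)%:P.
have Ww z : map_mx (horner_eval z) W = w z.
  by apply/rowP => j; rewrite !mxE; case: eqP => _; rewrite /horner_eval ?hornerX ?hornerC.
have qE z : q.[z] = jet_eval f (x *m leibniz (w z)) P - w z 0 0 ^+ d * jet_eval f x P.
  rewrite /q hornerD hornerN hornerM hornerC horner_exp.
  rewrite -[X in X - _]/(horner_eval z _) (jet_eval_comp (h := f)) => [|c]; last first.
    by rewrite /= /horner_eval hornerC.
  rewrite map_mxM map_leibniz Ww -map_mx_comp.
  have -> : map_mx (horner_eval z \o @polyC L) x = x.
    by apply/matrixP => r s; rewrite mxE /= /horner_eval hornerC.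
  by rewrite -(Ww z) !mxE.
have q0 : q = 0.
  apply: (poly_eq0_natroots f) => m; rewrite qE; apply/eqP; rewrite subr_eq0; apply/eqP.
  apply: IH => j ij; rewrite mxE; case: eqP => [_|/eqP jio].
    by exists m.+1%:R; rewrite ?rmorph_nat.
  by apply: gv; rewrite ltn_neqAle ij andbT; apply: contraNneq jio => E; apply/eqP/val_inj; rewrite /= E.
have := qE (v 0 io); rewrite q0 horner0 => /esym/eqP; rewrite subr_eq0.
suff -> : w (v 0 io) = v by move/eqP.
by apply/rowP => j; rewrite mxE; case: eqP => // ->.
Qed.

End Evaluation.

Lemma mpoly_ring_ind n (R : comNzRingType) (Q : {mpoly R[n]} -> Prop) :
  (forall c, Q c%:MP) -> (forall i, Q 'X_i) ->
  (forall a b, Q a -> Q b -> Q (a + b)) -> (forall a b, Q a -> Q b -> Q (a * b)) ->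
  forall a, Q a.
Proof.
move=> QC QX QD QM a; elim/mpolyind: a => [|c m p _ _ IH].
  by rewrite -mpolyC0.
apply: (QD) => //; rewrite -mul_mpolyC mpolyXE_id; apply: (QM) => //.
apply: (big_ind Q) => //; first by rewrite -mpolyC1.
by move=> i _; elim: (m i) => [|e IHe]; rewrite ?expr0 -?mpolyC1// exprS; exact: QM.
Qed.

Lemma row_invmx_mul (L : fieldType) n m (B : 'M[L]_n) (D : 'M[L]_(n, m)) i :
  B \in unitmx -> row i B = row i 1%:M -> row i (invmx B *m D) = row i D.
Proof.
move=> Bu Bi; rewrite -[in RHS](mul1mx D) -(mulmxV Bu) -mulmxA [in RHS]row_mul Bi.
by rewrite -row_mul mul1mx.
Qed.

(** * Functions on regular nilpotent matrices *)

Section KrylovShift.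
Variables (k : nat) (R : comNzRingType).
Local Notation n := k.+1.

Definition fact_mx : 'M[R]_n := diag_mx (\row_j (j`!)%:R).

(** Row j of the left-hand side is e_v M Z^j, computed by [row_shift_exp]. In characteristic 0 and
    for invertible M, the Krylov determinant of row v thus vanishes exactly when the entry M v 0
    does. *)
Lemma krylov_shift (A M : 'M[R]_n) v : A *m M = M *m shift_mx k R ->
  krylov v A *m M = fact_mx *m leibniz (row v M).
Proof.
move=> AM; have AMX j : A ^+ j *m M = M *m shift_mx k R ^+ j.
  elim: j => [|j IH]; first by rewrite !expr0 mul1mx mulmx1.
  by rewrite exprSr -[_ * A]/(_ *m A) -mulmxA AM mulmxA IH -mulmxA exprSr.
apply/row_matrixP => j; rewrite row_mul row_krylov -row_mul AMX row_mul row_shift_exp.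
by rewrite mul_diag_mx; apply/rowP => s; rewrite !mxE.
Qed.

Lemma det_fact_mx : \det fact_mx = \prod_(j < n) (j`!)%:R.
Proof. by rewrite det_diag; apply: eq_bigr => j _; rewrite mxE. Qed.

End KrylovShift.

Lemma map_fact_mx k (R S : comNzRingType) (f : {rmorphism R -> S}) :
  map_mx f (fact_mx k R) = fact_mx k S.
Proof. by apply/matrixP => r s; rewrite !mxE rmorphMn rmorph_nat. Qed.

Definition unit_shift_mx (k : nat) (R : nzRingType) : 'M[R]_k.+1 :=
  \matrix_(r, t) (t == r.+1 :> nat)%:R.

Lemma map_unit_shift_mx k (R S : nzRingType) (f : {rmorphism R -> S}) :
  map_mx f (unit_shift_mx k R) = unit_shift_mx k S.
Proof. by apply/matrixP => r t; rewrite !mxE rmorph_nat. Qed.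

(** The diagonal matrix of factorials conjugates the shift with entries 1 into [shift_mx]; the
    condition on row 0 of B makes M 0 0 the factorial of 0. *)
Lemma unit_shift_conj (L : fieldType) k (B : 'M[L]_k.+1) :
  (forall m, m.+1%:R != 0 :> L) -> B \in unitmx -> row 0 B = row 0 1%:M ->
  exists M, [/\ M \in unitmx, M 0 0 != 0 &
    invmx B *m unit_shift_mx k L *m B *m M = M *m shift_mx k L].
Proof.
move=> charL Bu B0; pose D := fact_mx k L.
have DU : D \in unitmx.
  rewrite unitmxE unitfE det_fact_mx; apply/prodf_neq0 => j _.
  by rewrite -(prednK (fact_gt0 j)) charL.
exists (invmx B *m D); split; first by rewrite unitmx_mul unitmx_inv Bu.
  have -> : (invmx B *m D) 0 0 = row 0 (invmx B *m D) 0 0 by rewrite [RHS]mxE.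
  by rewrite row_invmx_mul// !mxE /= mulr1n oner_neq0.
have Dup : unit_shift_mx k L *m D = D *m shift_mx k L.
  apply/matrixP => r t; rewrite mul_mx_diag mul_diag_mx !mxE.
  case: eqP => [->|_]; last by rewrite mul0r mulr0.
  by rewrite mul1r -natrM mulnC -factS.
by rewrite -[_ *m shift_mx _ _]mulmxA -Dup !mulmxA mulmxK.
Qed.

(** Compares G with B^-1 U B without denominators other than det B, so that the defect can be
    located in an ideal. *)
Lemma adj_conj_defect (R : comNzRingType) (L : fieldType) (f : {rmorphism R -> L}) k
    (B G U : 'M[R]_k.+1) : f (\det B) != 0 ->
  forall r t, f (\det B) * (f (G r t) -
    (invmx (map_mx f B) *m map_mx f U *m map_mx f B) r t) =
    f ((\adj B *m (B *m G - U *m B)) r t).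
Proof.
move=> B0; set BL := map_mx f B.
have BU : BL \in unitmx by rewrite unitmxE unitfE det_map_mx.
have adjE : \adj BL = \det BL *: invmx BL.
  by rewrite /invmx BU scalerA divff ?scale1r// det_map_mx.
move=> r t.
have -> : f ((\adj B *m (B *m G - U *m B)) r t) =
  map_mx f (\adj B *m (B *m G - U *m B)) r t by rewrite [RHS]mxE.
rewrite map_mxM map_mx_adj adjE -scalemxAl -det_map_mx [RHS]mxE; congr (_ * _).
have -> : f (G r t) - (invmx BL *m map_mx f U *m BL) r t =
  (map_mx f G - invmx BL *m map_mx f U *m BL) r t by rewrite !mxE.
by rewrite map_mxB !map_mxM mulmxBr mulmxA mulVmx// mul1mx mulmxA.
Qed.

Section KrylovField.
Variables (C : fieldType) (N k : nat).
Hypothesis charC : forall m, m.+1%:R != 0 :> C.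
Local Notation n := k.+1.

Lemma factr_neq0 (L : idomainType) (f : {rmorphism C -> L}) m : (m`!)%:R != 0 :> L.
Proof. by rewrite -(prednK (fact_gt0 m)) (natrS_neq0 charC f). Qed.

(** By [krylov_shift], [\adj Kr *m fact_mx] is M acted on by the jet det Kr / w, w being row v of M.
    Homogeneity of degree q n gives the factor (det Kr / w_0)^(q n), from which w_0 is eliminated by
    det Kr det M = det D w_0^n; this leaves the exponent q k. *)
Lemma jet_eval_krylov (L : fieldType) (f : {rmorphism C -> L}) (y : 'M[L]_(N.+1, n))
    (A M : 'M[L]_n) v q (P : Vk C N k) :
  diff_homog (q * n) P -> M \in unitmx -> A *m M = M *m shift_mx k L ->
  \det (krylov v A) != 0 ->
  jet_eval f (y *m (\adj (krylov v A) *m fact_mx k L)) P =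
  (\det (fact_mx k L) / \det M) ^+ q * \det (krylov v A) ^+ (q * k) * jet_eval f (y *m M) P.
Proof.
move=> Pq Mu AM s0; set Kr := krylov v A; set D := fact_mx k L; set w := row v M.
have KM : Kr *m M = D *m leibniz w := krylov_shift v AM.
have dM : \det M != 0 by rewrite -unitfE -unitmxE.
have dKM : \det Kr * \det M = \det D * w 0 0 ^+ n.
  by rewrite -det_mulmx KM det_mulmx det_leibniz.
have w0 : w 0 0 != 0.
  apply: contra_neq (mulf_neq0 s0 dM) => w0.
  by rewrite -/Kr dKM w0 expr0n mulr0.
have dD : \det D != 0.
  by apply: contra_neq (mulf_neq0 s0 dM) => D0; rewrite -/Kr dKM D0 mul0r.
pose u := jet_div (jet1 k L) w.
have lu : leibniz w *m leibniz u = 1%:M.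
  by rewrite leibniz_div// leibniz1 mul1mx mulmxV// leibniz_unit.
have E : \adj Kr *m D = M *m leibniz (\det Kr *: u).
  have -> : leibniz (\det Kr *: u) = \det Kr *: leibniz u.
    by apply/matrixP => r s; rewrite !mxE mulrnAr.
  have KrE : Kr *m (M *m leibniz u) = D by rewrite mulmxA KM -mulmxA lu mulmx1.
  by rewrite -[in LHS]KrE mulmxA mul_adj_mx mul_scalar_mx scalemxAr.
rewrite E mulmxA (jet_eval_leibniz charC _ _ _ Pq) mxE jet_div0// mxE eqxx div1r.
congr (_ * _).
have sE : \det Kr = \det D / \det M * w 0 0 ^+ n by rewrite mulrAC -dKM mulfK.
rewrite exprMn exprVn mulnS exprD.
rewrite [X in X * _ / _]( _ : _ = (\det D / \det M) ^+ q * w 0 0 ^+ (n * q)); last first.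
  by rewrite exprM -exprMn -sE.
have -> : (n * q = q + q * k)%N by rewrite mulnC mulnS.
by rewrite mulrAC mulfK ?mulrA// expf_neq0.
Qed.

End KrylovField.

(** * Equations of the regular nilpotent matrices *)

Section Kostant.
Variables (K : idomainType) (k : nat).
Local Notation n := k.+1.
Local Notation O := {mpoly K[n * n]}.
Local Notation gen := (generic_mx K k).
Local Notation newton := (newton_coefs K k).

Definition mx_eval (L : comNzRingType) (j : {rmorphism K -> L}) (A : 'M[L]_n) (F : O) : L :=
  mmap j (mxvec A 0) F.

HB.instance Definition _ (L : comNzRingType) (j : {rmorphism K -> L}) A :=
  GRing.RMorphism.copy (mx_eval j A : O -> L) (mmap j (mxvec A 0)).

Lemma mx_evalC (L : comNzRingType) (j : {rmorphism K -> L}) A c : mx_eval j A c%:MP = j c.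
Proof. by rewrite /mx_eval mmapC. Qed.

Lemma mx_evalX (L : comNzRingType) (j : {rmorphism K -> L}) A r s :
  mx_eval j A 'X_(mxvec_index r s) = A r s.
Proof. by rewrite /mx_eval mmapX mmap1U mxvecE. Qed.

Lemma mx_eval_generic (L : comNzRingType) (j : {rmorphism K -> L}) A :
  map_mx (mx_eval j A) gen = A.
Proof. by apply/matrixP => r s; rewrite !mxE mx_evalX. Qed.

Lemma mx_eval_krylov_det (L : comNzRingType) (j : {rmorphism K -> L}) A v :
  mx_eval j A (krylov_det K v) = \det (krylov v A).
Proof. by rewrite /krylov_det -det_map_mx map_krylov mx_eval_generic. Qed.

(** The passage from characteristic to Newton coefficients is triangular with diagonal entries -1,
    so it is inverted by descending induction on i. *)
Lemma char_coef_newton i : (i < n)%N -> ideal_span newton (char_coef K k i).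
Proof.
have [e] := ubnP (n - i); elim: e i => // e IH i ie i_n.
have -> : char_coef K k i = - newton_coef K k i.+1 -
    \sum_(l < n | (i < l)%N) char_coef K k l * divdiff_exp (diag_var K k) i.+1 l.
  rewrite /newton_coef opprK (bigID (fun l : 'I_n => (i < l)%N)) /= addrAC subrr add0r.
  rewrite (bigD1 (Ordinal i_n)) ?ltnn //= big1 ?addr0 => [|l /andP[il ne]].
    by rewrite /divdiff_exp ltnS leqnn subnn complete_sym0 mulr1.
  have li : (l < i)%N.
    rewrite ltn_neqAle leqNgt il andbT; apply: contraNneq ne => E.
    exact/eqP/val_inj.
  rewrite /divdiff_exp ltnS leqNgt li.
  exact: mulr0.
apply: ideal_spanB.
  apply: ideal_spanN; apply: ideal_span_gen; apply/mapP; exists i => //.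
  by rewrite mem_iota.
apply: ideal_span_sum => l il; rewrite mulrC; apply: ideal_spanM; apply: IH => //.
by have := ltn_ord l; lia.
Qed.

(** A is conjugate to a strictly triangular matrix, so its characteristic polynomial is 'X^n. *)
Lemma mx_eval_newton (L : fieldType) (j : {rmorphism K -> L}) (A M : 'M[L]_n) F :
  M \in unitmx -> A *m M = M *m shift_mx k L -> ideal_span newton F -> mx_eval j A F = 0.
Proof.
move=> Mu AM; apply: (ideal_span_sub (I := fun F => mx_eval j A F = 0)).
- exact: rmorph0.
- by move=> F' G F0 G0; rewrite rmorphD /= F0 G0 addr0.
- by move=> c F' F0; rewrite rmorphM /= F0 mulr0.
move=> _ /mapP[J _ ->]; rewrite rmorphN rmorph_sum big1 ?oppr0// => i _.
rewrite rmorphM [X in X * _](_ : _ = 0) ?mul0r//.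
rewrite -[LHS](coef_map (mx_eval j A)) map_char_poly mx_eval_generic.
have -> : char_poly A = 'X^n.
  have dM : \det (map_mx (@polyC L) M) != 0.
    by rewrite det_map_mx polyC_eq0 -unitfE -unitmxE.
  apply: (mulIf dM); rewrite -[LHS]det_mulmx.
  have -> : char_poly_mx A *m map_mx (@polyC L) M = map_mx (@polyC L) M *m char_poly_mx (shift_mx k L).
    by rewrite mulmxBl mulmxBr -!map_mxM AM scalar_mxC.
  rewrite det_mulmx mulrC; congr (_ * _).
  rewrite -det_tr det_trig.
    rewrite (eq_bigr (fun=> 'X)) ?prodr_const ?card_ord// => r _.
    by rewrite !mxE eqxx mulr1n ltn_eqF// subr0.
  apply/is_trig_mxP => r s rs; rewrite !mxE eq_sym -(inj_eq val_inj) ltn_eqF//.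
  by rewrite mulr0n ltn_eqF ?subr0// ltnW.
by rewrite coefXn ltn_eqF.
Qed.

Lemma krylov_det0_neq0 : krylov_det K (0 : 'I_n) != 0.
Proof.
have [W] := super_symbol K k; apply: contraPneq => E.
rewrite /krylov_det in E; rewrite E => -[_].
rewrite rmorph0 coef0 /signed_monomial expr0 mul1r => /esym/eqP.
by rewrite -msize_poly_eq0 msizeX.
Qed.

Section Saturation.
Hypothesis charK : forall m, m.+1%:R != 0 :> K.
Local Notation L := {fraction O}.
Local Notation s := (krylov_det K (0 : 'I_n)).

Let jL : {rmorphism K -> L} := @FracField.tofrac O \o @mpolyC (n * n) K.
Let Kr : 'M[O]_n := krylov 0 gen.
Let up : 'M[O]_n := unit_shift_mx k O.

(** Both products have row 0 of gen^(r+1) as row r when r < k. In the last row, Cayley-Hamilton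
    expresses row 0 of gen^n by the characteristic coefficients. *)
Lemma krylov_defect r t : ideal_span newton ((Kr *m gen - up *m Kr) r t).
Proof.
have upK (i j : 'I_n) : j = i.+1 :> nat -> row i (up *m Kr) = row j Kr.
  move=> ij; apply/rowP => l; rewrite !mxE (bigD1 j) //= big1 ?addr0 => [|e ej].
    by rewrite !mxE ij eqxx mul1r.
  rewrite mxE; case: eqP => [E|_]; last by rewrite mul0r.
  by case/eqP: ej; apply/val_inj; rewrite /= E.
have Kg : row r (Kr *m gen) = row 0 (gen ^+ r.+1).
  by rewrite row_mul row_krylov -row_mul exprSr.
have -> : (Kr *m gen - up *m Kr) r t = row r (Kr *m gen) 0 t - row r (up *m Kr) 0 t.
  by rewrite !mxE.
have [rk|kr] := ltnP r k.
  rewrite Kg (upK r (Ordinal (rk : r.+1 < n)%N)) // row_krylov subrr.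
  exact: ideal_span0.
have rmax : r = ord_max by apply/val_inj/eqP; rewrite /= eqn_leq kr -ltnS ltn_ord.
have -> : row r (up *m Kr) 0 t = 0.
  rewrite !mxE big1// => i _; rewrite mxE rmax /=.
  by rewrite ltn_eqF ?mul0r.
rewrite subr0 Kg rmax /= mxE.
have := Cayley_Hamilton gen; rewrite -[char_poly gen]coefK.
have -> : size (char_poly gen) = n.+1 by rewrite size_char_poly.
rewrite poly_def big_ord_recr /= rmorphD /= rmorph_sum /=.
have -> : (char_poly gen)`_n = 1.
  by have /monicP := char_poly_monic gen; rewrite lead_coefE size_char_poly.
rewrite scale1r rmorphXn /= horner_mx_X => /(congr1 (fun B : 'M_n => B 0 t)) /eqP.
rewrite mxE [in X in _ == X]mxE addrC addr_eq0 => /eqP ->.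
apply: ideal_spanN; rewrite summxE; apply: ideal_span_sum => i _.
rewrite -mul_polyC rmorphM /= horner_mx_C -[_ * _]/(_ *m _) mul_scalar_mx mxE mulrC.
by apply: ideal_spanM; exact: char_coef_newton.
Qed.

(** The extension of the ideal to the localization of O at s; [inO] is this localization itself. *)
Let inI (u : L) := exists m F, ideal_span newton F /\ (s%:F) ^+ m * u = F%:F.
Let inO (u : L) := exists m F, (s%:F) ^+ m * u = F%:F.

Let sF_neq0 m : (s%:F : L) ^+ m != 0.
Proof. by rewrite expf_neq0// tofrac_eq0 krylov_det0_neq0. Qed.

Let inID u v : inI u -> inI v -> inI (u + v).
Proof.
move=> [m [F [IF uE]]] [m' [F' [IF' vE]]].
exists (m + m')%N, (s ^+ m' * F + s ^+ m * F'); split.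
  by apply: ideal_spanD; exact: ideal_spanM.
rewrite tofracD !tofracM !tofracXn -uE -vE exprD.
by ring.
Qed.

Let inOD u v : inO u -> inO v -> inO (u + v).
Proof.
move=> [m [F uE]] [m' [F' vE]].
exists (m + m')%N, (s ^+ m' * F + s ^+ m * F').
rewrite tofracD !tofracM !tofracXn -uE -vE exprD.
by ring.
Qed.

Let inOM u v : inO u -> inO v -> inO (u * v).
Proof.
move=> [m [F uE]] [m' [F' vE]]; exists (m + m')%N, (F * F').
by rewrite tofracM -uE -vE exprD; ring.
Qed.

Let inIM u v : inI u -> inO v -> inI (u * v).
Proof.
move=> [m [F [IF uE]]] [m' [F' vE]]; exists (m + m')%N, (F' * F); split.
  exact: ideal_spanM.
by rewrite tofracM -uE -vE exprD; ring.
Qed.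

Let inO_frac F : inO F%:F.
Proof. by exists 0%N, F; rewrite expr0 mul1r. Qed.

(* Over the fraction field, the matrix A := Kr^-1 *m up *m Kr is a regular
   nilpotent one; up to powers of s, it is congruent to the generic matrix modulo
   the ideal. *)
Lemma krylov_saturation F :
  (forall (L' : fieldType) (j : {rmorphism K -> L'}) (A M : 'M[L']_n),
     M \in unitmx -> M 0 0 != 0 -> A *m M = M *m shift_mx k L' -> mx_eval j A F = 0) ->
  exists m, ideal_span newton (s ^+ m * F).
Proof.
move=> H; have s0 : (\det Kr)%:F != 0 :> L by rewrite tofrac_eq0 krylov_det0_neq0.
pose KrL : 'M[L]_n := map_mx (@FracField.tofrac O) Kr.
pose A := invmx KrL *m map_mx (@FracField.tofrac O) up *m KrL.
have [M [MU M00 AM]] : exists M, [/\ M \in unitmx, M 0 0 != 0 & A *m M = M *m shift_mx k L].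
  rewrite /A map_unit_shift_mx; apply: unit_shift_conj.
  - by move=> m; rewrite -(rmorph_nat jL) /= tofrac_eq0 mpolyC_eq0.
  - by rewrite unitmxE unitfE det_map_mx.
  by apply/rowP => t; rewrite !mxE; exact: rmorph_nat.
have F0 := H L jL A M MU M00 AM.
have defect := adj_conj_defect gen up s0.
have key G : inI (G%:F - mx_eval jL A G) /\ inO (mx_eval jL A G).
  elim/mpoly_ring_ind: G => [c|i|a b [Ia Oa] [Ib Ob]|a b [Ia Oa] [Ib Ob]].
  - rewrite mx_evalC /= subrr; split; last exact: inO_frac.
    by exists 0%N, 0; rewrite expr0 mul1r tofrac0; split=> //; exact: ideal_span0.
  - case/mxvec_indexP: i => r t; rewrite mx_evalX.
    have gE : 'X_(mxvec_index r t) = gen r t by rewrite mxE.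
    rewrite gE; pose E : O := (\adj Kr *m (Kr *m gen - up *m Kr)) r t.
    have dE : s%:F * ((gen r t)%:F - A r t) = E%:F := defect r t.
    have IE : ideal_span newton E.
      rewrite /E mxE; apply: ideal_span_sum => i _; apply: ideal_spanM.
      exact: krylov_defect.
    split; first by exists 1%N, E; rewrite expr1.
    exists 1%N, (s * gen r t - E); rewrite expr1 tofracB tofracM -dE.
    by ring.
  - rewrite tofracD rmorphD /=; split; last exact: inOD.
    by rewrite opprD addrACA; exact: inID.
  rewrite tofracM rmorphM /=; split; last exact: inOM.
  have -> : a%:F * b%:F - mx_eval jL A a * mx_eval jL A b =
    (a%:F - mx_eval jL A a) * b%:F + (b%:F - mx_eval jL A b) * mx_eval jL A a by ring.
  by apply: inID; apply: inIM.
have [[m [G [IG GE]]] _] := key F.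
exists m; suff -> : s ^+ m * F = G by [].
apply/eqP; rewrite -tofrac_eq tofracM tofracXn -GE F0.
by rewrite [X in _ == _ * X]subr0.
Qed.

End Saturation.

End Kostant.

Lemma rmorph_relation (R S : comNzRingType) (g : {rmorphism R -> S}) (t s x y : R) a :
  g (t * (t ^+ a * x - s ^+ a * y)) = g t * (g t ^+ a * g x - g s ^+ a * g y).
Proof. by rewrite !(rmorphM, rmorphB, rmorphXn). Qed.

Lemma rmorph_division (R S : comNzRingType) (g : {rmorphism R -> S}) (u s h : R) a :
  g (u + s ^+ a * h) = g u + g s ^+ a * g h.
Proof. by rewrite !(rmorphM, rmorphD, rmorphXn). Qed.

(** * Extension of functions from the regular nilpotent orbit *)

Section KostantTheorem.
Variables (C : fieldType) (N k : nat).
Hypothesis charC : forall m, m.+1%:R != 0 :> C.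
Local Notation n := k.+1.
Variables (K : idomainType) (iota : {rmorphism C -> K}) (y : 'M[K]_(N.+1, n)).
Variables (q : nat) (P : Vk C N k).
Hypothesis Pq : diff_homog (q * n) P.
Local Notation O := {mpoly K[n * n]}.

Let iO : {rmorphism C -> O} := @mpolyC (n * n) K \o iota.

(** A determines M only up to right multiplication by matrices commuting with [shift_mx]; the
    adjugate of the Krylov matrix provides a choice that is polynomial in A. *)
Definition krylov_value (v : 'I_n) : O :=
  jet_eval iO (map_mx (@mpolyC (n * n) K) y *m
    (\adj (krylov v (generic_mx K k)) *m fact_mx k O)) P.

Lemma mx_eval_krylov_value (L : fieldType) (j : {rmorphism K -> L}) (A : 'M[L]_n) v :
  mx_eval j A (krylov_value v) =
  jet_eval (j \o iota) (map_mx j y *m (\adj (krylov v A) *m fact_mx k L)) P.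
Proof.
rewrite /krylov_value (jet_eval_comp (h := j \o iota)) => [|c]; last exact: mx_evalC.
congr (jet_eval _ _ P); rewrite !map_mxM map_fact_mx map_mx_adj map_krylov mx_eval_generic.
congr (_ *m _); apply/matrixP => r s; rewrite !mxE; exact: mx_evalC.
Qed.

Lemma det_krylov_neq0 (L : fieldType) (j : {rmorphism K -> L}) (A M : 'M[L]_n) :
  M \in unitmx -> M 0 0 != 0 -> A *m M = M *m shift_mx k L -> \det (krylov 0 A) != 0.
Proof.
move=> Mu M00 AM; have := congr1 determinant (krylov_shift 0 AM).
rewrite !det_mulmx det_leibniz det_fact_mx => E.
have : \prod_(i < n) (i`!)%:R * row 0 M 0 0 ^+ n != 0 :> L.
  rewrite mulf_neq0 ?expf_neq0 ?mxE//; apply/prodf_neq0 => i _.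
  exact: (factr_neq0 charC (j \o iota)).
by rewrite -E mulf_eq0 negb_or => /andP[].
Qed.

(* On regular nilpotent matrices A, the function sought is, up to a constant, both
   al / s ^+ a and be / t ^+ a, where s and t are the Krylov determinants of the
   first and last rows of A; as t, s and the characteristic coefficients form a
   regular sequence, al is divisible by s ^+ a. *)
Theorem kostant : exists F : O, forall (L : fieldType) (j : {rmorphism K -> L}) (A M : 'M[L]_n),
  M \in unitmx -> M 0 0 != 0 -> A *m M = M *m shift_mx k L ->
  mx_eval j A F * \det M ^+ q = jet_eval (j \o iota) (map_mx j y *m M) P.
Proof.
have [al alA] : exists al, forall (L : fieldType) (j : {rmorphism K -> L}) A, mx_eval j A al =
    jet_eval (j \o iota) (map_mx j y *m (\adj (krylov 0 A) *m fact_mx k L)) P.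
  by exists (krylov_value 0) => L j A; exact: mx_eval_krylov_value.
have [be beA] : exists be, forall (L : fieldType) (j : {rmorphism K -> L}) A, mx_eval j A be =
    jet_eval (j \o iota) (map_mx j y *m (\adj (krylov ord_max A) *m fact_mx k L)) P.
  by exists (krylov_value ord_max) => L j A; exact: mx_eval_krylov_value.
have sA (L : fieldType) (j : {rmorphism K -> L}) (A : 'M[L]_n) : mx_eval j A (@krylov_det K k 0) = \det (krylov 0 A).
  exact: mx_eval_krylov_det.
have tA (L : fieldType) (j : {rmorphism K -> L}) (A : 'M[L]_n) : mx_eval j A (@krylov_det K k ord_max) = \det (krylov ord_max A).
  exact: mx_eval_krylov_det.
have sat := @krylov_saturation K k; have reg := regular_krylov_newton K k.
move: (@krylov_det K k 0) (@krylov_det K k ord_max) sA tA sat reg => s t sA tA sat reg.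
pose a := (q * k)%N.
(* The outer factor t makes G vanish also where the last Krylov determinant is zero, a case excluded
   in [jet_eval_krylov]. *)
pose G := t * (t ^+ a * al - s ^+ a * be).
have charK m : m.+1%:R != 0 :> K := natrS_neq0 charC iota m.
have G0 (L : fieldType) (j : {rmorphism K -> L}) (A M : 'M[L]_n) :
    M \in unitmx -> M 0 0 != 0 -> A *m M = M *m shift_mx k L -> mx_eval j A G = 0.
  move=> Mu M00 AM.
  have -> : mx_eval j A G = mx_eval j A t * (mx_eval j A t ^+ a * mx_eval j A al -
    mx_eval j A s ^+ a * mx_eval j A be) := rmorph_relation (mx_eval j A) _ _ _ _ _.
  rewrite tA sA alA beA.
  have [->|t0] := eqVneq (\det (krylov ord_max A)) 0; first by rewrite mul0r.
  have s0 := det_krylov_neq0 j Mu M00 AM.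
  rewrite !(jet_eval_krylov charC _ _ Pq Mu AM)//.
  by rewrite -/a mulrCA -/a; ring.
have [m Im] := sat charK _ G0.
(* So far [s ^+ m * G] lies in the ideal; the power of s cancels, being regular modulo the Newton
   coefficients. *)
have [_ [nm _]] := reg 1%N m.
have IG := nm _ Im.
(* G shows that t^(a+1) al is a multiple of s^a modulo the Newton coefficients; cancelling t^(a+1)
   makes al such a multiple. *)
have [nt _] := reg a.+1 a.
have : ideal_span (s ^+ a :: newton_coefs K k) (t ^+ a.+1 * al).
  exists G, (t * be); split=> //; rewrite /G exprS.
  by ring.
move=> /nt[u [h [Iu alE]]].
have {}Iu : ideal_span (newton_coefs K k) u := Iu.
(* The determinant of [fact_mx], whose q-th power occurs in [jet_eval_krylov]. *)
pose c : C := \prod_(j < n) (j`!)%:R.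
exists ((iota (c ^- q))%:MP * h) => L j A M Mu M00 AM.
have s0 := det_krylov_neq0 j Mu M00 AM.
have := congr1 (mx_eval j A) alE.
rewrite alA (jet_eval_krylov charC _ _ Pq Mu AM)//.
have -> : mx_eval j A (u + s ^+ a * h) = mx_eval j A u + mx_eval j A s ^+ a * mx_eval j A h
  := rmorph_division (mx_eval j A) _ _ _ _.
rewrite (mx_eval_newton j Mu AM Iu) add0r sA.
rewrite -/a mulrAC [RHS]mulrC => /(mulIf (expf_neq0 _ s0)) hE.
rewrite rmorphM /= mx_evalC -hE det_fact_mx.
have -> : \prod_(i < n) (i`!)%:R = j (iota c) by rewrite !rmorph_prod; apply: eq_bigr => i _; rewrite !rmorph_nat.
have c0 : j (iota c) != 0.
  rewrite -[j _]/((j \o iota) c) fmorph_eq0.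
  by apply/prodf_neq0 => i _; exact: (factr_neq0 charC idfun).
have dM : \det M != 0 by rewrite -unitfE -unitmxE.
have -> : j (iota (c ^- q)) = j (iota c) ^- q.
  by rewrite -[LHS]/((j \o iota) (c ^- q)) fmorphV rmorphXn.
rewrite exprMn exprVn.
by rewrite !mulrA mulVf ?expf_neq0// mul1r mulrAC mulVf ?expf_neq0// mul1r.
Qed.

End KostantTheorem.

(** * Determinants of shifted jets *)

(** Cramer's rule: expansion of det M' along row t, whose cofactors are those of M. *)
Lemma mulmx_adj_row (R : comNzRingType) n (M M' : 'M[R]_n) (v : 'rV[R]_n) t :
  (forall i, row i M' = if i == t then v else row i M) -> (v *m \adj M) 0 t = \det M'.
Proof.
move=> M'E; have M'v s : M' t s = v 0 s.
  by have := M'E t; rewrite eqxx => /rowP/(_ s); rewrite mxE.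
have M'M i s : i != t -> M' i s = M i s.
  by have := M'E i; case: eqP => // _ /rowP/(_ s); rewrite !mxE.
rewrite (expand_det_row _ t) mxE; apply: eq_bigr => s _; rewrite M'v mxE; congr (_ * _).
rewrite /cofactor; congr (_ * \det _); apply/matrixP => i j; rewrite !mxE.
by rewrite M'M// eq_sym neq_lift.
Qed.

Section DiffHomog.
Variables (C : fieldType) (N k : nat).
Hypothesis charC : forall m, m.+1%:R != 0 :> C.
Local Notation n := k.+1.
Local Notation V := {mpoly C[N.+1 * k.+1]}.
Local Notation polyCst := (@mpolyC (N.+1 * k.+1) C : {rmorphism C -> V}).

Lemma jet_eval_scale (c : C) (P : V) e :
  (jet_eval polyCst (c%:MP *: Xmx C N k) P)@_e = c ^+ mdeg e * P@_e.
Proof.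
elim/mpolyind: P => [|b m p _ _ IH]; first by rewrite rmorph0 !mcoeff0 mulr0.
rewrite rmorphD /= !mcoeffD IH mulrDr; congr (_ + _).
suff -> : jet_eval polyCst (c%:MP *: Xmx C N k) (b *: 'X_[m]) = (b * c ^+ mdeg m) *: 'X_[m].
  rewrite !mcoeffZ mcoeffX; case: eqP => [->|_]; first by rewrite !mulr1 mulrC.
  by rewrite !mulr0.
rewrite /jet_eval mmapZ mmapX /mmap1 -scalerA -mul_mpolyC; congr (_ * _).
rewrite -mul_mpolyC.
rewrite mpolyXE_id mdegE rmorphXn /= -prodrXr -big_split /=; apply: eq_bigr => i _.
by case/mxvec_indexP: i => i j; rewrite mxvecE !mxE exprMn.
Qed.

(** Ordinary homogeneity follows from the invariance: the constant series 2 multiplies a monomial of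
    degree e by 2^e, and in characteristic 0 the powers of 2 are distinct. *)
Lemma diff_homogP d (P : V) :
  (forall v : 'rV[C]_n, v 0 0 != 0 ->
    jet_eval polyCst (Xmx C N k *m leibniz (map_mx polyCst v)) P = v 0 0 ^+ d *: P) ->
  @diff_homog C N k d P.
Proof.
move=> H; split; last first.
  move=> a a0; rewrite series_act_eval H ?mxE//.
apply/dhomogP => e; rewrite mcoeff_msupp => Pe; apply/eqP.
pose v : 'rV[C]_n := 2%:R *: jet1 k C.
have v0 : v 0 0 = 2%:R by rewrite !mxE eqxx mulr1.
have := H v; rewrite v0 => /(_ (charC 1)).
have -> : Xmx C N k *m leibniz (map_mx polyCst v) = (2%:R)%:MP *: Xmx C N k.
  have -> : leibniz (map_mx polyCst v) = ((2%:R)%:MP)%:M.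
    rewrite -map_leibniz -[X in map_mx _ X](_ : 2%:R%:M = _) ?map_scalar_mx//.
    rewrite -scalemx1 -leibniz1; apply/matrixP => r s; rewrite !mxE.
    exact: mulrnAr.
  by rewrite scalar_mxC mul_scalar_mx.
move=> /(congr1 (mcoeff e)); rewrite jet_eval_scale mcoeffZ => /(mulIf Pe).
have expr2_nat m : (2%:R : C) ^+ m = (2 ^ m)%:R by rewrite natrX.
have natC_inj a b : a%:R = b%:R :> C -> a = b.
  have H' a' b' : (a' < b')%N -> a'%:R != b'%:R :> C.
    move=> lt; have -> : b' = (a' + (b' - a'.+1).+1)%N by lia.
    by rewrite natrD -subr_eq0 opprD addrA subrr sub0r oppr_eq0 charC.
  by move=> E; have [/H'|/H'|//] := ltngtP a b; rewrite E eqxx.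
by rewrite !expr2_nat => /natC_inj /eqP; rewrite eqn_exp2l// => /eqP.
Qed.

Lemma jet_eval_id P : jet_eval polyCst (Xmx C N k) P = P.
Proof.
elim/mpoly_ring_ind: P => [c|i|a b IHa IHb|a b IHa IHb].
- exact: jet_evalC.
- by case/mxvec_indexP: i => i j; rewrite -[X in jet_eval _ _ X]/(Xvar C i j) jet_evalX mxE.
- by rewrite rmorphD /= IHa IHb.
- by rewrite rmorphM /= IHa IHb.
Qed.

(** The value (i, j) at m selects the jet of X_i T^j / j! as row m of the minor. *)
Definition minor_index := {ffun 'I_n -> 'I_N.+1 * 'I_n}.

Definition minor_mx (R : comNzRingType) (x : 'M[R]_(N.+1, n)) (u : minor_index) : 'M[R]_n :=
  \matrix_(m, s) leibniz (row (u m).1 x) (u m).2 s.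

Definition jet_minor (u : minor_index) : V := \det (minor_mx (Xmx C N k) u).

Lemma row_minor_mx (R : comNzRingType) (x : 'M[R]_(N.+1, n)) u m :
  row m (minor_mx x u) = row (u m).2 (leibniz (row (u m).1 x)).
Proof. by apply/rowP => s; rewrite !mxE. Qed.

Lemma map_minor_mx (R S : comNzRingType) (f : {rmorphism R -> S}) (x : 'M[R]_(N.+1, n)) u :
  map_mx f (minor_mx x u) = minor_mx (map_mx f x) u.
Proof. by apply/matrixP => m s; rewrite !mxE rmorphMn. Qed.

Lemma jet_eval_minor (R : comNzRingType) (f : {rmorphism C -> R}) x u :
  jet_eval f x (jet_minor u) = \det (minor_mx x u).
Proof. by rewrite /jet_minor -det_map_mx map_minor_mx jet_eval_Xmx. Qed.

Lemma minor_mx_leibniz (R : comNzRingType) (x : 'M[R]_(N.+1, n)) v u :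
  minor_mx (x *m leibniz v) u = minor_mx x u *m leibniz v.
Proof.
by apply/row_matrixP => m; rewrite row_mul !row_minor_mx row_mul leibniz_mul row_mul.
Qed.

Lemma minor_diff_homog u : @diff_homog C N k n (jet_minor u).
Proof.
apply: diff_homogP => v _.
rewrite jet_eval_minor minor_mx_leibniz det_mulmx det_leibniz mxE mulrC.
by rewrite -mul_mpolyC rmorphXn.
Qed.

Section MinorQuotients.
Variables (r : nat) (g : 'I_r -> V).
Hypothesis g_minor : forall u, exists o, g o = jet_minor u.

Definition gen_eval (h : {mpoly C[r]}) : V := mmap polyCst g h.

HB.instance Definition _ := GRing.RMorphism.copy (gen_eval : {mpoly C[r]} -> V) (mmap polyCst g).

Lemma gen_evalX o : gen_eval 'X_o = g o.
Proof. by rewrite /gen_eval mmapX mmap1U. Qed.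

Lemma gen_evalC c : gen_eval c%:MP = c%:MP.
Proof. by rewrite /gen_eval mmapC. Qed.

Local Notation L := {fraction V}.

Section OneMinor.
Variable u : minor_index.
Hypothesis u0 : (u 0).2 = 0.
Hypothesis gu0 : jet_minor u != 0.
Local Notation gu := (jet_minor u).

Let xL : 'M[L]_(N.+1, n) := map_mx (@FracField.tofrac V) (Xmx C N k).
Let M : 'M[L]_n := minor_mx xL u.

Let detM : \det M = gu%:F.
Proof. by rewrite /M -map_minor_mx det_map_mx. Qed.

Let guF0 : gu%:F != 0 :> L. Proof. by rewrite tofrac_eq0. Qed.

Let Mu : M \in unitmx.
Proof. by rewrite unitmxE unitfE detM. Qed.

(** Fractions of degree 0 in the generators with a power of one minor as denominator; they form a
    ring, in which the entries of y and A are shown to lie. *)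
Let quot (z : L) := exists l h, h \is l.-homog /\ z * gu%:F ^+ l = (gen_eval h)%:F.

Let quotE z l h : z * gu%:F ^+ l = (gen_eval h)%:F ->
  forall o, g o = gu -> forall e, z * gu%:F ^+ (l + e) = (gen_eval (h * 'X_o ^+ e))%:F.
Proof.
move=> zE o go e; rewrite exprD mulrA zE rmorphM rmorphXn /= gen_evalX go.
by rewrite tofracM tofracXn.
Qed.

Let dhomogXn o e : ('X_o : {mpoly C[r]}) ^+ e \is e.-homog.
Proof. by rewrite -[X in X.-homog]mul1n; apply: dhomogMn; rewrite dhomogX; apply/eqP; exact: mdeg1. Qed.

Let quotD z z' : quot z -> quot z' -> quot (z + z').
Proof.
move=> [l [h [hh zE]]] [l' [h' [hh' zE']]]; have [o go] := g_minor u.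
exists (l + l')%N, (h * 'X_o ^+ l' + h' * 'X_o ^+ l); split.
  apply: dhomogD; first exact: dhomogM.
  by rewrite addnC; exact: dhomogM.
rewrite mulrDl (quotE zE go) addnC (quotE zE' go) rmorphD /=.
by rewrite tofracD.
Qed.

Let quotM z z' : quot z -> quot z' -> quot (z * z').
Proof.
move=> [l [h [hh zE]]] [l' [h' [hh' zE']]].
exists (l + l')%N, (h * h'); split; first exact: dhomogM.
by rewrite exprD mulrACA zE zE' rmorphM /= tofracM.
Qed.

Let quotC (c : C) : quot (c%:MP : V)%:F.
Proof.
exists 0%N, c%:MP; split; last by rewrite gen_evalC expr0 mulr1.
by rewrite -[c%:MP]mulr1 mul_mpolyC; apply: dhomogZ; exact: dhomog1.
Qed.

Let quot_minor w : quot ((jet_minor w)%:F / gu%:F).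
Proof.
have [o go] := g_minor w; exists 1%N, 'X_o; split; first exact: (dhomogXn o 1).
rewrite gen_evalX go expr1.
exact: divfK guF0 _.
Qed.

(** By Cramer's rule, replacing row t of the minor gives another minor. *)
Let quot_row i j t : quot ((row j (leibniz (row i xL)) *m invmx M) 0 t).
Proof.
pose w : minor_index := [ffun m => if m == t then (i, j) else u m].
suff -> : (row j (leibniz (row i xL)) *m invmx M) 0 t = (jet_minor w)%:F / gu%:F.
  exact: quot_minor.
rewrite /invmx Mu -scalemxAr mxE detM mulrC; congr (_ / _).
rewrite (@mulmx_adj_row _ _ _ (minor_mx xL w)) => [|m].
  by rewrite /jet_minor -det_map_mx map_minor_mx.
by rewrite !row_minor_mx ffunE; case: eqP.
Qed.

Let y : 'M[L]_(N.+1, n) := xL *m invmx M.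
Let A : 'M[L]_n := M *m shift_mx k L *m invmx M.

Let quot_y i t : quot (y i t).
Proof.
have -> : y i t = (row 0 (leibniz (row i xL)) *m invmx M) 0 t.
  have -> : row 0 (leibniz (row i xL)) = row i xL.
    by apply/rowP => s; rewrite !mxE bin0 subn0 inord_val.
  by rewrite -row_mul [RHS]mxE.
exact: quot_row.
Qed.

(** As Z commutes with [leibniz], multiplication by Z shifts each row of M once more, up to an
    integer, or kills it. *)
Let quot_A m t : quot (A m t).
Proof.
have -> : A m t = (row (u m).2 (shift_mx k L *m leibniz (row (u m).1 xL)) *m invmx M) 0 t.
  by rewrite -leibniz_shift row_mul -row_minor_mx -!row_mul [RHS]mxE.
have [lt|ge] := ltnP (u m).2 k.
  rewrite (@shift_mulmx _ _ _ _ _ (Ordinal (lt : _.+1 < n)%N)) // -scalemxAl mxE.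
  apply: quotM; last exact: quot_row.
  by have := quotC (Ordinal (lt : _.+1 < n)%N)%:R; rewrite rmorph_nat rmorph_nat.
have -> : (u m).2 = ord_max by apply/val_inj/eqP; rewrite /= eqn_leq ge -ltnS ltn_ord.
rewrite shift_mulmx_max mul0mx mxE.
by have := quotC 0; rewrite !rmorph0.
Qed.

Let M00 : M 0 0 != 0.
Proof.
rewrite mxE u0 !mxE subn0 bin0 mulr1n tofrac_eq0.
exact: mpolyX_neq0.
Qed.

Lemma minor_quotient q (P : V) : @diff_homog C N k (q * n) P ->
  exists m h, h \is (m + q).-homog /\ gu ^+ m * P = gen_eval h.
Proof.
move=> Pq.
(* The matrix y is taken generic here, so that F is polynomial in the entries of y as well; it is
   specialized by [j] below. *)
have [F FE] := kostant charC polyCst (Xmx C N k) Pq.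
pose jc : {rmorphism C -> L} := @FracField.tofrac V \o polyCst.
pose j : {rmorphism V -> L} := jet_eval jc y.
have AM : A *m M = M *m shift_mx k L := mulmxKV Mu _.
have yM : y *m M = xL := mulmxKV Mu _.
have := FE L j A M Mu M00 AM.
have -> : map_mx j (Xmx C N k) = y by exact: jet_eval_Xmx.
rewrite yM detM => {}FE.
have PE : jet_eval (j \o polyCst) xL P = P%:F.
  rewrite -[in RHS](jet_eval_id P); apply/esym.
  by apply: (jet_eval_comp (g := @FracField.tofrac V)) => c; rewrite /= jet_evalC.
have [l [h [hh FAE]]] : quot (mx_eval j A F).
  elim/mpoly_ring_ind: F {FE} => [c|i|a b qa qb|a b qa qb].
  - rewrite mx_evalC; elim/mpoly_ring_ind: c => [c|i|a b qa qb|a b qa qb].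
    + by rewrite /= jet_evalC; exact: quotC.
    + case/mxvec_indexP: i => i t; rewrite -[X in quot X]/(jet_eval jc y (Xvar C i t)) jet_evalX.
      exact: quot_y.
    + by rewrite rmorphD; exact: quotD.
    by rewrite rmorphM; exact: quotM.
  - by case/mxvec_indexP: i => m t; rewrite mx_evalX; exact: quot_A.
  - by rewrite rmorphD; exact: quotD.
  by rewrite rmorphM; exact: quotM.
have [o go] := g_minor u.
exists l, (h * 'X_o ^+ q); split; first exact: dhomogM.
apply/eqP; rewrite -tofrac_eq tofracM tofracXn -PE -FE mulrCA mulrA FAE.
by rewrite rmorphM rmorphXn /= gen_evalX go tofracM tofracXn.
Qed.

End OneMinor.

(** A minor without unshifted row has zero first column. Otherwise a transposition brings such a row
    to index 0, as [minor_quotient] requires, at the cost of a sign. *)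
Lemma minor_generated u q (P : V) : @diff_homog C N k (q * n) P ->
  exists m h, h \is (m + q).-homog /\ jet_minor u ^+ m * P = gen_eval h.
Proof.
move=> Pq; have [g0|g0] := eqVneq (jet_minor u) 0.
  exists 1%N, 0; split; first exact: dhomog0.
  by rewrite g0 expr1 mul0r rmorph0.
have [m um] : exists m, (u m).2 = 0.
  apply: boolp.contrapT => /boolp.forallNP u0; case/negP: g0; apply/eqP.
  rewrite /jet_minor (expand_det_col _ 0) big1// => m _.
  rewrite mxE mxE sub0n bin0n; have /eqP/negPf := u0 m.
  by rewrite -(inj_eq val_inj) /= => ->; rewrite mulr0n mul0r.
pose w : minor_index := [ffun l => u (tperm 0 m l)].
have w0 : (w 0).2 = 0 by rewrite ffunE tpermL.
have E : jet_minor w = (-1) ^+ (tperm 0 m : bool) * jet_minor u.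
  rewrite /jet_minor.
  have -> : minor_mx (Xmx C N k) w = perm_mx (tperm 0 m) *m minor_mx (Xmx C N k) u.
    by rewrite -row_permE; apply/matrixP => i j; rewrite !mxE ffunE.
  by rewrite det_mulmx det_perm.
have gw0 : jet_minor w != 0 by rewrite E mulf_neq0// signr_eq0.
have [l [h [hh hE]]] := minor_quotient w0 gw0 Pq.
case: (tperm 0 m : bool) E hE => /= ->; last by rewrite expr0 mul1r; exists l, h.
rewrite expr1 mulN1r exprNn -signr_odd -mulrA => hE; exists l, ((-1) ^+ odd l * h); split.
  by case: (odd l); rewrite ?expr0 ?mul1r// expr1 mulN1r dhomogN.
by rewrite rmorphM rmorph_sign /= -hE mulrA -expr2 sqrr_sign mul1r.
Qed.

End MinorQuotients.

End DiffHomog.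

Local Open Scope classical_set_scope.

(** * Homogeneous primes *)

Section Graded.
Variables (C : fieldType) (A : idomainType) (iota : {rmorphism C -> A}).
Variable S : grading iota.

Lemma pieceD d a b : S d a -> S d b -> S d (a + b).
Proof.
move=> Sa Sb; rewrite -[b]opprK -[- b]sub0r.
by apply: pieceB => //; apply: pieceB => //; exact: piece0.
Qed.

Lemma piece_sum d (I : Type) (r : seq I) (P : pred I) (f : I -> A) :
  (forall i, P i -> S d (f i)) -> S d (\sum_(i <- r | P i) f i).
Proof. by move=> H; apply: (big_ind (S d)) => //; [exact: piece0|exact: pieceD]. Qed.

Lemma piece1 : S 0 1.
Proof. by rewrite -(rmorph1 iota); exact: piece_cst. Qed.

Lemma pieceX d a n : S d a -> S (d * n)%N (a ^+ n).
Proof.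
move=> Sa; elim: n => [|n IH]; first by rewrite muln0 expr0; exact: piece1.
by rewrite mulnS exprS; exact: pieceM.
Qed.

(* An element of the graded algebra is the value at 1 of the polynomial whose
   coefficients are its homogeneous components. *)
Definition homog_poly (p : {poly A}) := forall d, S d p`_d.

Lemma homog_polyB p q : homog_poly p -> homog_poly q -> homog_poly (p - q).
Proof. by move=> hp hq d; rewrite coefB; exact: pieceB. Qed.

Lemma homog_polyM p q : homog_poly p -> homog_poly q -> homog_poly (p * q).
Proof.
move=> hp hq d; rewrite coefM; apply: piece_sum => i _.
have id : (i <= d)%N by rewrite -ltnS.
by rewrite -[X in S X](subnKC id); exact: pieceM.
Qed.

Lemma homog_poly_inj p q : homog_poly p -> homog_poly q -> p.[1] = q.[1] -> p = q.
Proof.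
move=> hp hq /eqP; rewrite -subr_eq0 -hornerN -hornerD => /eqP E.
apply/eqP; rewrite -subr_eq0; apply/eqP; have := homog_polyB hp hq.
move: (p - q) E => {p q hp hq} p; rewrite horner_coef => E hp.
apply/polyP => d; rewrite coef0; have [le|lt] := leqP (size p) d; first exact: nth_default.
apply: (piece_direct (g := S) hp _ lt); rewrite -[RHS]E; apply: eq_bigr => i _.
by rewrite expr1n mulr1.
Qed.

Lemma totalP a : total S a <-> exists2 p, homog_poly p & a = p.[1].
Proof.
split=> [[n [f [hf ->]]]|[p hp ->]].
  exists (\poly_(i < n) f i); first by move=> d; rewrite coef_poly; case: ifP => // _; exact: piece0.
  by rewrite horner_poly; apply: eq_bigr => i _; rewrite expr1n mulr1.
exists (size p), (fun d => p`_d); split=> //; rewrite horner_coef.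
by apply: eq_bigr => i _; rewrite expr1n mulr1.
Qed.

Lemma homog_poly_piece d a : S d a -> homog_poly (a *: 'X^d).
Proof.
by move=> Sa e; rewrite coefZ coefXn; case: eqP => [->|_]; rewrite ?mulr1 ?mulr0//; exact: piece0.
Qed.

Lemma homog_poly_pieceE d (a : A) : (a *: 'X^d).[1] = a.
Proof. by rewrite hornerZ hornerXn expr1n mulr1. Qed.

Lemma piece_uniq d e a : S d a -> S e a -> a != 0 -> d = e.
Proof.
move=> Sd Se a0; apply/eqP; apply: contraNT a0 => de.
have := homog_poly_inj (homog_poly_piece Sd) (homog_poly_piece Se).
rewrite !homog_poly_pieceE => /(_ erefl) /(congr1 (fun f : {poly A} => f`_d)).
by rewrite !coefZ !coefXn eqxx (negPf de) mulr1 mulr0 => ->.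
Qed.

Lemma proj_specE (p : proj_spec S) q : homog_poly q -> p q.[1] <-> forall d, p q`_d.
Proof.
move=> hq; split=> [|H].
  have -> : q.[1] = \sum_(d < size q) q`_d.
    by rewrite horner_coef; apply: eq_bigr => i _; rewrite expr1n mulr1.
  move=> pq d; have [le|lt] := leqP (size q) d; first by rewrite nth_default//; exact: hset0.
  exact: hset_homog hq pq d lt.
rewrite horner_coef; apply: (big_ind p); first exact: hset0.
  move=> a b pa pb; rewrite -[b]opprK -[- b]sub0r; apply: hsetB => //.
  by apply: hsetB => //; exact: hset0.
by move=> i _; rewrite expr1n mulr1.
Qed.

Lemma proj_spec_ext (p q : proj_spec S) :
  (forall d a, S d a -> p a <-> q a) -> p = q.
Proof.
move=> H; have pq : hset p = hset q.
  apply/funext => a; apply/propext; split.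
    move=> pa; have /totalP[f hf E] := hset_total pa; move: pa; rewrite E !proj_specE//.
    by move=> pf d; apply/(H _ _ (hf d)).
  move=> pa; have /totalP[f hf E] := hset_total pa; move: pa; rewrite E !proj_specE//.
  by move=> pf d; apply/(H _ _ (hf d)).
case: p q pq {H} => [p p1 p2 p3 p4 p5 p6 p7] [q q1 q2 q3 q4 q5 q6 q7] /= pq.
by case: _ / pq q1 q2 q3 q4 q5 q6 q7 => *; congr ProjSpec; exact: Prop_irrelevance.
Qed.

Section MkProj.
Variable Q : A -> Prop.
Hypothesis Q0 : Q 0.
Hypothesis QB : forall d a b, S d a -> S d b -> Q a -> Q b -> Q (a - b).
Hypothesis QM : forall d e a b, S d a -> S e b -> Q b -> Q (a * b).
Hypothesis QP : forall d e a b, S d a -> S e b -> Q (a * b) -> Q a \/ Q b.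
Hypothesis Qirr : exists d a, [/\ (0 < d)%N, S d a & ~ Q a].

Let H (a : A) : Prop := exists p, [/\ homog_poly p, forall d, Q p`_d & a = p.[1]].

Let QD d a b : S d a -> S d b -> Q a -> Q b -> Q (a + b).
Proof.
move=> Sa Sb Qa Qb; rewrite -[b]opprK -[- b]sub0r.
apply: (QB (d := d)) => //; first by apply: pieceB => //; exact: piece0.
by apply: (QB (d := d)) => //; exact: piece0.
Qed.

Let Qsum d (I : Type) (r : seq I) (P : pred I) (f : I -> A) :
  (forall i, P i -> S d (f i) /\ Q (f i)) -> Q (\sum_(i <- r | P i) f i).
Proof.
move=> Hf; suff [] : S d (\sum_(i <- r | P i) f i) /\ Q (\sum_(i <- r | P i) f i) by [].
apply: (big_ind (fun a => S d a /\ Q a)) => //; first by split=> //; exact: piece0.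
by move=> a b [Sa Qa] [Sb Qb]; split; [exact: pieceD|exact: QD Sa Sb Qa Qb].
Qed.

Let Hp p : homog_poly p -> H p.[1] -> forall d, Q p`_d.
Proof. by move=> hp [q [hq Qq E]] d; rewrite (homog_poly_inj hp hq E). Qed.

(** A homogeneous prime is determined by its homogeneous elements: an element belongs to it when all
    its components satisfy Q. *)
Lemma mk_proj : exists p : proj_spec S, forall d a, S d a -> p a <-> Q a.
Proof.
have Htot : H `<=` total S by move=> a [p [hp _ ->]]; apply/totalP; exists p.
have H0 : H 0.
  by exists 0; split=> [d|d|]; rewrite ?coef0 ?horner0//; exact: piece0.
have HB a b : H a -> H b -> H (a - b).
  move=> [p [hp Qp ->]] [q [hq Qq ->]]; exists (p - q); split.
  - exact: homog_polyB.
  - by move=> d; rewrite coefB; exact: QB (hp d) (hq d) (Qp d) (Qq d).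
  - by rewrite hornerD hornerN.
have HM a b : total S a -> H b -> H (a * b).
  move=> /totalP[p hp ->] [q [hq Qq ->]]; exists (p * q); split.
  - exact: homog_polyM.
  - move=> d; rewrite coefM; apply: (Qsum (d := d)) => i _.
    have id : (i <= d)%N by rewrite -ltnS.
    split; first by rewrite -[X in S X](subnKC id); exact: pieceM.
    exact: QM (hp i) (hq _) (Qq _).
  - by rewrite hornerM.
have HP a b : total S a -> total S b -> H (a * b) -> H a \/ H b.
  move=> /totalP[p hp ->] /totalP[q hq ->]; rewrite -hornerM => /(Hp (homog_polyM hp hq)) Qpq.
  apply: contrapT => /not_orP[np nq].
  (* For primality, the lowest components outside Q of the two factors are multiplied: all other
     terms of that degree in the product satisfy Q. *)
  have least f : homog_poly f -> ~ H f.[1] -> exists d, ~ Q f`_d /\ forall e, (e < d)%N -> Q f`_e.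
    move=> hf nf; have /existsNP[d0 nd0] : ~ forall d, Q f`_d by move=> Qf; apply: nf; exists f.
    have ex : exists d, `[< ~ Q f`_d >] by exists d0; apply/asboolP.
    exists (ex_minn ex); case: ex_minnP => d /asboolP nd dmin; split=> // e ed.
    by apply: contrapT => ne; have := dmin e (asboolT ne); rewrite leqNgt ed.
  have [d [nd dmin]] := least p hp np; have [e [ne emin]] := least q hq nq.
  have := Qpq (d + e)%N; rewrite coefM.
  have de : (d < (d + e).+1)%N by rewrite ltnS leq_addr.
  rewrite (bigD1 (Ordinal de)) //= addKn; set rest := \sum_(i < _ | _) _.
  have [Sr Qr] : S (d + e)%N rest /\ Q rest.
    have Hi (i : 'I_(d + e).+1) : i != Ordinal de -> S (d + e)%N (p`_i * q`_(d + e - i)) /\ Q (p`_i * q`_(d + e - i)).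
      move=> id; have le : (i <= d + e)%N by rewrite -ltnS.
      split; first by rewrite -[X in S X](subnKC le); exact: pieceM.
      have [lt|lt|E] := ltngtP i d.
      - rewrite mulrC; apply: (QM (hq _) (hp _)); exact: dmin.
      - by apply: (QM (hp _) (hq _)); apply: emin; lia.
      by case/eqP: id; apply/val_inj.
    split; first by apply: piece_sum => i /Hi[].
    exact: Qsum Hi.
  move=> Qs; have := QB (pieceD (pieceM (hp d) (hq e)) Sr) Sr Qs Qr.
  by rewrite addrK => /(QP (hp d) (hq e))[].
have Hh n (f : nat -> A) : (forall d, S d (f d)) -> H (\sum_(d < n) f d) ->
    forall d, (d < n)%N -> H (f d).
  move=> Sf; have -> : \sum_(d < n) f d = (\poly_(i < n) f i).[1].
    by rewrite horner_poly; apply: eq_bigr => i _; rewrite expr1n mulr1.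
  have hf : homog_poly (\poly_(i < n) f i).
    by move=> d; rewrite coef_poly; case: ifP => // _; exact: piece0.
  move=> /(Hp hf) Qf d dn; exists (f d *: 'X^d); split.
  - exact: homog_poly_piece.
  - move=> e; rewrite coefZ coefXn; case: eqP => [_|_]; last by rewrite mulr0.
    by have := Qf d; rewrite coef_poly dn mulr1.
  - by rewrite homog_poly_pieceE.
have HE d a : S d a -> H a <-> Q a.
  move=> Sa; split=> [|Qa].
    rewrite -{1}(homog_poly_pieceE d a) => /(Hp (homog_poly_piece Sa))/(_ d).
    by rewrite coefZ coefXn eqxx mulr1.
  exists (a *: 'X^d); split; [exact: homog_poly_piece| |by rewrite homog_poly_pieceE].
  by move=> e; rewrite coefZ coefXn; case: eqP => [_|_]; rewrite ?mulr1 ?mulr0.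
have Hi : exists d a, [/\ (0 < d)%N, S d a & ~ H a].
  by have [d [a [d0 Sa na]]] := Qirr; exists d, a; split=> // /(HE _ _ Sa).
by exists (ProjSpec Htot H0 HB HM HP Hh Hi).
Qed.

End MkProj.

Lemma hsetX (p : proj_spec S) d a n : S d a -> p (a ^+ n) -> p a.
Proof.
move=> Sa; elim: n => [|n IH]; first by rewrite expr0 => /hset1.
rewrite exprS => /hsetP[]//; [exact: total_piece Sa|exact: total_piece (pieceX n Sa)].
Qed.

Lemma hsetM_piece (p : proj_spec S) d e a b : S d a -> S e b -> p (a * b) -> p a \/ p b.
Proof. by move=> Sa Sb; apply: hsetP; [exact: total_piece Sa|exact: total_piece Sb]. Qed.

Lemma hsetMl_piece (p : proj_spec S) d a b : S d a -> p b -> p (a * b).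
Proof. by move=> Sa; apply: hsetMl; exact: total_piece Sa. Qed.

Lemma hsetD (p : proj_spec S) a b : p a -> p b -> p (a + b).
Proof.
move=> pa pb; rewrite -[b]opprK -[- b]sub0r; apply: hsetB => //.
by apply: hsetB => //; exact: hset0.
Qed.

Lemma generic_point (d : nat) (a : A) : (0 < d)%N -> S d a -> a != 0 ->
  exists p : proj_spec S, forall e b, S e b -> p b <-> b = 0.
Proof.
move=> d0 Sa a0; apply: (@mk_proj (fun b => b = 0)).
- by [].
- by move=> e b c _ _ -> ->; rewrite subr0.
- by move=> e f b c _ _ ->; rewrite mulr0.
- by move=> e f b c _ _ /eqP; rewrite mulf_eq0 => /orP[]/eqP; [left|right].
by exists d, a; split=> // /eqP; rewrite (negPf a0).
Qed.

Lemma proj_irreducible (d : nat) (a : A) : (0 < d)%N -> S d a -> a != 0 ->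
  irreducible_space (Proj S).
Proof.
move=> d0 Sa a0; have [p pE] := generic_point d0 Sa a0.
have pU (U : set (Proj S)) : open U -> U !=set0 -> U p.
  move=> [E [SE ->]] [x /= [f Ef xf]]; exists f => //.
  by have [e Sf] := SE _ Ef; move=> /(pE _ _ Sf) f0; apply: xf; rewrite f0; exact: hset0.
by split; [exists p|move=> U V oU oV U0 V0; exists p; split; exact: pU].
Qed.

End Graded.

Lemma mnm_le_mdeg m (e : 'X_{1..m}) L : (L <= mdeg e)%N ->
  exists2 u, (u <= e)%MM & mdeg u = L.
Proof.
have [j] := ubnP (mdeg e - L); elim: j e => // j IH e ej Le.
have [E|ne] := eqVneq (mdeg e) L; first by exists e; rewrite ?lepm_refl.
have [i ei] : exists i, e i != 0%N.
  apply/existsP; apply: contraNT ne => /existsPn H.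
  suff E : mdeg e = 0%N by move: Le; rewrite E leqn0 eq_sym.
  by rewrite mdegE big1// => i _; apply/eqP; have := H i; rewrite negbK.
have ie : (U_(i) <= e)%MM by rewrite lep1mP.
have dE : mdeg e = (mdeg (e - U_(i))%MM).+1 by rewrite -{1}(submK ie) mdegD mdeg1 addn1.
have [|| u ue uL] := IH (e - U_(i))%MM; first by move: ej ne Le; rewrite dE; lia.
  by move: ne Le; rewrite dE; lia.
by exists u => //; apply: lepm_trans ue _; exact: lem_subr.
Qed.

Lemma pigeonhole_sum s m (f : 'I_s.+1 -> nat) :
  (\sum_i f i = s.+1 * m)%N -> exists i, (m <= f i)%N.
Proof.
move=> E; apply/existsP; apply: contraT => /existsPn H.
have : (\sum_i (f i).+1 <= s.+1 * m)%N.
  rewrite -[X in (_ <= X * _)%N](card_ord s.+1) -sum_nat_const.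
  by apply: leq_sum => i _; rewrite ltnNge.
rewrite (eq_bigr (fun i => f i + 1)%N) => [|i _]; last by rewrite addn1.
by rewrite big_split /= E sum_nat_const card_ord muln1; lia.
Qed.

Section TotalRing.
Variables (C : fieldType) (A : idomainType) (iota : {rmorphism C -> A}).
Variable S : grading iota.

Lemma totalD a b : total S a -> total S b -> total S (a + b).
Proof.
move=> /totalP[p hp ->] /totalP[q hq ->]; apply/totalP; exists (p + q); last by rewrite hornerD.
by move=> d; rewrite coefD; exact: pieceD.
Qed.

Lemma totalB a b : total S a -> total S b -> total S (a - b).
Proof.
move=> /totalP[p hp ->] /totalP[q hq ->]; apply/totalP; exists (p - q).
  exact: homog_polyB.
by rewrite hornerD hornerN.
Qed.

Lemma totalM a b : total S a -> total S b -> total S (a * b).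
Proof.
move=> /totalP[p hp ->] /totalP[q hq ->]; apply/totalP; exists (p * q); last by rewrite hornerM.
exact: homog_polyM.
Qed.

Lemma total1 : total S 1. Proof. exact: total_piece (piece1 S). Qed.

Lemma total0 : total S 0. Proof. exact: total_piece (piece0 S 0). Qed.

Lemma det_congr (p : proj_spec S) m c (M : 'M[A]_m) : total S c ->
  (forall i j, total S (M i j) /\ p (M i j - (c%:M : 'M_m) i j)) -> p (\det M - c ^+ m).
Proof.
move=> Sc MP; rewrite -det_scalar.
(* The prime is an ideal of the graded algebra and not of A, so the congruence has to record that
   both members lie in that algebra. *)
pose rel (x y : A) := [/\ total S x, total S y & p (x - y)].
have relD a b a' b' : rel a b -> rel a' b' -> rel (a + a') (b + b').
  move=> [Sa Sb ab] [Sa' Sb' ab']; split; [exact: totalD|exact: totalD|].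
  by rewrite opprD addrACA; exact: hsetD.
have relM a b a' b' : rel a b -> rel a' b' -> rel (a * a') (b * b').
  move=> [Sa Sb ab] [Sa' Sb' ab']; split; [exact: totalM|exact: totalM|].
  have -> : a * a' - b * b' = a * (a' - b') + b' * (a - b) by ring.
  by apply: hsetD; exact: hsetMl.
have rel0 : rel 0 0 by split; rewrite ?subrr; [exact: total0|exact: total0|exact: hset0].
have rel1 : rel 1 1 by split; rewrite ?subrr; [exact: total1|exact: total1|exact: hset0].
have relN1 : rel (-1) (-1).
  have S1 : total S (-1) by rewrite -sub0r; apply: totalB; [exact: total0|exact: total1].
  by split=> //; rewrite subrr; exact: hset0.
suff [] : rel (\det M) (\det (c%:M : 'M_m)) by [].
rewrite /determinant.
apply: (big_ind2 rel rel0 relD) => s _; apply: (relM).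
  by case: (s : bool); rewrite ?expr1 ?expr0.
apply: (big_ind2 rel rel1 relM) => i _; have [SM pM] := MP i (s i); split=> //.
by rewrite mxE; case: (i == s i); rewrite ?mulr1n ?mulr0n//; exact: total0.
Qed.

End TotalRing.

(** * Absence of common zeros of the generators *)

Section ClosedImmersion.
Variables (C : fieldType) (A : idomainType) (iota : {rmorphism C -> A}).
Variables (S : grading iota) (n r : nat) (g : 'I_r.+1 -> A).
Hypothesis n0 : (0 < n)%N.
Hypothesis Sg : forall o, S n (g o).
Hypothesis g_gen : forall o q a, S (q * n)%N a ->
  exists m h, h \is (m + q).-homog /\ g o ^+ m * a = mmap iota g h.
Hypothesis g_neq0 : exists o, g o != 0.

Local Notation B := {mpoly C[r.+1]}.

Definition gen_val (h : B) : A := mmap iota g h.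

HB.instance Definition _ := GRing.RMorphism.copy (gen_val : B -> A) (mmap iota g).

Lemma gen_valX o : gen_val 'X_o = g o.
Proof. by rewrite /gen_val mmapX mmap1U. Qed.

Lemma gen_valC c : gen_val c%:MP = iota c.
Proof. by rewrite /gen_val mmapC. Qed.

Lemma gen_val_monomial c e : gen_val (c *: 'X_[e]) = iota c * gen_val 'X_[e].
Proof. by rewrite /gen_val mmapZ. Qed.

Lemma piece_monomial e : S (mdeg e * n)%N (gen_val 'X_[e]).
Proof.
rewrite /gen_val mmapX /mmap1 mdegE.
apply: (big_rec2 (fun d a => S (d * n)%N a)) => [|i d a _ Sa].
  by rewrite mul0n; exact: piece1.
by rewrite mulnDl; apply: pieceM => //; rewrite mulnC; exact: pieceX.
Qed.

Lemma piece_gen_val d h : h \is d.-homog -> S (d * n)%N (gen_val h).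
Proof.
move=> /dhomogP hd; rewrite [h]mpolyE rmorph_sum /= big_seq; apply: piece_sum => e /hd de.
rewrite gen_val_monomial -[X in S X]add0n; apply: pieceM; first exact: piece_cst.
by rewrite -de; exact: piece_monomial.
Qed.

Lemma gen_uniform q a : S (q * n)%N a -> exists m, forall o,
  exists h, h \is (m + q).-homog /\ g o ^+ m * a = gen_val h.
Proof.
move=> Sa; have /choice[m Hm] := fun o => g_gen o Sa.
exists (\max_o m o) => o; have [h [hh hE]] := Hm o.
have mo : (m o <= \max_o m o)%N by exact: leq_bigmax.
exists ('X_o ^+ (\max_o m o - m o) * h); split.
  rewrite -[X in (X + q)%N](subnK mo) -addnA; apply: dhomogM => //.
  rewrite -[X in X.-homog]mul1n; apply: dhomogMn; rewrite dhomogX; apply/eqP; exact: mdeg1.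
rewrite rmorphM rmorphXn /= gen_valX -[X in g o ^+ X](subnK mo) exprD -mulrA hE.
by [].
Qed.

Section Avoid.
Variable p : proj_spec S.
Hypothesis pg : forall o, p (g o).

Lemma positive_monomial e : (0 < mdeg e)%N -> p (gen_val 'X_[e]).
Proof.
move=> e0; have [i ei] : exists i, e i != 0%N.
  apply/existsP; apply: contraLR e0 => /existsPn H; rewrite -leqNgt leqn0 mdegE.
  by rewrite big1// => i _; apply/eqP; have := H i; rewrite negbK.
have ie : (U_(i) <= e)%MM by rewrite lep1mP.
rewrite -(submK ie) mpolyXD rmorphM /= gen_valX.
exact: hsetMl_piece (piece_monomial _) (pg i).
Qed.

(* The determinant trick: multiplication by a maps the monomials of degree L in
   the g o to combinations of them with coefficients in p. *)
Lemma absorbed_power q a : (0 < q)%N -> S (q * n)%N a -> p a.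
Proof.
move=> q0 Sa; have [m Hm] := gen_uniform Sa.
(* A monomial of degree (r + 1) m in r + 1 variables has an exponent at least m, so the m-th power
   of some generator is available to absorb a. T also has monomials of lower degree, at which v is
   set to 0. *)
pose L := (r.+1 * m)%N; pose T : predArgType := 'X_{1..r.+1 < L.+1}.
pose v (u : T) := if mdeg u == L then gen_val 'X_[u] else 0.
pose rep x := exists2 c : T -> A, (forall u, p (c u)) & x = \sum_u c u * v u.
have rep0 : rep 0.
  by exists (fun=> 0) => [u|]; [exact: hset0|rewrite big1// => u _; rewrite mul0r].
have repD x y : rep x -> rep y -> rep (x + y).
  move=> [c pc ->] [d pd ->]; exists (fun u => c u + d u) => [u|]; first exact: hsetD.
  by rewrite -big_split; apply: eq_bigr => u _; rewrite mulrDl.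
have rep_homog h : h \is (L + q).-homog -> rep (gen_val h).
  move=> /dhomogP hd; rewrite [h]mpolyE rmorph_sum /= big_seq; apply: (big_ind rep rep0 repD) => e /hd /= de.
  have [|u ue uL] := @mnm_le_mdeg _ e L; first by rewrite de leq_addr.
  have uT : (mdeg u < L.+1)%N by rewrite uL.
  exists (fun w : T => if w == BMultinom uT then iota h@_e * gen_val 'X_[e - u] else 0).
    move=> w; case: ifP => _; last exact: hset0.
    apply: (hsetMl_piece (piece_cst S _)); apply: positive_monomial.
    by have := mdegD (e - u) u; rewrite submK// de uL; lia.
  rewrite (bigD1 (BMultinom uT)) //= eqxx big1 ?addr0 => [|w /negPf->]; last by rewrite mul0r.
  by rewrite /v /= uL eqxx gen_val_monomial -mulrA -rmorphM -mpolyXD submK.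
have rep_row u : rep (a * v u).
  rewrite /v; case: eqP => [uL|_]; last by rewrite mulr0.
  have [o mo] : exists o, (m <= (u : 'X_{1..r.+1}) o)%N.
    by apply: pigeonhole_sum; rewrite -mdegE uL.
  have [h [hh hE]] := Hm o.
  have mU : (U_(o) *+ m <= u)%MM.
    apply/mnm_lepP => i; rewrite mulmnE mnm1E; case: eqP => [<-|_]; rewrite ?mul0n// mul1n.
    exact: mo.
  have -> : a * gen_val 'X_[u] = gen_val ('X_[u - U_(o) *+ m] * h).
    rewrite -{1}(submK mU) mpolyXD -mpolyXn !rmorphM rmorphXn /= gen_valX mulrCA.
    by congr (_ * _); rewrite mulrC; exact: hE.
  apply: rep_homog.
  have dm : mdeg (U_(o) *+ m)%MM = m by rewrite mdegMn mdeg1 mul1n.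
  have -> : (L + q = mdeg (u - U_(o) *+ m)%MM + (m + q))%N.
    by rewrite addnA -{2}dm -mdegD submK// uL.
  by apply: dhomogM => //; rewrite dhomogX.
have /choice[c Hc] : forall u, exists c : T -> A, (forall w, p (c w)) /\ a * v u = \sum_w c w * v w.
  by move=> u; have [c pc E] := rep_row u; exists c.
pose M : 'M[A]_#|T| := \matrix_(i, j) ((i == j)%:R * a - c (enum_val i) (enum_val j)).
pose V : 'cV[A]_#|T| := \col_i v (enum_val i).
have MV : M *m V = 0.
  apply/colP => i; rewrite !mxE.
  rewrite (eq_bigr (fun j => (i == j)%:R * a * v (enum_val j) - c (enum_val i) (enum_val j) * v (enum_val j))); last first.
    by move=> j _; rewrite !mxE mulrBl.
  rewrite sumrB (bigD1 i) //= eqxx mul1r big1 ?addr0 => [|j /negPf ij]; last first.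
    by rewrite eq_sym ij mul0r mul0r.
  have [_ ->] := Hc (enum_val i).
  rewrite -(big_enum_val (fun w => c (enum_val i) w * v w)); apply/eqP; rewrite subr_eq0.
  by apply/eqP; apply: eq_bigl.
have [o go] := g_neq0.
have d0 : \det M = 0.
  have oT : (mdeg (U_(o) *+ L)%MM < L.+1)%N by rewrite mdegMn mdeg1 mul1n.
  have vo : v (BMultinom oT) != 0.
    by rewrite /v /= mdegMn mdeg1 mul1n eqxx -mpolyXn rmorphXn /= gen_valX expf_neq0.
  have := congr1 (mulmx (\adj M)) MV; rewrite mulmxA mul_adj_mx mulmx0 mul_scalar_mx.
  move=> /colP/(_ (enum_rank (BMultinom oT))); rewrite !mxE enum_rankK => /eqP.
  by rewrite mulf_eq0 (negPf vo) orbF => /eqP.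
have : p (\det M - a ^+ #|T|).
  apply: det_congr; first exact: total_piece Sa.
  move=> i j; rewrite !mxE; have [pc _] := Hc (enum_val i); split.
    apply: totalB; last exact: hset_total (pc _).
    by case: (i == j); rewrite ?mul1r ?mul0r; [exact: total_piece Sa|exact: total0].
  rewrite mulr_natl addrAC subrr; apply: hsetB => //.
  exact: hset0.
rewrite d0 sub0r => pa; apply: (hsetX (n := #|T|) Sa).
by rewrite -[_ ^+ _]opprK -[- (- _)]sub0r; apply: hsetB => //; exact: hset0.
Qed.

End Avoid.

(** An element of positive degree outside p has an n-th power of degree divisible by n, to which
    [absorbed_power] applies. *)
Lemma gen_avoid (p : proj_spec S) : exists o, ~ p (g o).
Proof.
apply: contrapT => /forallNP H; have pg o : p (g o) by apply: contrapT; exact: H.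
have [d [a [d0 Sa na]]] := hset_irrelevant p; apply: na.
exact: hsetX Sa (absorbed_power pg d0 (pieceX n Sa)).
Qed.

End ClosedImmersion.

(** * The closed immersion into a projective space *)

Lemma frac_eqP (D : idomainType) (a b c d : D) : b%:F != 0 -> d%:F != 0 ->
  a%:F / b%:F = c%:F / d%:F <-> a * d = c * b.
Proof.
move=> b0 d0; split=> [/eqP|E]; last first.
  by apply/eqP; rewrite (eqr_div _ _ b0 d0) -!tofracM tofrac_eq E.
by rewrite (eqr_div _ _ b0 d0) -!tofracM tofrac_eq => /eqP.
Qed.

Lemma frac_subE (D : idomainType) (a b c d : D) : b%:F != 0 -> d%:F != 0 ->
  a%:F / b%:F - c%:F / d%:F = (a * d - c * b)%:F / (b * d)%:F.
Proof.
by move=> b0 d0; rewrite -mulNr (addf_div _ _ b0 d0) mulNr tofracB !tofracM.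
Qed.

Section ProjMap.
Variables (C : fieldType) (A : idomainType) (iota : {rmorphism C -> A}).
Variables (S : grading iota) (n r : nat) (g : 'I_r.+1 -> A).
Hypothesis n0 : (0 < n)%N.
Hypothesis Sg : forall o, S n (g o).
Hypothesis g_gen : forall o q a, S (q * n)%N a ->
  exists m h, h \is (m + q).-homog /\ g o ^+ m * a = mmap iota g h.
Hypothesis g_neq0 : exists o, g o != 0.

Local Notation B := {mpoly C[r.+1]}.
Local Notation SB := (standard_grading C r.+1).
Local Notation X := (Proj S).
Local Notation Y := (projective_space C r).
Local Notation ev := (gen_val iota g).

Lemma piece_var o : SB 1 'X_o.
Proof. by rewrite /= dhomogX; apply/eqP; exact: mdeg1. Qed.

Lemma piece_ev d h : SB d h -> S (d * n)%N (ev h).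
Proof. exact: piece_gen_val. Qed.

Lemma evM h h' : ev (h * h') = ev h * ev h'. Proof. exact: rmorphM. Qed.
Lemma evB h h' : ev (h - h') = ev h - ev h'. Proof. exact: rmorphB. Qed.
Lemma evX o m : ev ('X_o ^+ m) = g o ^+ m.
Proof. by rewrite rmorphXn /= gen_valX. Qed.

Lemma point_map_exists (p : proj_spec S) : exists q : proj_spec SB,
  forall d h, SB d h -> q h <-> p (ev h).
Proof.
apply: mk_proj.
- by rewrite /gen_val mmap0; exact: hset0.
- by move=> d a b _ _ pa pb; rewrite evB; exact: hsetB.
- by move=> d e a b Sa _ pb; rewrite evM; exact: hsetMl_piece (piece_ev Sa) pb.
- by move=> d e a b Sa Sb; rewrite evM; exact: hsetM_piece (piece_ev Sa) (piece_ev Sb).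
have [o go] := gen_avoid n0 Sg g_gen g_neq0 p.
by exists 1%N, 'X_o; rewrite gen_valX; split=> //; exact: piece_var.
Qed.

Definition point_map (p : X) : Y := projT1 (cid (point_map_exists p)).

Lemma point_mapE (p : X) d h : SB d h -> hset (point_map p : proj_spec SB) h <-> hset (p : proj_spec S) (ev h).
Proof. exact: (projT2 (cid (point_map_exists p))). Qed.

Local Notation Fm p := (hset (point_map p : proj_spec SB)).

Lemma point_map_continuous : continuous point_map.
Proof.
apply/continuousP => U [E [SE ->]].
exists [set ev h | h in E]; split.
  by move=> _ [h /SE[d Sh] <-]; exists (d * n)%N; exact: piece_ev.
apply/seteqP; split=> p /=.
  move=> [h Eh ph]; exists (ev h); first by exists h.
  by have [d Sh] := SE _ Eh; move=> /(point_mapE p Sh).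
move=> [_ [h Eh <-] ph]; exists h => //.
by have [d Sh] := SE _ Eh; move=> /(point_mapE p Sh).
Qed.

(** The value is chosen among those given by all admissible fractions, which agree by [germ_mapE];
    it is 0 outside the local ring. *)
Definition germ_map (p : X) (u : {fraction B}) : {fraction A} :=
  xget 0 [set w | exists d a b, [/\ SB d a, SB d b, ~ Fm p b, u = a%:F / b%:F & w = (ev a)%:F / (ev b)%:F]].

Lemma germ_mapE (p : X) d a b : SB d a -> SB d b -> ~ Fm p b ->
  germ_map p (a%:F / b%:F) = (ev a)%:F / (ev b)%:F.
Proof.
move=> Sa Sb pb; apply: xget_unique; first by exists d, a, b.
move=> _ [d' [a' [b' [Sa' Sb' pb' E ->]]]].
have ev0 e h : SB e h -> ~ Fm p h -> (ev h)%:F != 0 :> {fraction A}.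
  move=> Sh ph; rewrite tofrac_eq0; apply/eqP => h0; apply: ph; apply/(point_mapE p Sh).
  by rewrite h0; exact: hset0.
have {}E := (frac_eqP _ _ (notin_hprime_neq0 pb) (notin_hprime_neq0 pb')).1 E.
by apply/(frac_eqP _ _ (ev0 _ _ Sb' pb') (ev0 _ _ Sb pb)); rewrite -!evM E.
Qed.

Lemma hloc_atP (p : X) u : hloc_at (point_map p) u -> exists d a b,
  [/\ SB d a, SB d b, ~ Fm p b & u = a%:F / b%:F].
Proof. by []. Qed.

Lemma ev_notin (p : X) d h : SB d h -> ~ Fm p h -> ~ hset (p : proj_spec S) (ev h).
Proof. by move=> Sh ph /(point_mapE p Sh). Qed.

Lemma ev_neq0 (p : X) d h : SB d h -> ~ Fm p h -> (ev h)%:F != 0 :> {fraction A}.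
Proof. by move=> Sh /(ev_notin Sh) ph; exact: notin_hprime_neq0 ph. Qed.

Lemma germ_map_cst (p : X) c : germ_map p (cst Y c) = cst X c.
Proof.
have S0 c' : SB 0%N c'%:MP by exact: (piece_cst SB).
have p1 : ~ Fm p 1%:MP by rewrite mpolyC1; exact: hset1.
have -> : cst Y c = (c%:MP)%:F / (1%:MP)%:F by rewrite mpolyC1 tofrac1 divr1.
by rewrite (germ_mapE (S0 _) (S0 _) p1) !gen_valC rmorph1 tofrac1 divr1.
Qed.

Lemma germ_mapB (p : X) u v : hloc_at (point_map p) u -> hloc_at (point_map p) v ->
  germ_map p (u - v) = germ_map p u - germ_map p v.
Proof.
move=> /hloc_atP[d [a [b [Sa Sb pb ->]]]] /hloc_atP[e [a' [b' [Sa' Sb' pb' ->]]]].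
have b0 := notin_hprime_neq0 pb; have b0' := notin_hprime_neq0 pb'.
rewrite (germ_mapE Sa Sb pb) (germ_mapE Sa' Sb' pb').
rewrite (frac_subE _ _ b0 b0') (frac_subE _ _ (ev_neq0 Sb pb) (ev_neq0 Sb' pb')).
rewrite (@germ_mapE p (d + e)) ?evB ?evM; first exact: erefl.
- apply: pieceB; first exact: pieceM.
  by rewrite addnC; exact: pieceM.
- exact: pieceM.
- exact: hset_mulN Sb Sb' pb pb'.
Qed.

Lemma germ_mapM (p : X) u v : hloc_at (point_map p) u -> hloc_at (point_map p) v ->
  germ_map p (u * v) = germ_map p u * germ_map p v.
Proof.
move=> /hloc_atP[d [a [b [Sa Sb pb ->]]]] /hloc_atP[e [a' [b' [Sa' Sb' pb' ->]]]].
rewrite (germ_mapE Sa Sb pb) (germ_mapE Sa' Sb' pb') !mulf_div -!tofracM.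
rewrite (@germ_mapE p (d + e)) ?evM; first exact: erefl.
- exact: pieceM.
- exact: pieceM.
- exact: hset_mulN Sb Sb' pb pb'.
Qed.

Lemma germ_map_loc (p : X) u : hloc_at (point_map p) u -> hloc_at p (germ_map p u).
Proof.
move=> /hloc_atP[d [a [b [Sa Sb pb ->]]]]; rewrite (germ_mapE Sa Sb pb).
exists (d * n)%N, (ev a), (ev b); split=> //; [exact: piece_ev|exact: piece_ev|].
exact: ev_notin Sb pb.
Qed.

Lemma germ_map_local (p : X) u : hloc_at (point_map p) u ->
  unit_in (hloc_at p) (germ_map p u) -> unit_in (hloc_at (point_map p)) u.
Proof.
move=> /hloc_atP[d [a [b [Sa Sb pb ->]]]]; rewrite (germ_mapE Sa Sb pb).
move=> [u0 _ [e [c [f [Sc Sf pf]]]]]; rewrite invf_div => E.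
apply: (hloc_at_unit Sa Sb _ pb) => /(point_mapE p Sa) pa.
have a0 : (ev a)%:F != 0 :> {fraction A} by move: u0; rewrite mulf_eq0 negb_or => /andP[].
have {}E := (frac_eqP _ _ a0 (notin_hprime_neq0 pf)).1 E.
have : hset (p : proj_spec S) (ev b * f) by rewrite E; exact: hsetMl_piece Sc pa.
by move=> /(hsetM_piece (piece_ev Sb) Sf)[|//]; exact: ev_notin Sb pb.
Qed.

Lemma germ_map_sections (U : set Y) s : open U -> sections U s ->
  sections (point_map @^-1` U) (fun p => germ_map p (s (point_map p))).
Proof.
move=> oU sU p Up; have [sp near_s] := sU _ Up; split; first exact: germ_map_loc sp.
have /hloc_atP[d [a [b [Sa Sb pb uE]]]] := sp.
have near1 : \forall q \near p, s (point_map q) = s (point_map p).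
  exact: (point_map_continuous near_s).
have near2 : \forall q \near p, ~ Fm q b.
  apply: open_nbhs_nbhs; split; last exact: pb.
  exists [set ev b]; split; first by move=> _ ->; exists (d * n)%N; exact: piece_ev.
  apply/seteqP; split=> q /=.
    by move=> qb; exists (ev b) => //; exact: ev_notin Sb qb.
  by move=> [_ -> qb] /(point_mapE q Sb).
apply: filterS2 near1 near2 => q -> qb.
by rewrite uE (germ_mapE Sa Sb pb) (germ_mapE Sa Sb qb).
Qed.

Definition proj_map : lrmorphism X Y :=
  @LRMorphism C X Y point_map germ_map point_map_continuous germ_map_cst
    germ_mapB germ_mapM germ_map_local germ_map_sections.

(** This gives closedness of the map: a prime that contains all polynomials vanishing on W lifts to
    a prime that contains all elements vanishing on W. *)
Lemma point_of_ideal (W : set X) (q : proj_spec SB) :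
  (forall d h, SB d h -> (forall p : proj_spec S, W p -> p (ev h)) -> q h) ->
  exists p : proj_spec S, (forall d a, S d a -> (forall p', W p' -> hset (p' : proj_spec S) a) -> p a) /\
    forall d h, SB d h -> p (ev h) <-> q h.
Proof.
move=> Wq.
have ker d h : SB d h -> ev h = 0 -> q h.
  by move=> Sh h0; apply: (Wq d) => // p _; rewrite h0; exact: hset0.
have [o qo] : exists o, ~ q 'X_o.
  have SX o : SB (1 * 1)%N 'X_o by exact: piece_var.
  have Xgen (o : 'I_r.+1) (d : nat) (h : B) : SB (d * 1)%N h -> exists m h', h' \is (m + d).-homog /\
      'X_o ^+ m * h = mmap (@mpolyC r.+1 C) (fun i => 'X_i) h'.
    rewrite muln1 => Sh; exists 0%N, h; split=> //; rewrite expr0 mul1r.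
    rewrite [LHS]mpolyE /mmap; apply: eq_bigr => e _.
    by rewrite mul_mpolyC mmap1_id.
  apply: (gen_avoid (n := 1) (g := fun o : 'I_r.+1 => 'X_o : B)) => //.
  by exists 0; exact: mpolyX_neq0.
have qoX m : ~ q ('X_o ^+ m) by move=> /(hsetX (piece_var o)).
have SBX m : SB m ('X_o ^+ m) by have := pieceX m (piece_var o); rewrite mul1n.
have qmul d h m : SB d h -> q ('X_o ^+ m * h) -> q h.
  by move=> Sh /(hsetM_piece (SBX m) Sh)[/qoX|].
(* Since q only sees polynomials in the generators, a is first brought by some b to a degree
   divisible by n, then into the image of [ev] by a power of g o, where 'X_o is not in q. *)
pose Q a := forall d e b m h l, S d a -> S e b -> (d + e = l * n)%N -> SB (m + l)%N h ->
  g o ^+ m * (a * b) = ev h -> q h.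
have gen a d e b l : S d a -> S e b -> (d + e = l * n)%N ->
    exists m h, SB (m + l)%N h /\ g o ^+ m * (a * b) = ev h.
  move=> Sa Sb E; have := pieceM Sa Sb; rewrite E => /(g_gen o)[m [h [hh hE]]].
  by exists m, h.
have [p pE] : exists p : proj_spec S, forall d a, S d a -> p a <-> Q a.
  apply: mk_proj.
  - move=> d e b m h l _ _ _ Sh; rewrite mul0r mulr0 => /esym; exact: ker _ _ Sh.
  - move=> d a a' Sa Sa' Qa Qa' d' e b m h l Saa' Sb E Sh hE.
    (* Zero has every degree, whereas the degree of a nonzero element is unique; the two cases are
       separate throughout. *)
    have [aa0|aa0] := eqVneq (a - a') 0.
      by apply: (ker _ _ Sh); rewrite -hE aa0 mul0r mulr0.
    have dd := piece_uniq (pieceB Sa Sa') Saa' aa0.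
    subst d'.
    have [m1 [h1 [Sh1 h1E]]] := gen _ _ _ _ _ Sa Sb E.
    have [m2 [h2 [Sh2 h2E]]] := gen _ _ _ _ _ Sa' Sb E.
    have q1 := Qa _ _ _ _ _ _ Sa Sb E Sh1 h1E.
    have q2 := Qa' _ _ _ _ _ _ Sa' Sb E Sh2 h2E.
    apply: (qmul _ _ (m1 + m2)%N Sh).
    have Sd : SB (m + m1 + m2 + l)%N ('X_o ^+ (m1 + m2) * h - 'X_o ^+ m * ('X_o ^+ m2 * h1 - 'X_o ^+ m1 * h2)).
      apply: pieceB.
        by rewrite -[X in SB X](_ : (m1 + m2) + (m + l) = _)%N; [exact: pieceM|lia].
      rewrite -[X in SB X](_ : m + (m2 + (m1 + l)) = _)%N; last lia.
      apply: pieceM => //; apply: pieceB; first exact: pieceM.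
      by rewrite -[X in SB X](_ : m1 + (m2 + l) = _)%N; [exact: pieceM|lia].
    have d0 : ev ('X_o ^+ (m1 + m2) * h - 'X_o ^+ m * ('X_o ^+ m2 * h1 - 'X_o ^+ m1 * h2)) = 0.
      by rewrite !(evB, evM) !evX -hE -h1E -h2E exprD; ring.
    have := ker _ _ Sd d0 => qd.
    have qr : q ('X_o ^+ m * ('X_o ^+ m2 * h1 - 'X_o ^+ m1 * h2)).
      apply: (hsetMl_piece (SBX m)); apply: hsetB.
        exact: hsetMl_piece (SBX m2) q1.
      exact: hsetMl_piece (SBX m1) q2.
    by have := hsetD qd qr; rewrite subrK.
  - move=> d e c a Sc Sa Qa d' e' b m h l Sca Sb E Sh hE.
    have [ca0|ca0] := eqVneq (c * a) 0.
      by apply: (ker _ _ Sh); rewrite -hE ca0 mul0r mulr0.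
    have dd := piece_uniq (pieceM Sc Sa) Sca ca0.
    apply: (Qa e (d + e')%N (c * b) m h l) => //; first exact: pieceM.
      by rewrite -E -dd; lia.
    by rewrite -hE; congr (_ * _); ring.
  - move=> d e a b Sa Sb Qab; apply: contrapT => /not_orP[].
    move=> /existsNP[d1] /existsNP[e1] /existsNP[b1] /existsNP[m1] /existsNP[h1] /existsNP[l1].
    move=> /not_implyP[Sa1] /not_implyP[Sb1] /not_implyP[E1] /not_implyP[Sh1] /not_implyP[hE1 nh1].
    move=> /existsNP[d2] /existsNP[e2] /existsNP[b2] /existsNP[m2] /existsNP[h2] /existsNP[l2].
    move=> /not_implyP[Sa2] /not_implyP[Sb2] /not_implyP[E2] /not_implyP[Sh2] /not_implyP[hE2 nh2].
    have : q (h1 * h2).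
      apply: (Qab (d1 + d2)%N (e1 + e2)%N (b1 * b2) (m1 + m2)%N (h1 * h2) (l1 + l2)%N).
      - exact: pieceM.
      - exact: pieceM.
      - by rewrite mulnDl -E1 -E2; lia.
      - by rewrite -[X in SB X](_ : (m1 + l1) + (m2 + l2) = _)%N; [exact: pieceM|lia].
      by rewrite evM -hE1 -hE2 exprD; ring.
    by move=> /(hsetM_piece Sh1 Sh2)[].
  exists n, (g o); split=> //.
  move=> /(_ n 0%N 1 0%N 'X_o 1%N (Sg o) (piece1 S)) H; apply: qo; apply: H.
  - by rewrite addn0 mul1n.
  - exact: piece_var.
  by rewrite expr0 mul1r mulr1 gen_valX.
exists p; split.
  move=> d a Sa Wa; apply/(pE _ _ Sa) => d' e b m h l Sa' Sb E Sh hE.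
  apply: (Wq _ _ Sh) => p' Wp'; rewrite -hE.
  have Sgm : S (n * m)%N (g o ^+ m) by exact: pieceX.
  apply: (hsetMl_piece Sgm); rewrite mulrC; apply: (hsetMl_piece Sb).
  exact: Wa.
move=> d h Sh; split.
  move=> /(pE _ _ (piece_ev Sh)) /(_ (d * n)%N 0%N 1 0%N h d (piece_ev Sh) (piece1 S)); apply.
  - by rewrite addn0.
  - exact: Sh.
  by rewrite expr0 mul1r mulr1.
move=> qh; apply/(pE _ _ (piece_ev Sh)) => d' e b m h' l Seh Sb E Sh' hE.
have [eh0|eh0] := eqVneq (ev h) 0.
  by apply: (ker _ _ Sh'); rewrite -hE eh0 mul0r mulr0.
have dd := piece_uniq (piece_ev Sh) Seh eh0.
have dl : (d <= l)%N by rewrite -(leq_pmul2r n0) dd -E leq_addr.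
have eE : (e = (l - d) * n)%N by rewrite mulnBl -E dd addKn.
have [m2 [h2 [Sh2 h2E]]] : exists m2 h2, SB (m2 + (l - d))%N h2 /\ g o ^+ m2 * b = ev h2.
  by move: Sb; rewrite eE => /(g_gen o)[m2 [h2 [hh2 hE2]]]; exists m2, h2.
apply: (qmul _ _ m2 Sh').
have Sd : SB (m2 + (m + l))%N ('X_o ^+ m2 * h' - 'X_o ^+ m * (h2 * h)).
  apply: pieceB; first exact: pieceM.
  rewrite -[X in SB X](_ : m + ((m2 + (l - d)) + d) = _)%N; last lia.
  by apply: pieceM => //; exact: pieceM.
have d0 : ev ('X_o ^+ m2 * h' - 'X_o ^+ m * (h2 * h)) = 0.
  by rewrite !(evB, evM) !evX -hE -h2E; ring.
have qr : q ('X_o ^+ m * (h2 * h)).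
  by apply: (hsetMl_piece (SBX m)); exact: hsetMl_piece Sh2 qh.
by have := hsetD (ker _ _ Sd d0) qr; rewrite subrK.
Qed.

(** Degrees not divisible by n are circumvented: a point is tested on a through a^n, and a germ a /
    b is rewritten as a b^(n-1) / b^n. *)
Theorem proj_map_closed_immersion : closed_immersion proj_map.
Proof.
split.
- move=> p p' E; apply: (@proj_spec_ext _ _ _ S) => d a Sa.
  have [o po] := gen_avoid n0 Sg g_gen g_neq0 p.
  have San : S (d * n)%N (a ^+ n) by exact: pieceX.
  have [m [h [hh hE]]] := g_gen o San.
  have Sgm : S (n * m)%N (g o ^+ m) by exact: pieceX.
  have key (x : X) : ~ hset (x : proj_spec S) (g o) ->
      (hset (x : proj_spec S) a <-> Fm x h).
    move=> xo; rewrite (point_mapE x (d := m + d)) //.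
    rewrite -[ev h]/(mmap iota g h) -hE; split=> [xa|].
      apply: (hsetMl_piece Sgm).
      rewrite -(prednK n0) exprSr.
      exact: hsetMl_piece (pieceX _ Sa) xa.
    move=> /(hsetM_piece Sgm San)[/(hsetX (Sg o))//|/(hsetX Sa)//].
  have p'o : ~ hset (p' : proj_spec S) (g o).
    move=> p'go; apply: po; rewrite -(gen_valX iota g).
    apply/(point_mapE p (piece_var o)); rewrite [point_map p]E.
    by apply/(point_mapE p' (piece_var o)); rewrite gen_valX.
  by rewrite (key p po) (key p' p'o) [point_map p]E.
- move=> W cW.
  have [E [SE WE]] : open (~` W) by exact: closed_openC.
  have WP (p : X) : W p <-> forall a, E a -> hset (p : proj_spec S) a.
    split=> [Wp a Ea|H].
      apply: contrapT => pa.
      have : (~` W) p by rewrite WE; exists a.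
      exact.
    apply: contrapT => nW; have : (~` W) p by [].
    by rewrite WE => -[a Ea]; apply; exact: H.
  rewrite -[X in closed X]setCK; apply: open_closedC.
  exists [set h | exists2 d, SB d h & forall p : proj_spec S, W p -> p (ev h)]; split.
    by move=> h [d Sh _]; exists d.
  apply/seteqP; split=> q /=.
    move=> nq; apply: contrapT => H; apply: nq.
    have Wq d h : SB d h -> (forall p : proj_spec S, W p -> p (ev h)) -> hset (q : proj_spec SB) h.
      by move=> Sh Wh; apply: contrapT => qh; apply: H; exists h => //; exists d.
    have [p [pW pq]] := point_of_ideal Wq.
    exists p.
      apply/WP => a Ea; have [d Sa] := SE _ Ea; apply: (pW _ _ Sa) => p' /WP; exact.
    apply: (@proj_spec_ext _ _ _ SB) => d h Sh.
    by rewrite (point_mapE p Sh); exact: pq Sh.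
  move=> [h [d Sh Wh] qh] [p Wp pq]; apply: qh; rewrite -pq.
  by apply/(point_mapE p Sh); exact: Wh.
move=> p v [d [a [b [Sa Sb pb ->]]]].
have [o po] := gen_avoid n0 Sg g_gen g_neq0 p.
have San : S (d * n)%N (a * b ^+ n.-1).
  by rewrite -{1}(prednK n0) mulnS; apply: pieceM => //; exact: pieceX.
have Sbn : S (d * n)%N (b ^+ n) by exact: pieceX.
have [m [h [hh hE]]] := g_gen o San; have [m' [h' [hh' hE']]] := g_gen o Sbn.
have SBX l : SB l ('X_o ^+ l) by have := pieceX l (piece_var o); rewrite mul1n.
have S1 : SB (m' + (m + d))%N ('X_o ^+ m' * h) by exact: pieceM.
have S2 : SB (m' + (m + d))%N ('X_o ^+ m * h').
  by rewrite -[X in SB X](_ : m + (m' + d) = _)%N; [exact: pieceM|lia].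
have e1 : ev ('X_o ^+ m' * h) = g o ^+ m' * (g o ^+ m * (a * b ^+ n.-1)).
  by rewrite evM evX hE.
have e2 : ev ('X_o ^+ m * h') = g o ^+ m * (g o ^+ m' * b ^+ n).
  by rewrite evM evX hE'.
have pgX l : ~ hset (p : proj_spec S) (g o ^+ l) by move=> /(hsetX (Sg o)).
have SgX l : S (n * l)%N (g o ^+ l) by exact: pieceX.
have pbn : ~ hset (p : proj_spec S) (b ^+ n) by move=> /(hsetX Sb).
have p2 : ~ Fm p ('X_o ^+ m * h').
  move=> /(point_mapE p S2); rewrite e2 => /(hsetM_piece (SgX m) (pieceM (SgX m') Sbn))[/pgX//|].
  by move=> /(hsetM_piece (SgX m') Sbn)[/pgX|].
exists (('X_o ^+ m' * h)%:F / ('X_o ^+ m * h')%:F).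
  by exists (m' + (m + d))%N, ('X_o ^+ m' * h), ('X_o ^+ m * h').
rewrite [LHS](germ_mapE S1 S2 p2).
have b0 := notin_hprime_neq0 pb.
apply/(frac_eqP _ _ (ev_neq0 S2 p2) b0).
by rewrite e1 e2 -[in RHS](prednK n0) exprS; ring.
Qed.

End ProjMap.

(** * The open immersion of the jet bundle *)

Section JetDiv.
Variables (k : nat) (F : fieldType).
Implicit Types u v w : 'rV[F]_k.+1.

Lemma jet_div_adj u v : v 0 0 != 0 ->
  u *m \adj (leibniz v) = v 0 0 ^+ k.+1 *: jet_div u v.
Proof.
move=> v0; rewrite /jet_div /invmx leibniz_unit// det_leibniz.
by rewrite -scalemxAr scalerA mulfV ?scale1r// expf_neq0.
Qed.

Lemma jet_div_leibniz u v w : v 0 0 != 0 -> w 0 0 != 0 ->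
  jet_div (u *m leibniz w) (v *m leibniz w) = jet_div u v.
Proof.
move=> v0 w0; have vw0 : (v *m leibniz w) 0 0 != 0 by rewrite jet_mul0 mulf_neq0.
apply: (can_inj (mulmxK (leibniz_unit vw0))).
by rewrite jet_divK// leibniz_mul mulmxA jet_divK.
Qed.

Lemma jet_div_mulV u v : v 0 0 != 0 -> jet_div u v = u *m leibniz (jet_div (jet1 k F) v).
Proof. by move=> v0; rewrite leibniz_div// leibniz1 mul1mx. Qed.

End JetDiv.

Section JetMap.
Variables (C : fieldType) (N k : nat).
Hypothesis charC : forall m, m.+1%:R != 0 :> C.
Local Notation n := k.+1.
Local Notation V := {mpoly C[N.+1 * k.+1]}.
Local Notation A := (chart_ring C N k).
Local Notation F := {fraction A}.
Local Notation L := {fraction V}.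
Local Notation S := (Vdiff C N k).
Local Notation polyCst := (@mpolyC (N.+1 * k.+1) C : {rmorphism C -> V}).
Local Notation Xz i := (Xvar C i 0 : V).

HB.instance Definition _ (i : 'I_N.+1) := GRing.RMorphism.copy (dehom i : V -> A)
  (mmap (@mpolyC (N * k.+1) C)
    (mxvec (\matrix_(j < N.+1, s < k.+1) hcoord C k i j 0 s) 0)).

Lemma dehomX (i j : 'I_N.+1) (s : 'I_n) : dehom i (Xvar C j s) = hcoord C k i j 0 s.
Proof. by rewrite /dehom /Xvar mmapX mmap1U mxvecE mxE. Qed.

Lemma dehomC (i : 'I_N.+1) c : dehom i (c%:MP : V) = c%:MP.
Proof. by rewrite /dehom mmapC. Qed.

Lemma dehomXii (i : 'I_N.+1) : dehom i (Xz i) = 1.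
Proof. by rewrite dehomX hcoordii mxE eqxx. Qed.

Lemma map_dehom (i j : 'I_N.+1) : map_mx (dehom i) (row j (Xmx C N k)) = hcoord C k i j.
Proof. by apply/rowP => s; rewrite !mxE dehomX. Qed.

Definition jet_row (j : 'I_N.+1) : 'rV[L]_n := map_mx (@FracField.tofrac V) (row j (Xmx C N k)).

Lemma jet_row0 j : jet_row j 0 0 = (Xz j)%:F.
Proof. by rewrite !mxE. Qed.

Lemma jet_row_neq0 j : jet_row j 0 0 != 0.
Proof. by rewrite jet_row0 tofrac_eq0; exact: mpolyX_neq0. Qed.

(** The inverse of dehomogenization: the chart coordinates become the derivatives of X_j / X_i. *)
Definition chart_frac (i : 'I_N.+1) (a : A) : L :=
  mmap (@FracField.tofrac V \o @mpolyC (N.+1 * k.+1) C)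
    (mxvec (\matrix_(j < N, s < n) jet_div (jet_row (lift i j)) (jet_row i) 0 s) 0) a.

HB.instance Definition _ (i : 'I_N.+1) := GRing.RMorphism.copy (chart_frac i : A -> L)
  (mmap (@FracField.tofrac V \o @mpolyC (N.+1 * k.+1) C)
    (mxvec (\matrix_(j < N, s < n) jet_div (jet_row (lift i j)) (jet_row i) 0 s) 0)).

Lemma chart_fracC i c : chart_frac i c%:MP = (c%:MP)%:F.
Proof. by rewrite /chart_frac mmapC. Qed.

Lemma chart_fracX i j s : chart_frac i 'X_(mxvec_index j s) =
  jet_div (jet_row (lift i j)) (jet_row i) 0 s.
Proof. by rewrite /chart_frac mmapX mmap1U mxvecE mxE. Qed.

Lemma map_chart_frac i j : map_mx (chart_frac i) (hcoord C k i j) = jet_div (jet_row j) (jet_row i).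
Proof.
have [<-|nij] := eqVneq i j; first by rewrite hcoordii map_jet1 jet_divv// jet_row_neq0.
have [j' -> _] := unlift_some nij.
by apply/rowP => s; rewrite mxE hcoord_lift mxE chart_fracX.
Qed.

Lemma chart_frac_coord i j : chart_frac i (hcoord C k i j 0 0) = (Xz j)%:F / (Xz i)%:F.
Proof.
have /rowP/(_ 0) := map_chart_frac i j.
by rewrite mxE jet_div0 ?jet_row_neq0// !jet_row0.
Qed.

Lemma XF_neq0 j : (Xz j)%:F != 0 :> L.
Proof. by rewrite -jet_row0 jet_row_neq0. Qed.

Lemma diff_homogX i : diff_homog 1 (Xz i).
Proof.
apply: diff_homogP => // v _.
rewrite -[X in jet_eval _ _ X]/(Xvar C i 0) jet_evalX mxE (bigD1 0) //= big1 ?addr0 => [|r r0].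
  by rewrite !mxE bin0 subn0 mulr1n inord_val expr1 mulrC mul_mpolyC.
rewrite [leibniz _ _ _]mxE bin_small ?mulr0n ?mulr0//.
by rewrite lt0n; apply: contraNneq r0 => E; apply/eqP/val_inj.
Qed.

Lemma piece_X i d : S d (Xz i ^+ d).
Proof. by have := pieceX d (diff_homogX i : S 1%N (Xz i)); rewrite mul1n. Qed.

Lemma chart_frac_dehom i d (P : V) : diff_homog d P ->
  chart_frac i (dehom i P) = P%:F / (Xz i)%:F ^+ d.
Proof.
move=> Pd; pose jc : {rmorphism C -> L} := @FracField.tofrac V \o polyCst.
pose xL : 'M[L]_(N.+1, n) := map_mx (@FracField.tofrac V) (Xmx C N k).
have row_xL j : row j xL = jet_row j by apply/rowP => s; rewrite !mxE.
have -> : chart_frac i (dehom i P) =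
    jet_eval jc (xL *m leibniz (jet_div (jet1 k L) (jet_row i))) P.
  apply: rmorph_mmap => [c|v]; first exact: chart_fracC.
  case/mxvec_indexP: v => j s; rewrite !mxvecE [in LHS]mxE -[LHS]/(chart_frac i (hcoord C k i j 0 s)).
  have -> : chart_frac i (hcoord C k i j 0 s) = map_mx (chart_frac i) (hcoord C k i j) 0 s.
    by rewrite [RHS]mxE.
  rewrite map_chart_frac jet_div_mulV ?jet_row_neq0//.
  by rewrite -row_xL -row_mul [LHS]mxE.
rewrite (jet_eval_leibniz charC _ _ _ Pd) jet_div0 ?jet_row_neq0// jet_row0 mxE eqxx div1r.
rewrite exprVn mulrC; congr (_ / _).
rewrite -[in RHS](jet_eval_id P); apply/esym.
by apply: (jet_eval_comp (g := @FracField.tofrac V)).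
Qed.

(** By Cramer's rule, X_i^(k+1) times the s-th derivative of X_j / X_i. *)
Definition chart_coord_numer (i j : 'I_N.+1) (s : 'I_n) : V :=
  (row j (Xmx C N k) *m \adj (leibniz (row i (Xmx C N k)))) 0 s.

Lemma jet_eval_numer (R : comNzRingType) (f : {rmorphism C -> R}) x i j s :
  jet_eval f x (chart_coord_numer i j s) = (row j x *m \adj (leibniz (row i x))) 0 s.
Proof.
have -> : jet_eval f x (chart_coord_numer i j s) =
  map_mx (jet_eval f x) (row j (Xmx C N k) *m \adj (leibniz (row i (Xmx C N k)))) 0 s.
  by rewrite [RHS]mxE.
by rewrite map_mxM map_mx_adj map_leibniz !map_row jet_eval_Xmx.
Qed.

Lemma chart_coord_numerE i j s :
  (chart_coord_numer i j s)%:F = (Xz i)%:F ^+ n * jet_div (jet_row j) (jet_row i) 0 s.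
Proof.
have -> : (chart_coord_numer i j s)%:F = map_mx (@FracField.tofrac V)
  (row j (Xmx C N k) *m \adj (leibniz (row i (Xmx C N k)))) 0 s by rewrite [RHS]mxE.
rewrite map_mxM map_mx_adj map_leibniz -!/(jet_row _) jet_div_adj ?jet_row_neq0//.
by rewrite mxE jet_row0.
Qed.

Lemma diff_homog_numer i j s : diff_homog n (chart_coord_numer i j s).
Proof.
apply: diff_homogP => // v v0; apply/eqP; rewrite -tofrac_eq; apply/eqP.
rewrite jet_eval_numer !row_mul; set w := map_mx _ v.
pose wF := map_mx (@FracField.tofrac V) w.
have wF0 : wF 0 0 = (v 0 0)%:MP%:F by rewrite !mxE.
have wF0_neq0 : wF 0 0 != 0 by rewrite wF0 tofrac_eq0 mpolyC_eq0.
set M := _ *m _; have -> : (M 0 s)%:F = map_mx (@FracField.tofrac V) M 0 s by rewrite [RHS]mxE.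
rewrite /M !map_mxM map_mx_adj !map_leibniz !map_mxM !map_leibniz -!/(jet_row _) -/wF.
have vw0 : (jet_row i *m leibniz wF) 0 0 != 0.
  by rewrite jet_mul0; exact: mulf_neq0 (jet_row_neq0 i) wF0_neq0.
rewrite (jet_div_adj _ vw0) (jet_div_leibniz _ (jet_row_neq0 i) wF0_neq0) mxE jet_mul0 jet_row0 wF0.
rewrite -mul_mpolyC tofracM rmorphXn tofracXn chart_coord_numerE exprMn.
by rewrite mulrAC mulrC mulrA.
Qed.

Lemma dehom_numer i j s : dehom i (chart_coord_numer i j s) = hcoord C k i j 0 s.
Proof.
have -> : dehom i (chart_coord_numer i j s) = map_mx (dehom i)
  (row j (Xmx C N k) *m \adj (leibniz (row i (Xmx C N k)))) 0 s by rewrite [RHS]mxE.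
rewrite map_mxM map_mx_adj map_leibniz !map_dehom hcoordii leibniz1.
have -> : \adj 1%:M = 1%:M :> 'M[A]_n.
  by have := mul_mx_adj (1%:M : 'M[A]_n); rewrite mul1mx det1.
by rewrite mulmx1.
Qed.

Lemma dehom_surj i (a : A) : exists d P, S d P /\ dehom i P = a.
Proof.
elim/chart_ind: a => [c|j s|a b [d [P [SP <-]]] [e [Q [SQ <-]]]|a b [d [P [SP <-]]] [e [Q [SQ <-]]]].
- by exists 0%N, c%:MP; split; [exact: (piece_cst S)|exact: dehomC].
- exists n, (chart_coord_numer i (lift i j) s); split; first exact: diff_homog_numer.
  by rewrite dehom_numer hcoord_lift mxE.
(* Powers of X_i equalize the degrees and dehomogenize to 1. *)
- exists (d + e)%N, (P * Xz i ^+ e + Q * Xz i ^+ d); split.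
    apply: pieceD; first exact: pieceM SP (piece_X i e).
    by rewrite addnC; exact: pieceM SQ (piece_X i d).
  by rewrite rmorphD !rmorphM !rmorphXn /= dehomXii !expr1n !mulr1.
by exists (d + e)%N, (P * Q); split; [exact: pieceM SP SQ|rewrite rmorphM].
Qed.

Lemma chart_frac_inj i (a : A) : chart_frac i a = 0 -> a = 0.
Proof.
have [d [P [SP <-]]] := dehom_surj i a; rewrite (chart_frac_dehom i SP) => /eqP.
rewrite mulf_eq0 invr_eq0 expf_eq0 (negPf (XF_neq0 i)) andbF orbF tofrac_eq0 => /eqP->.
exact: rmorph0.
Qed.

Definition chartF (i : 'I_N.+1) : F -> L := frac_lift (chart_frac i).

HB.instance Definition _ (i : 'I_N.+1) :=
  GRing.isZmodMorphism.Build F L (chartF i) (frac_lift_zmod (@chart_frac_inj i)).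
HB.instance Definition _ (i : 'I_N.+1) :=
  GRing.isMonoidMorphism.Build F L (chartF i) (frac_lift_monoid (@chart_frac_inj i)).

Lemma chartF_frac i a : chartF i a%:F = chart_frac i a.
Proof. exact: (frac_lift_frac (@chart_frac_inj i)). Qed.

Lemma chartF_inj i : injective (chartF i).
Proof. exact: fmorph_inj. Qed.

Lemma chartF_div i a b : chartF i (a%:F / b%:F) = chart_frac i a / chart_frac i b.
Proof. by rewrite fmorph_div /= !chartF_frac. Qed.

Lemma map_chartF i j : map_mx (chartF i) (hcoordF C k i j) = jet_div (jet_row j) (jet_row i).
Proof.
rewrite -map_chart_frac; apply/rowP => s; rewrite !mxE; exact: chartF_frac.
Qed.

Lemma chartF_trans i l a : chartF i (trans i l a) = chart_frac l a.
Proof.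
pose f := [the {rmorphism A -> L} of chartF i \o trans i l].
apply: (@chart_morph _ _ _ _ f (chart_frac l)) => [c|j s] /=.
  by rewrite transC chartF_frac !chart_fracC.
rewrite transX chart_fracX; set u := jet_div _ _.
have -> : chartF i (u 0 s) = map_mx (chartF i) u 0 s by rewrite [RHS]mxE.
by rewrite map_jet_div !map_chartF jet_div_div ?jet_row_neq0.
Qed.

Lemma chartF_transF i l u : chartF i (transF i l u) = chartF l u.
Proof.
have [a [b [b0 ->]]] := fracP u.
by rewrite transF_div fmorph_div /= !chartF_trans chartF_div.
Qed.

(** In the fractions of V, both sides become P / X_l^d. *)
Lemma trans_dehom i l d (P : V) : S d P ->
  trans i l (dehom l P) = (dehom i P)%:F / (hcoord C k i l 0 0 ^+ d)%:F.
Proof.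
move=> SP; apply: (chartF_inj (i := i)); rewrite chartF_trans chartF_div.
rewrite (chart_frac_dehom l SP) (chart_frac_dehom i SP) rmorphXn /= chart_frac_coord.
rewrite expr_div_n invf_div mulrA divfK ?expf_neq0 ?XF_neq0//.
Qed.

Local Notation J := (jet_bundle C N k).
Local Notation Y := (PN_jet C N k).
Local Notation chF i := (chartF i).

Lemma dehomM (i : 'I_N.+1) (P Q : V) : dehom i (P * Q) = dehom i P * dehom i Q.
Proof. exact: rmorphM. Qed.

Lemma dehomXn (i : 'I_N.+1) m : dehom i (Xz i ^+ m) = 1.
Proof. by rewrite rmorphXn /= dehomXii expr1n. Qed.

Lemma chart_point_exists (i : 'I_N.+1) (p : prime_spec A) : exists q : proj_spec S,
  forall d P, S d P -> q P <-> p (dehom i P).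
Proof.
apply: mk_proj.
- by rewrite /dehom mmap0; exact: pset0.
- by move=> d P Q _ _ pP pQ; rewrite [dehom _ _]rmorphB; exact: psetB.
- by move=> d e P Q _ _ pQ; rewrite dehomM; exact: psetMl.
- by move=> d e P Q _ _; rewrite dehomM => /psetP.
exists 1%N, (Xz i); split=> //; first exact: diff_homogX.
by rewrite dehomXii; exact: pset1.
Qed.

Definition chart_point (i : 'I_N.+1) (p : prime_spec A) : Y :=
  projT1 (cid (chart_point_exists i p)).

Lemma chart_pointE i p d P : S d P ->
  hset (chart_point i p : proj_spec S) P <-> p (dehom i P).
Proof. exact: (projT2 (cid (chart_point_exists i p))). Qed.

Lemma chart_point_X i p : ~ hset (chart_point i p : proj_spec S) (Xz i).
Proof. by move=> /(chart_pointE i p (diff_homogX i)); rewrite dehomXii; exact: pset1. Qed.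

Lemma max_at_div (p : prime_spec A) a b : ~ p b -> max_at p (a%:F / b%:F) <-> p a.
Proof.
move=> pb; have b0 := notin_prime_neq0 pb; split=> [H|pa]; last by exists a, b.
apply/max_at_frac; rewrite -[a%:F](divfK b0) mulrC.
by apply: max_atM => //; exact: loc_at_frac.
Qed.

Lemma chart_point_glued i l p q :
  glued (existT _ i p) (existT _ l q) -> chart_point i p = chart_point l q.
Proof.
move=> [pil pq]; apply: (@proj_spec_ext _ _ _ S) => d P SP.
rewrite (chart_pointE i p SP) (chart_pointE l q SP) pq (trans_dehom i l SP).
by rewrite max_at_div//; exact: prime_exp.
Qed.

Definition jet_map (x : J) : Y :=
  chart_point (projT1 (repr (x : jet_pts C N k))) (projT2 (repr (x : jet_pts C N k))).

Lemma jet_map_pt i p : jet_map (jet_pt i p) = chart_point i p.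
Proof.
apply: chart_point_glued; apply: jet_pt_eq.
by rewrite /jet_pt -sigT_eta reprK.
Qed.

Lemma jet_map_continuous : continuous jet_map.
Proof.
apply/continuousP => U [E [SE ->]]; apply/sigT_openP => i.
exists [set dehom i P | P in E]; apply/seteqP; split=> p /=.
  rewrite -[X in jet_map X]/(jet_pt i p) jet_map_pt => -[P EP pP].
  exists (dehom i P); first by exists P.
  by have [d SP] := SE _ EP; move=> /(chart_pointE i p SP).
move=> [_ [P EP <-] pP]; exists P => //.
rewrite -[X in jet_map X]/(jet_pt i p) jet_map_pt.
by have [d SP] := SE _ EP; move=> /(chart_pointE i p SP).
Qed.

Lemma chartF_fracE i d (P Q : V) : S d P -> S d Q -> Q != 0 ->
  P%:F / Q%:F = chF i ((dehom i P)%:F / (dehom i Q)%:F).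
Proof.
move=> SP SQ Q0; rewrite chartF_div (chart_frac_dehom i SP) (chart_frac_dehom i SQ).
have X0 : (Xz i)%:F ^+ d != 0 :> L by rewrite expf_neq0 ?XF_neq0.
by rewrite invf_div mulrA divfK.
Qed.

Lemma loc_at_chart i p (z : F) : loc_at p z <-> hloc_at (chart_point i p) (chF i z).
Proof.
split.
  move=> [a [b [pb ->]]].
  have [d [P [SP Pa]]] := dehom_surj i a; have [e [Q [SQ Qb]]] := dehom_surj i b.
  have S1 : S (d + e)%N (P * Xz i ^+ e) := pieceM SP (piece_X i e).
  have S2 : S (d + e)%N (Q * Xz i ^+ d).
    by rewrite addnC; exact: pieceM SQ (piece_X i d).
  have q2 : ~ hset (chart_point i p : proj_spec S) (Q * Xz i ^+ d).
    by move=> /(chart_pointE i p S2); rewrite dehomM dehomXn mulr1 Qb.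
  exists (d + e)%N, (P * Xz i ^+ e), (Q * Xz i ^+ d); split=> //.
  have Q0 : Q * Xz i ^+ d != 0 by apply/eqP => Q0; apply: q2; rewrite Q0; exact: hset0.
  by rewrite (chartF_fracE i S1 S2 Q0) !dehomM !dehomXn !mulr1 Pa Qb.
move=> [d [P [Q [SP SQ qQ E]]]].
have Q0 : Q != 0 by apply/eqP => Q0; apply: qQ; rewrite Q0; exact: hset0.
move: E; rewrite (chartF_fracE i SP SQ Q0) => /(chartF_inj (i := i)) ->.
exists (dehom i P), (dehom i Q); split=> // /(chart_pointE i p SQ).
exact: qQ.
Qed.

Lemma jet_stalk_chartF (x : J) (w : F) : jet_stalk x w <-> hloc_at (jet_map x) (chF ord0 w).
Proof.
have [i [p ->]] := jet_ptP (x : jet_pts C N k).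
by rewrite jet_stalkE jet_map_pt /= (loc_at_chart i) chartF_transF.
Qed.

Lemma hloc_at_chartF (x : J) (u : L) : hloc_at (jet_map x) u -> exists w, u = chF ord0 w.
Proof.
have [i [p ->]] := jet_ptP (x : jet_pts C N k); rewrite jet_map_pt => -[d [P [Q [SP SQ qQ ->]]]].
have Q0 : Q != 0 by apply/eqP => Q0; apply: qQ; rewrite Q0; exact: hset0.
exists (transF ord0 i ((dehom i P)%:F / (dehom i Q)%:F)).
by rewrite chartF_transF -(chartF_fracE i SP SQ Q0).
Qed.

(* The pull-back of germs inverts [chartF], and does not depend on the point. *)
Definition jet_germ (x : J) (u : L) : F := xget 0 [set w | chF ord0 w = u].

Lemma jet_germE x w : jet_germ x (chF ord0 w) = w.
Proof. by apply: xget_unique => // w' /(chartF_inj (i := ord0)). Qed.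

Lemma jet_germ_cst (x : J) c : jet_germ x (cst Y c) = cst J c.
Proof.
have -> : cst Y c = chF ord0 (cst J c) by rewrite /= chartF_frac chart_fracC.
exact: jet_germE.
Qed.

Lemma jet_germB (x : J) u v : hloc_at (jet_map x) u -> hloc_at (jet_map x) v ->
  jet_germ x (u - v) = jet_germ x u - jet_germ x v.
Proof.
move=> /hloc_at_chartF[a ->] /hloc_at_chartF[b ->].
have -> : chF ord0 a - chF ord0 b = chF ord0 (a - b) by rewrite rmorphB.
by rewrite !jet_germE.
Qed.

Lemma jet_germM (x : J) u v : hloc_at (jet_map x) u -> hloc_at (jet_map x) v ->
  jet_germ x (u * v) = jet_germ x u * jet_germ x v.
Proof.
move=> /hloc_at_chartF[a ->] /hloc_at_chartF[b ->].
have -> : chF ord0 a * chF ord0 b = chF ord0 (a * b) by rewrite rmorphM.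
by rewrite !jet_germE.
Qed.

Lemma jet_germ_local (x : J) u : hloc_at (jet_map x) u ->
  unit_in (jet_stalk x) (jet_germ x u) -> unit_in (hloc_at (jet_map x)) u.
Proof.
move=> lu; have [w uE] := hloc_at_chartF lu; move: lu; rewrite uE jet_germE.
move=> lu [w0 _ lwV]; split=> //; first by rewrite fmorph_eq0.
by rewrite -fmorphV; apply/jet_stalk_chartF.
Qed.

Lemma jet_germ_sections (U : set Y) s : open U -> sections U s ->
  @sections _ J (jet_map @^-1` U) (fun x => jet_germ x (s (jet_map x))).
Proof.
move=> oU sU x Ux; have [sp near_s] := sU _ Ux; split.
  by have [w E] := hloc_at_chartF sp; move: sp; rewrite /= E jet_germE; move/jet_stalk_chartF.
have near1 : \forall y \near x, s (jet_map y) = s (jet_map x).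
  exact: (jet_map_continuous near_s).
by apply: filterS near1 => y ->.
Qed.

Definition jet_immersion : lrmorphism J Y :=
  @LRMorphism C J Y jet_map jet_germ jet_map_continuous jet_germ_cst
    jet_germB jet_germM jet_germ_local jet_germ_sections.

Lemma chart_point_ext i p q : chart_point i p = chart_point i q -> jet_pt i p = jet_pt i q.
Proof.
move=> E; apply/eqmodP/asboolP; split; first by rewrite hcoordii mxE eqxx; exact: pset1.
move=> a; rewrite trans_id max_at_frac.
have [d [P [SP <-]]] := dehom_surj i a.
by rewrite -(chart_pointE i p SP) -(chart_pointE i q SP) E.
Qed.

(** If the images agree, the second one also avoids X_i, so both points lie in the i-th chart, where
    the surjectivity of [dehom i] separates them. *)
Lemma jet_map_inj : injective jet_map.
Proof.
move=> x y; have [i [p ->]] := jet_ptP (x : jet_pts C N k).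
have [l [q ->]] := jet_ptP (y : jet_pts C N k); rewrite !jet_map_pt => E.
have qX : ~ q (hcoord C k l i 0 0).
  rewrite -dehomX => /(chart_pointE l q (diff_homogX i)); rewrite -E.
  exact: chart_point_X.
have [p' pp'] := glued_exists qX.
have -> : jet_pt l q = jet_pt i p' by apply/eqmodP/asboolP.
by apply: chart_point_ext; rewrite E; exact: chart_point_glued.
Qed.

(** The image of q under [dehom i] is a prime: homogeneous elements with the same image differ by
    powers of X_i, which lie outside q, so membership does not depend on the representative. *)
Lemma chart_point_surj i (q : proj_spec S) : ~ q (Xz i) -> exists p, chart_point i p = q.
Proof.
move=> qX.
have qXn m : ~ q (Xz i ^+ m) by move=> /(hsetX (diff_homogX i : S 1%N (Xz i))).
have SXn := piece_X i.
pose Q (a : A) := exists d P, [/\ S d P, q P & dehom i P = a].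
have QE d P : S d P -> Q (dehom i P) <-> q P.
  move=> SP; split=> [[e [P' [SP' qP' E]]]|qP]; last by exists d, P.
  have : chart_frac i (dehom i P') = chart_frac i (dehom i P) by rewrite E.
  rewrite (chart_frac_dehom i SP) (chart_frac_dehom i SP') -!tofracXn.
  have X0 m : (Xz i ^+ m)%:F != 0 :> L by rewrite tofracXn expf_neq0 ?XF_neq0.
  move=> /(frac_eqP _ _ (X0 e) (X0 d)) PX.
  have : q (P * Xz i ^+ e).
    by rewrite -PX mulrC; exact: hsetMl_piece (SXn d) qP'.
  by move=> /(hsetM_piece SP (SXn e))[|/qXn].
have Q0 : Q 0 by exists 0%N, 0; split; [exact: piece0|exact: hset0|rewrite /dehom mmap0].
have QB a b : Q a -> Q b -> Q (a - b).
  move=> [d [P [SP qP <-]]] [e [P' [SP' qP' <-]]].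
  exists (d + e)%N, (P * Xz i ^+ e - P' * Xz i ^+ d); split.
  - apply: pieceB; first exact: pieceM SP (SXn e).
    by rewrite addnC; exact: pieceM SP' (SXn d).
  - by apply: hsetB; rewrite mulrC; [exact: hsetMl_piece (SXn e) qP|exact: hsetMl_piece (SXn d) qP'].
  - by rewrite [LHS]rmorphB /= !dehomM !dehomXn !mulr1.
have QM a b : Q b -> Q (a * b).
  have [d [P [SP <-]]] := dehom_surj i a; move=> [e [P' [SP' qP' <-]]].
  exists (d + e)%N, (P * P'); split; [exact: pieceM SP SP'|exact: hsetMl_piece SP qP'|exact: dehomM].
have Q1 : ~ Q 1.
  by rewrite -(dehomXn i 0) => /(QE _ _ (SXn 0%N)) /qXn.
have QP a b : Q (a * b) -> Q a \/ Q b.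
  have [d [P [SP <-]]] := dehom_surj i a; have [e [P' [SP' <-]]] := dehom_surj i b.
  rewrite -dehomM => /(QE _ _ (pieceM SP SP')) /(hsetM_piece SP SP')[qP|qP].
    by left; apply/(QE _ _ SP).
  by right; apply/(QE _ _ SP').
exists (@PrimeSpec A Q Q0 QB QM Q1 QP).
apply: (@proj_spec_ext _ _ _ S) => d P SP.
by rewrite (chart_pointE i _ SP); exact: QE SP.
Qed.

Lemma jet_map_open (U : set J) : open U -> open (jet_map @` U).
Proof.
move=> oU; have oUi i : exists E : set A, @jet_pt C N k i @^-1` U = [set p : prime_spec A | exists2 f, E f & ~ p f].
  have : open (@jet_pt C N k i @^-1` U).
    by move/continuousP: (@jet_pt_continuous C N k i); apply.
  by move=> [E UE]; exists E.
have [E UE] := choice oUi.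
(* The factor X_i confines each open set to D_+(X_i), whose points all come from the i-th chart. *)
exists [set Q | exists i d P, [/\ S d P, E i (dehom i P) & Q = P * Xz i]]; split.
  move=> _ [i [d [P [SP _ ->]]]]; exists (d + 1)%N.
  exact: pieceM SP (diff_homogX i : S 1%N (Xz i)).
apply/seteqP; split=> q /=.
  move=> [x Ux <-]; have [i [p xE]] := jet_ptP (x : jet_pts C N k).
  have : (@jet_pt C N k i @^-1` U) p by rewrite /= -xE.
  rewrite UE => -[a Ea pa]; have [d [P [SP Pa]]] := dehom_surj i a.
  exists (P * Xz i); first by exists i, d, P; rewrite Pa.
  rewrite xE jet_map_pt => /(hsetM_piece SP (diff_homogX i : S 1%N (Xz i)))[].
    by move=> /(chart_pointE i p SP); rewrite Pa.
  exact: chart_point_X.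
move=> [_ [i [d [P [SP Ea ->]]]] qPX].
have qX : ~ hset (q : proj_spec S) (Xz i).
  move=> qX; apply: qPX; exact: (@hsetMl_piece _ _ _ S q _ _ _ SP qX).
have [p pE] := chart_point_surj qX.
exists (jet_pt i p); last by rewrite jet_map_pt.
have : (@jet_pt C N k i @^-1` U) p.
  rewrite UE; exists (dehom i P) => //= /(chart_pointE i p SP); rewrite pE => qP.
  by apply: qPX; rewrite mulrC; exact: hsetMl_piece (diff_homogX i : S 1%N (Xz i)) qP.
exact.
Qed.

Theorem jet_open_immersion : open_immersion jet_immersion.
Proof.
split; [exact: jet_map_inj|exact: jet_map_open|move=> x; split].
- by move=> u lu /=; have [w E] := hloc_at_chartF lu; rewrite E jet_germE; apply/jet_stalk_chartF; rewrite -E.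
- move=> u v /set_mem lu /set_mem lv; have [w ->] := hloc_at_chartF lu; have [z ->] := hloc_at_chartF lv.
  by rewrite /= !jet_germE => ->.
move=> w lw; exists (chF ord0 w); last exact: jet_germE.
by apply/jet_stalk_chartF.
Qed.

Theorem jet_natural : natural_map jet_immersion.
Proof.
move=> i; split.
  apply/seteqP; split=> q.
    by move=> [_ [p _ <-] <-]; rewrite /= jet_map_pt; exact: chart_point_X.
  move=> /chart_point_surj[p pE]; exists (jet_pt i p); first by exists p.
  by rewrite /= jet_map_pt.
move=> p d P SP /=; rewrite -(chart_frac_dehom i SP) -chartF_frac.
by rewrite -(chartF_transF ord0 i) jet_germE transF_comp transF_id.
Qed.

Theorem jet_dense : dense (range jet_immersion).
Proof.
have [_ irr] : irreducible_space Y.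
  apply: (@proj_irreducible _ _ _ S 1 (Xz ord0)) => //; first exact: diff_homogX.
  exact: mpolyX_neq0.
move=> U U0 oU; apply: irr => //; first by apply: jet_map_open; exact: openT.
pose Q (a : A) := a = 0; have Q0 : Q 0 by [].
have QB a b : Q a -> Q b -> Q (a - b) by move=> -> ->; rewrite /Q subr0.
have QM a b : Q b -> Q (a * b) by move=> ->; rewrite /Q mulr0.
have Q1 : ~ Q 1 by move/eqP; rewrite oner_eq0.
have QP a b : Q (a * b) -> Q a \/ Q b.
  by move/eqP; rewrite mulf_eq0 => /orP[]/eqP; [left|right].
pose x : J := jet_pt ord0 (@PrimeSpec A Q Q0 QB QM Q1 QP).
by exists (jet_map x); exists x.
Qed.

End JetMap.

(** * Projectivity *)

Section Projective.
Variables (C : fieldType) (N k : nat).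
Hypothesis charC : forall m, m.+1%:R != 0 :> C.
Local Notation n := k.+1.
Local Notation V := {mpoly C[N.+1 * k.+1]}.
Local Notation T := (minor_index N k).

(** The successor gives the index type the shape of homogeneous coordinates; the surplus index falls
    on the default of [nth], which yields a minor again. *)
Definition minor_gen (o : 'I_#|{: T}|.+1) : V :=
  jet_minor C (nth [ffun=> (0, 0)] (enum {: T}) o).

Lemma minor_gen_surj u : exists o, minor_gen o = jet_minor C u.
Proof.
have lt : (index u (enum {: T}) < #|{: T}|.+1)%N by rewrite ltnS cardE index_size.
by exists (Ordinal lt); rewrite /minor_gen /= nth_index// mem_enum.
Qed.

Lemma minor_gen_neq0 : exists o, minor_gen o != 0.
Proof.
(* All the shifts of the jet of X_0 form a triangular matrix, of determinant X_0^(k+1). *)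
pose u : T := [ffun m => (0, m)]; have [o oE] := minor_gen_surj u; exists o; rewrite oE.
rewrite /jet_minor.
have -> : minor_mx (Xmx C N k) u = leibniz (row 0 (Xmx C N k)).
  by apply/matrixP => i j; rewrite mxE ffunE.
by rewrite det_leibniz expf_neq0// !mxE; exact: mpolyX_neq0.
Qed.

Theorem PN_jet_projective : projective_variety (PN_jet C N k).
Proof.
split.
  apply: (@proj_irreducible _ _ _ (Vdiff C N k) 1 (Xvar C 0 0)) => //.
    exact: diff_homogX.
  exact: mpolyX_neq0.
have Sg o : Vdiff C N k n (minor_gen o) by exact: minor_diff_homog.
have g_gen o q a : Vdiff C N k (q * n)%N a -> exists m h, h \is (m + q).-homog /\
    minor_gen o ^+ m * a = mmap (@mpolyC (N.+1 * k.+1) C) minor_gen h.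
  by move=> Sa; exact: (minor_generated charC minor_gen_surj _ Sa).
exists #|{: T}|, (proj_map (ltn0Sn k) Sg g_gen minor_gen_neq0).
exact: proj_map_closed_immersion.
Qed.

End Projective.

Theorem corollary0p0p2 (R : realType) (N k : nat) (hN : (1 <= N)%N) :
  projective_variety (PN_jet R[i] N k) /\
  exists f : lrmorphism (jet_bundle R[i] N k) (PN_jet R[i] N k),
    [/\ open_immersion f, dense (range f) & natural_map f].
Proof.
have charC m : m.+1%:R != 0 :> R[i] by rewrite Num.Theory.pnatr_eq0.
split; first exact: PN_jet_projective.
exists (jet_immersion N k charC); split.
- exact: jet_open_immersion.
- exact: jet_dense.
- exact: jet_natural.
Qed.
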